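(* Consider any one of the three settings (annular, periodic, periodic inside $G$) described in the context, with positive flow-speed functions $a_1,a_2$. Let $I$ be a real open interval and let $\boldsymbol\lambda(t)=(\lambda_1(t),\lambda_2(t)):\mathrm{Cl}(I)\to\mathbb{R}_+^2$ be a continuous function such that $\lambda_1$ is strictly increasing and $\lambda_2$ is strictly decreasing in $I$. Let $\{\mathbf\Gamma(t)=(\Gamma_1(t),\Gamma_2(t)):t\in I\}$ be a continuously-varying, positively-ordered parametrized solution family, so that for each $t\in I$, $$|\nabla_pU(\mathbf\Gamma(t);p)|=\lambda_i(t)\,a_i(p)\quad\text{on }\Gamma_i(t),\ i=1,2 .$$ Fix $\tau\in I$ and let $\tilde{\mathbf\Gamma}=(\tilde\Gamma_1,\tilde\Gamma_2)$ be any classical solution at $\boldsymbol\lambda(\tau)$, i.e. $|\nabla U(\tilde{\mathbf\Gamma};p)|=\lambda_i(\tau)a_i(p)$ on $\tilde\Gamma_i$, $i=1,2$ (not necessarily a member of the family). If there exist values $\alpha,\beta\in I$ with $\alpha<\tau<\beta$ and $$\mathbf\Gamma(\alpha)\le\tilde{\mathbf\Gamma}\le\mathbf\Gamma(\beta),$$ then $\tilde{\mathbf\Gamma}=\mathbf\Gamma(\tau)$.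
   Context: $\mathbb{R}_+=(0,\infty)$. Annular setting: $\mathrm X$ is the family of simple closed curves in $\mathbb{R}^2$, with interior complement $D(\Gamma)$ and exterior complement $E(\Gamma)$; $\Gamma\le\Gamma'$ means $D(\Gamma)\subset D(\Gamma')$ and $\Gamma<\Gamma'$ means $\mathrm{Cl}(D(\Gamma))\subset D(\Gamma')$; $\Omega(\mathbf\Gamma)=D(\Gamma_2)\cap E(\Gamma_1)$ for $\mathbf\Gamma=(\Gamma_1,\Gamma_2)$, $\Gamma_1<\Gamma_2$. Periodic setting: fix $P>0$; $\mathrm X$ is the family of all infinite directed arcs $\Gamma$, $P$-periodic in $x$ (invariant under $(x,y)\mapsto(x+P,y)$), directed from $x=-\infty$ to $x=\infty$, whose winding number $W(\Gamma;p)$ about any $p\notin\Gamma$ is $\pm1/2$; $D_1(\Gamma)=\{W=-1/2\}$, $D_2(\Gamma)=\{W=1/2\}$ are the lower and upper complements; $\Gamma\le\Gamma'$ means $D_1(\Gamma)\subset D_1(\Gamma')$ or $D_2(\Gamma')\subset D_2(\Gamma)$; $\Gamma<\Gamma'$ means $\mathrm{Cl}(D_1(\Gamma))\subset D_1(\Gamma')$ or $\mathrm{Cl}(D_2(\Gamma'))\subset D_2(\Gamma)$; $\Omega(\mathbf\Gamma)=D_1(\Gamma_2)\cap D_2(\Gamma_1)$; the functions $a_1,a_2$ are $P$-periodic in $x$. Periodic setting inside $G$: as the periodic setting, with all curve-pairs required to satisfy $\partial^-G<\Gamma_1<\Gamma_2<\partial^+G$, where $G$ is a simply-connected $P$-periodic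 strip-like domain with interior and exterior tangent balls of uniform radius at all boundary points and $\partial^\pm G\in\mathrm X$ are its upper/lower boundary components. In each setting $\mathbf X$ denotes the set of admissible pairs $\mathbf\Gamma=(\Gamma_1,\Gamma_2)$ with $\Gamma_1<\Gamma_2$; inequalities between pairs are component-wise; $a_1,a_2:\mathbb{R}^2\to\mathbb{R}_+$ are positive $C^2$-functions; the capacitary potential $U(\mathbf\Gamma;\cdot)$ is the continuous function on $\mathrm{Cl}(\Omega(\mathbf\Gamma))$ ($P$-periodic in the periodic settings), harmonic in $\Omega(\mathbf\Gamma)$, with $U=0$ on $\Gamma_1$ and $U=1$ on $\Gamma_2$. A parametrized solution family (relative to $\boldsymbol\lambda(t)$) is a map $t\mapsto\mathbf\Gamma(t)\in\mathbf X\cap C^{3,\tilde\varrho}$ (for some $\tilde\varrho\in(0,1]$) on the open interval $I$ such that for each $t\in I$ the potential $U(\mathbf\Gamma(t);\cdot)$ is $C^1$ on the closure of $\Omega(\mathbf\Gamma(t))$ and $|\nabla_pU(\mathbf\Gamma(t);p)|=\lambda_i(t)a_i(p)$ on $\Gamma_i(t)$, $i=1,2$. It is positively-ordered if $\mathbf\Gamma(\alpha)<\mathbf\Gamma(\beta)$ whenever $\alpha<\beta$ in $I$, and continuously-varying if $\mathbf\Gamma(t)\to\mathbf\Gamma(\tau)$ in Hausdorff distance (component-wise) as $t\to\tau$, for every $\tau\in I$. A classical solution has $\nabla U$ continuous up to the boundary. *)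

(* Defs.v *)
(* The plane is the product R * R over a realType R. Its library norm is
   the sup norm, which gives the usual topology; where the metric matters, the
   Euclidean norm [enorm] is used instead. *)
From HB Require Import structures.
From mathcomp Require Import all_boot all_order all_algebra.
From mathcomp Require Import all_classical all_reals all_analysis.

Set Implicit Arguments.
Unset Strict Implicit.
Unset Printing Implicit Defensive.

Import Order.TTheory GRing.Theory Num.Theory.
Import numFieldNormedType.Exports.

Local Open Scope classical_set_scope.
Local Open Scope ring_scope.

Notation plane R := (R * R)%type (only parsing).

Definition enorm {R : realType} (p : plane R) : R :=
  Num.sqrt (p.1 ^+ 2 + p.2 ^+ 2).

Definition disc {R : realType} (c : plane R) (r : R) : set (plane R) :=
  [set p | enorm (p - c) < r].

Definition setdist {R : realType} (p : plane R) (A : set (plane R)) : \bar R :=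
  ereal_inf [set (enorm (p - q))%:E | q in A].

Definition hausdorff_dist {R : realType} (A B : set (plane R)) : \bar R :=
  maxe (ereal_sup [set setdist p B | p in A])
       (ereal_sup [set setdist q A | q in B]).

Definition e_x {R : realType} : plane R := (1, 0).
Definition e_y {R : realType} : plane R := (0, 1).

Definition grad {R : realType} (f : plane R -> R) (p : plane R) : plane R :=
  ('D_e_x f p, 'D_e_y f p).

(* Class C^k; meant for an open set A. *)
Fixpoint Ck_on {R : realType} (k : nat) (A : set (plane R))
    (f : plane R -> R) : Prop :=
  match k with
  | 0 => forall p, A p -> {for p, continuous f}
  | k'.+1 => [/\ forall p, A p -> derivable f p e_x /\ derivable f p e_y,
                 Ck_on k' A ('D_e_x f) & Ck_on k' A ('D_e_y f)]
  end.

Definition harmonic_on {R : realType} (A : set (plane R))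
    (f : plane R -> R) : Prop :=
  Ck_on 2 A f /\ forall p, A p -> 'D_e_x ('D_e_x f) p + 'D_e_y ('D_e_y f) p = 0.

(* f is C^1 in the open set A and its gradient extends to the map g, continuous
   on the closure of A; g is then unique on the closure of A. *)
Definition grad_up_to_boundary {R : realType} (A : set (plane R))
    (f : plane R -> R) (g : plane R -> plane R) : Prop :=
  [/\ Ck_on 1 A f, {within closure A, continuous g}
    & forall p, A p -> g p = grad f p].

(* Regular parametrization of class C^(3,rho). The Hoelder bound is global; the
   parametrizations below are periodic up to a translation. *)
Definition regular_C3 {R : realType} (rho : R) (g : R -> plane R) : Prop :=
  [/\ forall k : nat, (k < 3)%N -> forall s, derivable (derive1n k g) s 1,
      forall s, derive1 g s != 0
    & exists C : R, forall s s',
        enorm (derive1n 3 g s - derive1n 3 g s') <= C * `|s - s'| `^ rho].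

Definition closed_param {R : realType} (g : R -> plane R)
    (G : set (plane R)) : Prop :=
  [/\ continuous g, periodic g 1,
      forall s t, 0 <= s < 1 -> 0 <= t < 1 -> g s = g t -> s = t
    & range g = G].

Definition int_compl {R : realType} (G : set (plane R)) : set (plane R) :=
  [set p | ~ G p /\ bounded_set (connected_component (~` G) p)].

Definition ext_compl {R : realType} (G : set (plane R)) : set (plane R) :=
  [set p | ~ G p /\ ~ bounded_set (connected_component (~` G) p)].

Definition arc_param {R : realType} (g : R -> plane R)
    (G : set (plane R)) : Prop :=
  [/\ continuous g, injective g, range g = G,
      (g s).1 @[s --> -oo] --> -oo & (g s).1 @[s --> +oo] --> +oo].

(* Total increment of a continuous argument of g - p, divided by 2 pi; only
   meaningful for p off the range of g. *)
Definition winding_number {R : realType} (g : R -> plane R) (p : plane R)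
    (w : R) : Prop :=
  exists (theta : R -> R) (a b : R),
    [/\ continuous theta,
        forall s, g s - p = enorm (g s - p) *: (cos (theta s), sin (theta s)),
        theta s @[s --> -oo] --> a, theta s @[s --> +oo] --> b
      & w = (b - a) / (2 * pi)].

(* All directed parametrizations of an arc agree up to an increasing change of
   variable, so the winding number does not depend on the choice of g. *)
Definition arc_winding {R : realType} (G : set (plane R)) (p : plane R)
    (w : R) : Prop :=
  ~ G p /\ exists2 g, arc_param g G & winding_number g p w.

Definition lower_compl {R : realType} (G : set (plane R)) : set (plane R) :=
  [set p | arc_winding G p (- 2^-1)].

Definition upper_compl {R : realType} (G : set (plane R)) : set (plane R) :=
  [set p | arc_winding G p 2^-1].

Definition xperiodic_set {R : realType} (P : R) (A : set (plane R)) : Prop :=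
  [set p + (P, 0) | p in A] = A.

Definition periodic_arc {R : realType} (P : R) (G : set (plane R)) : Prop :=
  [/\ exists g, arc_param g G, xperiodic_set P G
    & forall p, ~ G p -> arc_winding G p (- 2^-1) \/ arc_winding G p 2^-1].

Definition periodic_le {R : realType} (G G' : set (plane R)) : Prop :=
  lower_compl G `<=` lower_compl G' \/ upper_compl G' `<=` upper_compl G.

Definition periodic_lt {R : realType} (G G' : set (plane R)) : Prop :=
  closure (lower_compl G) `<=` lower_compl G' \/
  closure (upper_compl G') `<=` upper_compl G.

Definition loop_in {R : realType} (A : set (plane R)) (g : R -> plane R) :=
  [/\ {within `[0, 1], continuous g}, g 0 = g 1
    & forall s, 0 <= s <= 1 -> A (g s)].

Definition simply_connected {R : realType} (A : set (plane R)) : Prop :=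
  (forall p q, A p -> A q -> exists g : R -> plane R,
     [/\ {within `[0, 1], continuous g}, g 0 = p, g 1 = q
       & forall s, 0 <= s <= 1 -> A (g s)]) /\
  (forall g, loop_in A g -> exists H : R * R -> plane R,
     [/\ {within `[0, 1] `*` `[0, 1], continuous H},
         forall t s, 0 <= t <= 1 -> 0 <= s <= 1 -> A (H (t, s)),
         forall s, 0 <= s <= 1 -> H (0, s) = g s,
         forall s, 0 <= s <= 1 -> H (1, s) = g 0
       & forall t, 0 <= t <= 1 -> H (t, 0) = g 0 /\ H (t, 1) = g 0]).

Definition uniform_tangent_balls {R : realType} (G : set (plane R)) : Prop :=
  exists2 r : R, 0 < r & forall p, (closure G `\` G^°) p ->
    (exists2 c, enorm (p - c) = r & disc c r `<=` G) /\
    (exists2 c, enorm (p - c) = r & disc c r `<=` ~` G).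

(* G is the region between its lower and upper boundary arcs Gm and Gp. *)
Definition strip_domain {R : realType} (P : R) (G Gm Gp : set (plane R)) :
    Prop :=
  [/\ [/\ open G, simply_connected G, xperiodic_set P G
        & uniform_tangent_balls G],
      [/\ periodic_arc P Gm, periodic_arc P Gp & periodic_lt Gm Gp],
      closure G `\` G^° = Gm `|` Gp
    & G = lower_compl Gp `&` upper_compl Gm].

Inductive setting (R : realType) : Type :=
  | Annular
  | Periodic of R
  | PeriodicIn of R & set (plane R) & set (plane R) & set (plane R).

Arguments Annular {R}.

Definition valid_setting {R : realType} (S : setting R) : Prop :=
  match S with
  | Annular => True
  | Periodic P => 0 < P
  | PeriodicIn P G Gm Gp => 0 < P /\ strip_domain P G Gm Gp
  end.

Definition curve {R : realType} (S : setting R) (G : set (plane R)) : Prop :=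
  match S with
  | Annular => exists g, closed_param g G
  | Periodic P | PeriodicIn P _ _ _ => periodic_arc P G
  end.

Definition curve_C3 {R : realType} (S : setting R) (rho : R)
    (G : set (plane R)) : Prop :=
  match S with
  | Annular => exists2 g, closed_param g G & regular_C3 rho g
  | Periodic P | PeriodicIn P _ _ _ =>
      exists g, [/\ arc_param g G, forall s, g (s + 1) = g s + (P, 0)
                  & regular_C3 rho g]
  end.

Definition compl1 {R : realType} (S : setting R) (G : set (plane R)) :
    set (plane R) :=
  if S is Annular then int_compl G else lower_compl G.

Definition compl2 {R : realType} (S : setting R) (G : set (plane R)) :
    set (plane R) :=
  if S is Annular then ext_compl G else upper_compl G.

Definition curve_le {R : realType} (S : setting R) (G G' : set (plane R)) :
    Prop :=
  if S is Annular then int_compl G `<=` int_compl G' else periodic_le G G'.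

Definition curve_lt {R : realType} (S : setting R) (G G' : set (plane R)) :
    Prop :=
  if S is Annular then closure (int_compl G) `<=` int_compl G'
  else periodic_lt G G'.

Definition fun_periodic {R : realType} (S : setting R) (A : set (plane R))
    (f : plane R -> R) : Prop :=
  match S with
  | Annular => True
  | Periodic P | PeriodicIn P _ _ _ => forall p, A p -> f (p + (P, 0)) = f p
  end.

Notation curve_pair R := (set (plane R) * set (plane R))%type (only parsing).

Definition admissible {R : realType} (S : setting R) (G : curve_pair R) :
    Prop :=
  [/\ curve S G.1, curve S G.2, curve_lt S G.1 G.2
    & if S is PeriodicIn _ _ Gm Gp then
        curve_lt S Gm G.1 /\ curve_lt S G.2 Gp
      else True].

Definition pair_le {R : realType} (S : setting R) (G G' : curve_pair R) :=
  curve_le S G.1 G'.1 /\ curve_le S G.2 G'.2.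

Definition pair_lt {R : realType} (S : setting R) (G G' : curve_pair R) :=
  curve_lt S G.1 G'.1 /\ curve_lt S G.2 G'.2.

Definition Omega {R : realType} (S : setting R) (G : curve_pair R) :
    set (plane R) :=
  compl1 S G.2 `&` compl2 S G.1.

(* U is the capacitary potential of G; its values off the closure of Omega are
   irrelevant. *)
Definition capacitary_potential {R : realType} (S : setting R)
    (G : curve_pair R) (U : plane R -> R) : Prop :=
  [/\ {within closure (Omega S G), continuous U},
      fun_periodic S (closure (Omega S G)) U,
      harmonic_on (Omega S G) U,
      forall p, G.1 p -> U p = 0
    & forall p, G.2 p -> U p = 1].

Definition flow_speed {R : realType} (S : setting R) (a : plane R -> R) :
    Prop :=
  [/\ forall p, 0 < a p, Ck_on 2 setT a & fun_periodic S setT a].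

Definition classical_solution {R : realType} (S : setting R)
    (a1 a2 : plane R -> R) (lam : R * R) (G : curve_pair R) : Prop :=
  admissible S G /\
  exists (U : plane R -> R) (gradU : plane R -> plane R),
    [/\ capacitary_potential S G U,
        grad_up_to_boundary (Omega S G) U gradU,
        forall p, G.1 p -> enorm (gradU p) = lam.1 * a1 p
      & forall p, G.2 p -> enorm (gradU p) = lam.2 * a2 p].

Definition solution_family {R : realType} (S : setting R)
    (a1 a2 : plane R -> R) (I : set R) (lam : R -> R * R)
    (G : R -> curve_pair R) : Prop :=
  (exists2 rho : R, 0 < rho <= 1 &
     forall t, I t -> curve_C3 S rho (G t).1 /\ curve_C3 S rho (G t).2) /\
  forall t, I t -> classical_solution S a1 a2 (lam t) (G t).

Definition positively_ordered {R : realType} (S : setting R) (I : set R)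
    (G : R -> curve_pair R) : Prop :=
  forall s t, I s -> I t -> s < t -> pair_lt S (G s) (G t).

Definition continuously_varying {R : realType} (I : set R)
    (G : R -> curve_pair R) : Prop :=
  forall t, I t ->
    hausdorff_dist (G s).1 (G t).1 @[s --> t] --> 0%E /\
    hausdorff_dist (G s).2 (G t).2 @[s --> t] --> 0%E.

(* Main.v *)
Require Import Defs.
From HB Require Import structures.
From mathcomp Require Import all_boot all_order all_algebra.
From mathcomp Require Import all_classical all_reals all_analysis.
From mathcomp Require Import ring lra zify.

Set Implicit Arguments.
Unset Strict Implicit.
Unset Printing Implicit Defensive.

Import Order.TTheory GRing.Theory Num.Theory.
Import numFieldNormedType.Exports.

Local Open Scope classical_set_scope.
Local Open Scope ring_scope.

(* Start from the member at [alpha], where the order with the fixed solution [tGam]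
   is known, and let [t] increase to [tau]. Where the order holds, the maximum
   principle on [D(Gam_2(t)) `&` E(tGam_1)] gives [U(Gam(t)) >= U(tGam)]. At a point
   common to [Gam_1(t)] and [tGam_1] this yields [|grad U(Gam(t))| >= |grad U(tGam)|],
   against [lambda_1(t) < lambda_1(tau)]; a contact on the outer curves yields the
   opposite inequality, against [lambda_2(t) > lambda_2(tau)]. Without contact, the
   order persists for nearby parameters, so it holds up to [tau]. Descending from
   [beta] gives the converse order.

   Continuation needs that the complementary sides of a curve are connected and
   have the whole curve as boundary. This rests on Borsuk's criterion: a
   closed set [K] on which [(z - a) / (z - c)] has a continuous argument, small at
   infinity, does not separate [a] from [c]; and if [K] is compact and [a] is
   in a bounded component without [c], then [(z - a)^n / (z - c)^m] has a continuous
   argument on [K] only for [n = 0]. *)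

(** * Arguments of plane vectors *)
Section PlaneVectors.
Context {R : realType}.
Implicit Types (u v w p : R * R) (x y t s : R).

(** The fixed solution is only classical, so at a contact its curve need not admit a tangent ball
    and the Hopf lemma is not at hand. Strict monotonicity of [lam] takes its place: a strict gap
    between two boundary gradients is refuted along one straight segment, using only their
    continuity up to the boundary. All geometry is stated for a curve with two abstract sides, which
    covers closed curves and periodic arcs at once. Exchanging the sides and replacing [U] by
    [1 - U] turns outer contacts into inner ones; exchanging the sides also turns the descent from
    [beta] into an ascent. Connectedness of a side takes the form: a non-empty open part whose
    closure adds only points of the curve is the whole side. Borsuk's criterion proves exactly this,
    and both halves of the continuation consume it. Turning numbers are compared by one device: if
    two moving vectors are never opposite, their continuous arguments keep within [pi] of a fixed
    multiple of [2 * pi]. That a closed curve has an interior is obtained separately, from a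
    non-zero derivative of the members; [tGam] inherits it from [Gam alpha]. *)

Definition dot u v : R := u.1 * v.1 + u.2 * v.2.
Definition cross u v : R := u.1 * v.2 - u.2 * v.1.
Definition cis t : R * R := (cos t, sin t).
(** The zero vector has every real as an argument, so uniqueness modulo full turns is stated for
    non-zero vectors only. *)
Definition argument t u : Prop := u = enorm u *: cis t.

Lemma plane_eq u v : u.1 = v.1 -> u.2 = v.2 -> u = v.
Proof. by case: u v => [? ?] [? ?] /= -> ->. Qed.

Lemma enorm_ge0 u : 0 <= enorm u. Proof. exact: sqrtr_ge0. Qed.

Lemma enorm_sqr u : enorm u ^+ 2 = u.1 ^+ 2 + u.2 ^+ 2.
Proof. by rewrite sqr_sqrtr // addr_ge0 // sqr_ge0. Qed.

Lemma enorm_gt0 u : (0 < enorm u) = (u != 0).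
Proof.
rewrite lt_neqAle enorm_ge0 andbT eq_sym -(inj_eq (@addrI _ 0)) !add0r.
apply/idP/idP.
  by apply: contraNneq => ->; rewrite -sqrf_eq0 enorm_sqr /= expr0n /= addr0.
apply: contraNneq => /eqP; rewrite -sqrf_eq0 enorm_sqr.
rewrite paddr_eq0 ?sqr_ge0 // !sqrf_eq0 => /andP[/eqP u1 /eqP u2].
by apply/eqP/plane_eq.
Qed.

Lemma enorm0 : enorm (0 : R * R) = 0.
Proof. by apply/eqP; rewrite -sqrf_eq0 enorm_sqr /= expr0n /= addr0. Qed.

Lemma enormZ x u : enorm (x *: u) = `|x| * enorm u.
Proof.
apply/eqP; rewrite -(@eqrXn2 _ 2) ?enorm_ge0 ?mulr_ge0 ?enorm_ge0 //.
rewrite exprMn !enorm_sqr /= real_normK ?num_real //; apply/eqP.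
by rewrite /GRing.scale /=; ring.
Qed.

Lemma enormN u : enorm (- u) = enorm u.
Proof. by rewrite /enorm /= !sqrrN. Qed.

Lemma enorm_distC u v : enorm (u - v) = enorm (v - u).
Proof. by rewrite -enormN opprB. Qed.

Lemma dot_le u v : dot u v <= enorm u * enorm v.
Proof.
have H : dot u v ^+ 2 <= (enorm u * enorm v) ^+ 2.
  rewrite exprMn !enorm_sqr -subr_ge0.
  suff -> : (u.1 ^+ 2 + u.2 ^+ 2) * (v.1 ^+ 2 + v.2 ^+ 2) - dot u v ^+ 2 =
    cross u v ^+ 2 by rewrite sqr_ge0.
  by rewrite /dot /cross; ring.
have := ger0_norm (mulr_ge0 (enorm_ge0 u) (enorm_ge0 v)).
move: H; rewrite -ler_sqrt ?sqr_ge0 // !sqrtr_sqr => H <-.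
by apply: le_trans H; rewrite ler_norm.
Qed.

Lemma dotN_le u v : - (enorm u * enorm v) <= dot u v.
Proof.
have := dot_le (- u) v; rewrite enormN => H.
by rewrite lerNl (le_trans _ H) // /dot /=; lra.
Qed.

Lemma dotvv u : dot u u = enorm u ^+ 2.
Proof. by rewrite enorm_sqr /dot !expr2. Qed.

Lemma enormD u v : enorm (u + v) <= enorm u + enorm v.
Proof.
rewrite -(@ler_pXn2r _ 2) ?nnegrE ?addr_ge0 ?enorm_ge0 //.
rewrite sqrrD !enorm_sqr; have := dot_le u v; rewrite /dot /=; lra.
Qed.

Lemma enorm_cis t : enorm (cis t) = 1.
Proof. by rewrite /enorm /= cos2Dsin2 sqrtr1. Qed.

Lemma normr_le_enorm u : `|u| <= enorm u.
Proof.
have h x : x ^+ 2 <= enorm u ^+ 2 -> `|x| <= enorm u.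
  by move=> hx; rewrite -(@ler_pXn2r _ 2) ?nnegrE ?enorm_ge0 // real_normK ?num_real.
by rewrite prod_normE ge_max !h // enorm_sqr ?lerDl ?lerDr sqr_ge0.
Qed.

Lemma enorm_le_normr u : enorm u <= 2 * `|u|.
Proof.
have h1 : `|u.1| <= `|u| by rewrite prod_normE le_max lexx.
have h2 : `|u.2| <= `|u| by rewrite prod_normE le_max lexx orbT.
have hu : u = u.1 *: (1, 0) + u.2 *: (0, 1).
  by apply: plane_eq; rewrite /= /GRing.scale /=; ring.
rewrite [in X in X <= _]hu; apply: le_trans (enormD _ _) _; rewrite !enormZ.
have -> : enorm ((1, 0) : R * R) = 1.
  by rewrite /enorm /= expr1n expr0n /= addr0 sqrtr1.
have -> : enorm ((0, 1) : R * R) = 1.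
  by rewrite /enorm /= expr1n expr0n /= add0r sqrtr1.
lra.
Qed.

Lemma norm1_le_enorm u : `|u.1| <= enorm u.
Proof. by apply: le_trans (normr_le_enorm u); rewrite prod_normE le_max lexx. Qed.

Lemma dot_argument t s u v : argument t u -> argument s v ->
  dot u v = enorm u * enorm v * cos (s - t).
Proof.
rewrite /argument => hu hv; rewrite {1}hu {1}hv /dot /= /GRing.scale /= cosB; ring.
Qed.

Lemma cross_argument t s u v : argument t u -> argument s v ->
  cross u v = enorm u * enorm v * sin (s - t).
Proof.
rewrite /argument => hu hv; rewrite {1}hu {1}hv /cross /= /GRing.scale /= sinB; ring.
Qed.

Lemma sin_atan x : sin (atan x) = x * (Num.sqrt (1 + x ^+ 2))^-1.
Proof.
rewrite -cos_atan -[X in X * _]atanK /tan -mulrA mulVf ?mulr1 //.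
by rewrite cos_atan invr_eq0 sqrtr_eq0 -ltNge ltr_pwDl // sqr_ge0.
Qed.

(** In the half plane [0 < dot u v] the angle from [u] to [v] lies strictly between [- pi / 2] and
    [pi / 2], so it is the arctangent of its slope. This explicit branch is the source of all
    continuous local arguments below. *)
Lemma argument_atan t u v : argument t u -> 0 < dot u v ->
  argument (t + atan (cross u v / dot u v)) v.
Proof.
move=> hu duv.
have u0 : 0 < enorm u.
  rewrite enorm_gt0; apply: contraTneq duv => ->.
  by rewrite /dot /= !mul0r addr0 ltxx.
set x := cross u v / dot u v.
have hx : x * dot u v = cross u v by rewrite /x divfK // gt_eqF.
have s0 : 0 < Num.sqrt (1 + x ^+ 2) by rewrite sqrtr_gt0 ltr_pwDl // sqr_ge0.
have hS : Num.sqrt (1 + x ^+ 2) * dot u v = enorm u * enorm v.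
  apply/eqP; rewrite -(@eqrXn2 _ 2) ?mulr_ge0 ?enorm_ge0 ?ltW //.
  have h1 : 0 <= 1 + x ^+ 2 by rewrite addr_ge0 // sqr_ge0.
  rewrite exprMn sqr_sqrtr // mulrDl mul1r -exprMn hx exprMn !enorm_sqr.
  by rewrite /dot /cross; apply/eqP; ring.
set S := Num.sqrt _ in s0 hS.
rewrite /argument /cis cosD sinD cos_atan sin_atan -/S.
have hd : enorm v = S * dot u v / enorm u by rewrite hS mulrC mulKf // gt_eqF.
have cE : u.1 = enorm u * cos t by rewrite [in LHS]hu.
have sE : u.2 = enorm u * sin t by rewrite [in LHS]hu.
have ct : cos t = u.1 / enorm u by rewrite cE mulrC mulKf // gt_eqF.
have st : sin t = u.2 / enorm u by rewrite sE mulrC mulKf // gt_eqF.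
have key1 : enorm u ^+ 2 * v.1 = dot u v * u.1 - cross u v * u.2.
  by rewrite enorm_sqr /dot /cross; ring.
have key2 : enorm u ^+ 2 * v.2 = dot u v * u.2 + cross u v * u.1.
  by rewrite enorm_sqr /dot /cross; ring.
rewrite hd ct st.
have e0 : enorm u != 0 by rewrite gt_eqF.
have S0 : S != 0 by rewrite gt_eqF.
apply: plane_eq; rewrite /= /GRing.scale /=.
  apply: (mulfI (expf_neq0 2 e0)); rewrite key1 -hx.
  by field; rewrite e0 S0.
apply: (mulfI (expf_neq0 2 e0)); rewrite key2 -hx.
by field; rewrite e0 S0.
Qed.

Lemma argument_ex u : exists t, argument t u.
Proof.
have [->|u0] := eqVneq u 0; first by exists 0; rewrite /argument enorm0 scale0r.
have e0 : 0 < enorm u by rewrite enorm_gt0.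
set c := u.1 / enorm u.
have c1 : -1 <= c <= 1.
  by rewrite -ler_norml normrM normfV (ger0_norm (enorm_ge0 u)) ler_pdivrMr // mul1r norm1_le_enorm.
have hc : u.1 = enorm u * c by rewrite /c mulrC divfK // gt_eqF.
have c2 : 0 <= 1 - c ^+ 2 by nra.
have hs : enorm u * Num.sqrt (1 - c ^+ 2) = `|u.2|.
  apply/eqP; rewrite -(@eqrXn2 _ 2) ?mulr_ge0 ?enorm_ge0 ?sqrtr_ge0 //.
  rewrite exprMn (sqr_sqrtr c2) mulrBr mulr1 -exprMn -hc real_normK ?num_real //.
  by rewrite enorm_sqr; apply/eqP; ring.
have [p|n] := leP 0 u.2.
  exists (acos c); apply: plane_eq; rewrite /= /GRing.scale /=.
    by rewrite acosK // in_itv.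
  by rewrite sin_acos // hs ger0_norm.
exists (- acos c); apply: plane_eq; rewrite /= /GRing.scale /=.
  by rewrite cosN acosK // in_itv.
by rewrite sinN sin_acos // mulrN hs ltr0_norm // opprK.
Qed.

Lemma cisDnatpi (n : nat) x : cis (x + n%:R * (2 * pi)) = cis x.
Proof.
elim: n => [|n IH]; first by rewrite mul0r addr0.
rewrite -[RHS]IH; apply: plane_eq => /=.
  by rewrite -[RHS]cosD2pi; congr cos; rewrite -natr1; ring.
by rewrite -[RHS]sinD2pi; congr sin; rewrite -natr1; ring.
Qed.

Lemma cisDzpi (n : int) x : cis (x + n%:~R * (2 * pi)) = cis x.
Proof.
case: n => n; first exact: cisDnatpi.
rewrite -[LHS](cisDnatpi n.+1) NegzE; congr cis.
by rewrite mulrNz -!pmulrn; ring.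
Qed.

Lemma cos_eqN1 x : cos x = -1 -> exists n : int, x = pi + n%:~R * (2 * pi).
Proof.
move=> cx.
pose n := Num.floor (x / (2 * pi)); have p0 := @pi_gt0 R.
have pp : 0 < 2 * pi :> R by rewrite mulr_gt0.
pose y := x + (- n)%:~R * (2 * pi).
have hy : cos y = -1 by rewrite -cx; have [] := cisDzpi (- n) x.
have y1 : 0 <= y < 2 * pi.
  have := floor_itv (x / (2 * pi)); rewrite -/n => /andP[].
  rewrite ler_pdivlMr // ltr_pdivrMr // intrD mulrDl mul1r => h1 h2.
  by rewrite /y mulrNz mulNr; lra.
exists n; suff h : pi = y by rewrite [X in X + _]h /y mulrNz mulNr subrK.
have [le|gt] := leP y pi.
  by apply/esym/cos_inj; rewrite ?in_itv /= ?pi_ge0 ?lexx ?hy ?cospi //; case/andP: y1 => -> _.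
have hz : cos (2 * pi - y) = -1.
  rewrite -hy -[RHS]cosN -[RHS](cosD2pi (- y)); congr cos; ring.
have : pi = 2 * pi - y.
  apply/esym/cos_inj; rewrite ?in_itv /= ?pi_ge0 ?lexx ?hz ?cospi //; lra.
lra.
Qed.

Lemma cis_eq1 x : cos x = 1 -> exists n : int, x = n%:~R * (2 * pi).
Proof.
move=> cx; have /cos_eqN1[n hn] : cos (x + pi) = -1 by rewrite cosDpi cx.
by exists n; move: hn; lra.
Qed.

Lemma argument_unique t s u : u != 0 -> argument t u -> argument s u ->
  exists n : int, t - s = n%:~R * (2 * pi).
Proof.
move=> u0 ht hs; apply: cis_eq1.
have := dot_argument hs ht; rewrite dotvv expr2 -{1}[enorm u * enorm u]mulr1.
by move/mulfI => ->//; rewrite mulf_neq0 // gt_eqF // enorm_gt0.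
Qed.

(** By the intermediate value theorem [d] cannot cross an odd multiple of [pi], where the cosine is
    -1; it stays in the band between two consecutive ones. *)
Lemma leash (J : set R) (d : R -> R) : is_interval J -> continuous d ->
  (forall s, J s -> cos (d s) != -1) ->
  exists n : int, forall s, J s -> `|d s - n%:~R * (2 * pi)| < pi.
Proof.
move=> iJ cd hJ; have [[s0 Js0]|J0] := pselect (J !=set0); last first.
  by exists 0 => s Js; exfalso; apply: J0; exists s.
(* The shift by [pi] makes [n] the index of the band centred at [n%:~R * (2 * pi)] that contains
   [d s0]. *)
pose n := Num.floor ((d s0 + pi) / (2 * pi)); have p0 := @pi_gt0 R.
have pp : 0 < 2 * pi :> R by rewrite mulr_gt0.
have := floor_itv ((d s0 + pi) / (2 * pi)); rewrite -/n => /andP[].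
rewrite ler_pdivlMr // ltr_pdivrMr // intrD mulrDl mul1r => h1 h2.
have bad (m : int) s : J s -> d s <> pi + m%:~R * (2 * pi).
  move=> Js e; have /negP := hJ s Js; apply; apply/eqP.
  by rewrite e; have [-> _] := cisDzpi m pi; rewrite cospi.
have ivt (m : int) s : J s ->
    Num.min (d s0) (d s) <= pi + m%:~R * (2 * pi) <= Num.max (d s0) (d s) -> False.
  move=> Js hm; have cw a b : {within `[a, b], continuous d}.
    exact: continuous_subspaceT.
  have [le|/ltW le] := leP s0 s.
    have [c + e] := IVT le (cw _ _) hm.
    by rewrite in_itv /= => cI; apply: (bad m c _ e); apply: (iJ s0 s).
  rewrite minC maxC in hm; have [c + e] := IVT le (cw _ _) hm.
  by rewrite in_itv /= => cI; apply: (bad m c _ e); apply: (iJ s s0).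
exists n => s Js; rewrite ltr_norml; apply/andP; split; rewrite ltNge; apply/negP => hb.
  apply: (ivt (n - 1) s) => //; rewrite intrD mulrDl ge_min le_max.
  rewrite mulN1r; apply/andP; split; apply/orP; [right|left]; lra.
apply: (ivt n s) => //; rewrite ge_min le_max.
apply/andP; split; apply/orP; [left|right]; lra.
Qed.

End PlaneVectors.

(** * Continuity of maps into the plane *)

Lemma continuous_pt (T U : topologicalType) (f : T -> U) :
  (forall s, {for s, continuous f}) -> continuous f.
Proof. by []. Qed.

Section Continuity.
Context {R : realType} {T : topologicalType}.
Implicit Types (f g : T -> R * R) (h k : T -> R) (x : T).

Lemma continuous_at_fst f x : {for x, continuous f} ->
  {for x, continuous (fun s => (f s).1)}.
Proof. by move=> cf; apply: cvg_comp cf _; exact: cvg_fst. Qed.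

Lemma continuous_at_snd f x : {for x, continuous f} ->
  {for x, continuous (fun s => (f s).2)}.
Proof. by move=> cf; apply: cvg_comp cf _; exact: cvg_snd. Qed.

Lemma continuous_at_pair h k x : {for x, continuous h} -> {for x, continuous k} ->
  {for x, continuous (fun s => (h s, k s))}.
Proof. by move=> ch ck; exact: (cvg_pair ch ck). Qed.

Lemma continuous_at_dot f g x : {for x, continuous f} -> {for x, continuous g} ->
  {for x, continuous (fun s => dot (f s) (g s))}.
Proof.
move=> cf cg; apply: (@continuousD _ R T); apply: (@continuousM R T);
  by [exact: continuous_at_fst|exact: continuous_at_snd].
Qed.

Lemma continuous_at_cross f g x : {for x, continuous f} -> {for x, continuous g} ->
  {for x, continuous (fun s => cross (f s) (g s))}.
Proof.
move=> cf cg; apply: (@continuousB _ R T); apply: (@continuousM R T);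
  by [exact: continuous_at_fst|exact: continuous_at_snd].
Qed.

Lemma continuous_at_enorm f x : {for x, continuous f} ->
  {for x, continuous (fun s => enorm (f s))}.
Proof.
move=> cf; apply: (continuous_comp (f := fun s => (f s).1 ^+ 2 + (f s).2 ^+ 2)
  (g := Num.sqrt)); last exact: sqrt_continuous.
apply: (@continuousD _ R T); apply: (@continuousM R T);
  by [exact: continuous_at_fst|exact: continuous_at_snd].
Qed.

Lemma continuous_at_cis h x : {for x, continuous h} ->
  {for x, continuous (fun s => cis (h s))}.
Proof.
move=> ch; apply: continuous_at_pair; apply: continuous_comp => //.
  exact: continuous_cos.
exact: continuous_sin.
Qed.

Lemma continuous_at_atan_slope f g x : {for x, continuous f} ->
  {for x, continuous g} -> dot (f x) (g x) != 0 ->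
  {for x, continuous (fun s => atan (cross (f s) (g s) / dot (f s) (g s)))}.
Proof.
move=> cf cg d0; apply: continuous_comp; last exact: continuous_atan.
apply: (@continuousM R T); first exact: continuous_at_cross.
apply: (@continuousV R T) => //; exact: continuous_at_dot.
Qed.

End Continuity.

(** * Continuous arguments along a path *)

Section Lifting.
Context {R : realType}.
Implicit Types (f : R -> R * R) (s t a b : R).

Lemma continuous_clamp a b : continuous (fun s : R => Num.max a (Num.min b s)).
Proof.
move=> s; apply: (@continuous_max R R (fun=> a) (fun s => Num.min b s)).
  exact: cst_continuous.
apply: (@continuous_min R R (fun=> b) id); first exact: cst_continuous.
exact: id.
Qed.

Lemma clamp_id a b s : a <= s <= b -> Num.max a (Num.min b s) = s.
Proof. by case/andP => h1 h2; rewrite (min_idPr h2) (max_idPr h1). Qed.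

Lemma clamp_itv a b s : a <= b -> a <= Num.max a (Num.min b s) <= b.
Proof. by move=> ab; rewrite le_max lexx ge_max ab ge_min lexx. Qed.

(** The arctangent branch centred at [f t] is valid on all of [[s0, s1]]; adding the constant
    [th s0 - loc s0] makes it continue [th] past [s0]. *)
Lemma argument_extend f a s0 t s1 (th : R -> R) : continuous f -> continuous th ->
  a <= s0 -> s0 <= s1 -> (forall s, a <= s <= s0 -> argument (th s) (f s)) ->
  (forall s, s0 <= s <= s1 -> 0 < dot (f t) (f s)) ->
  exists2 th' : R -> R, continuous th' &
    forall s, a <= s <= s1 -> argument (th' s) (f s).
Proof.
move=> cf cth as0 s01 ha hd.
pose loc s := atan (cross (f t) (f s) / dot (f t) (f s)).
have a0 : argument (th s0) (f s0) by apply: ha; rewrite as0 lexx.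
have h0 : 0 < dot (f t) (f s0) by apply: hd; rewrite lexx.
have aloc s : s0 <= s <= s1 -> argument (th s0 - loc s0 + loc s) (f s).
  move=> hs; apply: argument_atan; last exact: hd.
  rewrite /loc -atanN.
  have -> : - (cross (f t) (f s0) / dot (f t) (f s0)) =
     cross (f s0) (f t) / dot (f s0) (f t).
    by rewrite -mulNr; congr (_ / _); rewrite /cross /dot; ring.
  apply: argument_atan => //; move: h0; rewrite /dot; lra.
(* Clamping keeps the slope at parameters where its denominator is positive, so the glued function
   is continuous on the whole line. *)
pose c s := Num.max s0 (Num.min s1 s).
exists (fun s => th (Num.min s0 s) + (loc (c s) - loc s0)).
  apply: continuous_pt => s; apply: (@continuousD _ R R).
    apply: (continuous_comp (f := fun s => Num.min s0 s) (g := th)); last exact: cth.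
    apply: (@continuous_min R R (fun=> s0) id); first exact: cst_continuous.
    exact: id.
  apply: (@continuousB _ R R); last exact: cst_continuous.
  apply: (continuous_comp (f := c) (g := loc)); first exact: continuous_clamp.
  apply: continuous_at_atan_slope; [exact: cst_continuous|exact: cf|].
  by rewrite gt_eqF // hd // clamp_itv.
move=> s /andP[h1 h2]; have [le|/ltW le] := leP s s0.
  rewrite /c.
  have -> : Num.max s0 (Num.min s1 s) = s0.
    by apply/max_idPl; rewrite ge_min le orbT.
  by rewrite subrr addr0; apply: ha; rewrite h1.
rewrite /c clamp_id ?le ?h2 //.
by rewrite addrA addrAC; apply: aloc; rewrite le.
Qed.

(** A supremum argument on the right ends up to which an argument exists: near the supremum [t], one
    branch centred at [f t] covers both sides of [t]. *)
Lemma lift_argument f a b : a <= b -> continuous f ->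
  (forall s, a <= s <= b -> f s != 0) ->
  exists2 th : R -> R, continuous th &
    forall s, a <= s <= b -> argument (th s) (f s).
Proof.
move=> ab cf f0.
pose S := [set t | a <= t <= b /\ exists2 th : R -> R, continuous th &
    forall s, a <= s <= t -> argument (th s) (f s)].
have Sa : S a.
  split; first by rewrite lexx.
  have [t0 h0] := argument_ex (f a); exists (fun=> t0); first exact: cst_continuous.
  by move=> s; rewrite -eq_le => /eqP <-.
have hS : has_sup S by split; [exists a|exists b => s [/andP[]]].
have ha : a <= sup S by apply: ub_le_sup => //; case: hS.
have hb : sup S <= b by apply: ge_sup => [|s [/andP[]]//]; exists a.
set t := sup S in ha hb.
have : {for t, continuous (fun s => dot (f t) (f s))}.
  by apply: continuous_at_dot; [exact: cst_continuous|exact: cf].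
have d0 : 0 < dot (f t) (f t).
  by rewrite dotvv exprn_gt0 // enorm_gt0 f0 // ha.
move=> /cvgr_gt /(_ _ d0) /nbhs_ballP[e /= e0 he].
have hd s : t - e < s < t + e -> 0 < dot (f t) (f s).
  by move=> hs; apply: he; rewrite /ball /= ltr_norml; lra.
have [s0 Ss0 hs0] := sup_adherent e0 hS; rewrite -/t in hs0.
have s0t : s0 <= t by apply: ub_le_sup => //; case: hS.
case: (Ss0) => /andP[as0 s0b] [th cth hth].
(* [s1] exceeds [t] unless it is [b]; since it is shown to lie in [S], it must be [b]. *)
pose s1 := Num.min b (t + e / 2).
have s01 : s0 <= s1 by rewrite le_min s0b; lra.
have s1e : s1 < t + e by rewrite gt_min; apply/orP; right; lra.
have [|th' cth' hth'] := @argument_extend f a s0 t s1 th cf cth as0 s01 hth.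
  by move=> s hs; apply: hd; lra.
have Ss1 : S s1.
  split; last by exists th'.
  by rewrite (le_trans as0 s01) ge_min lexx.
have : s1 <= t by apply: ub_le_sup => //; case: hS.
rewrite ge_min => /orP[bt|]; last by lra.
have sb : s1 = b by apply: min_l; lra.
by exists th' => //; rewrite -sb.
Qed.

End Lifting.

(** * Compactness, connectedness and extension of functions *)

Section Topology.
Context {R : realType}.

Lemma bounded_closed_compact_plane (A : set (R * R)) M : closed A ->
  (forall p, A p -> `|p| <= M) -> compact A.
Proof.
move=> cA hA; apply: (subclosed_compact cA (B := `[- M, M] `*` `[- M, M])).
  by apply: compact_setX; exact: segment_compact.
by move=> p /hA; rewrite prod_normE ge_max !ler_norml /= !in_itv => /andP[].
Qed.

(** A property that is locally constant along [C] is clopen in [C]. It carries turning numbers over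
    an interval of radii and over a component of a complement. *)
Lemma connected_locally_invariant (T : topologicalType) (C : set T)
    (P : T -> Prop) x : connected C -> C x -> P x ->
  (forall y, C y -> \forall z \near y, C z -> (P y <-> P z)) ->
  forall y, C y -> P y.
Proof.
move=> cC Cx Px hP; suff : C `&` P = C by move=> + y Cy => /seteqP[_ /(_ y Cy)[]].
apply: cC; first by exists x.
  exists [set y | C y -> P y]°; first exact: open_interior.
  apply/seteqP; split => y [Cy h]; split => //; last exact: (interior_subset h).
  by apply: filterS (hP _ Cy) => z hz Cz; apply/hz.
exists (~` [set y | C y -> ~ P y]°); first exact/open_closedC/open_interior.
apply/seteqP; split => y [Cy h]; split => //.
  by move=> /interior_subset /= /(_ Cy).
apply: contrapT => nP; apply: h.
by apply: filterS (hP _ Cy) => z hz Cz /(hz Cz).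
Qed.

Lemma continuous_at_glue (T U : topologicalType) (f g h : T -> U) x :
  {for x, continuous f} -> {for x, continuous g} -> f x = g x ->
  (forall y, h y = f y \/ h y = g y) -> {for x, continuous h}.
Proof.
move=> cf cg fg hh N; have -> : h x = f x by case: (hh x) => ->.
move=> Nx; have hf : \forall y \near x, N (f y) by exact: cf.
have hg : \forall y \near x, N (g y) by apply: cg; rewrite -fg.
suff : \forall y \near x, N (h y) by [].
by apply: filterS2 hf hg => y ? ?; case: (hh y) => ->.
Qed.

Lemma continuous_at_near (T U : topologicalType) (f h : T -> U) x :
  {for x, continuous f} -> (\forall y \near x, h y = f y) ->
  {for x, continuous h}.
Proof.
move=> cf hh N; rewrite (nbhs_singleton hh) => /cf; apply: filterS2 hh => y /= ->; exact.
Qed.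

Lemma extension_small_at_infinity (K : set (R * R)) (h : R * R -> R) (rho c : R) :
  closed K -> {within K, continuous h} -> 0 < c ->
  (forall z, K z -> rho < `|z| -> `|h z| <= c) ->
  exists H : R * R -> R, [/\ continuous H, forall z, K z -> H z = h z &
    exists rho', forall z, rho' < `|z| -> `|H z| <= c].
Proof.
move=> cK ch c0 hc.
have [M0 hM0] : exists M, forall z, K z -> `|z| <= rho -> `|h z| <= M.
  have cB : closed [set z : R * R | `|z| <= rho].
    by apply: (preimage_closed _ (@closed_le R rho)) => x _; exact: norm_continuous.
  have : compact (K `&` [set z | `|z| <= rho]).
    by apply: (@bounded_closed_compact_plane _ rho); [exact: closedI|move=> p []].
  move=> /(@continuous_compact _ _ h) cc.
  have /cc /compact_bounded : {within K `&` [set z | `|z| <= rho], continuous h}.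
    by apply: continuous_subspaceW ch => z [].
  move=> [M [Mr hM]]; exists (M + 1) => z Kz zr.
  by apply: (hM (M + 1)); [rewrite ltrDl|exists z].
pose M := Num.max M0 c.
have M0' : 0 < M by rewrite lt_max c0 orbT.
have hM z : K z -> `|h z| <= M.
  move=> Kz; have [le|gt] := leP `|z| rho.
    by rewrite le_max hM0.
  by rewrite le_max hc ?orbT.
have [H0 [H0h cH0 bH0]] := continuous_bounded_extension pseudometric_normal cK M0' ch hM.
(* The envelope is at least [M] while the norm is at most [rho], then falls with slope one, and
   equals [c] beyond [rho + M]. *)
pose k (z : R * R) := Num.max c (M - (`|z| - rho)).
have kc z : c <= k z by rewrite le_max lexx.
have ck : continuous k.
  apply: continuous_pt => z; apply: (@continuous_max R _ (fun=> c)); first exact: cst_continuous.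
  apply: (@continuousB _ R); first exact: cst_continuous.
  apply: (@continuousB _ R); last exact: cst_continuous.
  exact: norm_continuous.
have hk z : K z -> `|h z| <= k z.
  move=> Kz; have [le|gt] := leP `|z| rho.
    by rewrite le_max; apply/orP; right; rewrite (le_trans (hM _ Kz)) //; lra.
  exact: le_trans (hc _ Kz gt) _.
exists (fun z => Num.max (- k z) (Num.min (k z) (H0 z))); split.
- apply: continuous_pt => z; apply: (@continuous_max R _ (fun z => - k z)).
    by apply: (@continuousN R R); exact: ck.
  by apply: (@continuous_min R _ k H0); [exact: ck|exact: cH0].
- move=> z Kz; rewrite -H0h ?inE //; apply: clamp_id.
  by have := hk _ Kz; rewrite ler_norml.
exists (rho + M) => z hz; have kz : k z = c by apply: max_l; lra.
by rewrite ler_norml kz; apply: clamp_itv; lra.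
Qed.

End Topology.

(** * Total turning of a plane curve *)
Section Turning.
Context {R : realType}.
Implicit Types (f g : R -> R * R) (a b x y : R).

Definition turn f a b x := exists2 th : R -> R, continuous th &
  (forall s, a <= s <= b -> argument (th s) (f s)) /\ th b - th a = x.

Lemma turn_ex f a b : a <= b -> continuous f ->
  (forall s, a <= s <= b -> f s != 0) -> exists x, turn f a b x.
Proof.
by move=> ab cf f0; have [th cth hth] := lift_argument ab cf f0;
  exists (th b - th a), th.
Qed.

Lemma turn_loop f a b x : a <= b -> f a = f b -> f a != 0 -> turn f a b x ->
  exists n : int, x = n%:~R * (2 * pi).
Proof.
move=> ab fab f0 [th cth [hth <-]].
apply: (argument_unique f0); [rewrite fab|]; apply: hth; by rewrite lexx ab.
Qed.

(** Both turns are whole multiples of [2 * pi] because the paths close up, and by [leash] they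
    differ by less than [2 * pi], hence not at all. With [g = f] this says that the turn of a loop
    does not depend on the lift. *)
Lemma turn_leash f g a b x y : a <= b -> f a = f b -> g a = g b ->
  (forall s, a <= s <= b -> f s != 0) -> (forall s, a <= s <= b -> g s != 0) ->
  turn f a b x -> turn g a b y ->
  (forall s, a <= s <= b -> dot (f s) (g s) != - (enorm (f s) * enorm (g s))) ->
  x = y.
Proof.
move=> ab fab gab f0 g0 tf tg no.
have aI : a <= a <= b by rewrite lexx ab.
have bI : a <= b <= b by rewrite lexx ab.
have [m hm] := turn_loop ab fab (f0 _ aI) tf.
have [n hn] := turn_loop ab gab (g0 _ aI) tg.
case: tf tg => [th cth [hth hx]] [th' cth' [hth' hy]].
have cd : continuous (fun s => th' s - th s).
  by apply: continuous_pt => s; apply: (@continuousB _ R R); [exact: cth'|exact: cth].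
have [|k hk] := leash (@interval_is_interval _ `[a, b]) cd.
  move=> s /=; rewrite in_itv /= => hs; apply: contra (no s hs) => /eqP e.
  by rewrite (dot_argument (hth _ hs) (hth' _ hs)) e mulrN1.
have ha : `|th' a - th a - k%:~R * (2 * pi)| < pi by apply: hk; rewrite /= in_itv.
have hb : `|th' b - th b - k%:~R * (2 * pi)| < pi by apply: hk; rewrite /= in_itv.
have p0 := @pi_gt0 R.
have : `|(n - m)%:~R * (2 * pi)| < 2 * pi :> R.
  rewrite intrB mulrBl -hm -hn -hx -hy; move: ha hb; rewrite !ltr_norml; lra.
rewrite normrM [X in _ * X]gtr0_norm ?mulr_gt0 // gtr_pMl ?mulr_gt0 //.
rewrite -intr_norm ltrz1 => nm.
have /eqP : n - m = 0 by lia.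
by rewrite subr_eq0 hm hn => /eqP ->.
Qed.

Lemma dot_gt0_not_opposite (u v : R * R) : 0 < dot u v ->
  dot u v != - (enorm u * enorm v).
Proof.
move=> d; rewrite gt_eqF // (le_lt_trans _ d) // oppr_le0.
by rewrite mulr_ge0 // enorm_ge0.
Qed.

Lemma cis0 : cis (0 : R) = (1, 0). Proof. by rewrite /cis cos0 sin0. Qed.

Lemma cis2pi : cis (2 * pi) = cis 0 :> R * R.
Proof. by rewrite -[RHS](cisDnatpi 1) mul1r add0r. Qed.

(** For radii close to [rho] the two loops have positive dot product at all angles, uniformly by
    compactness of the circle, so [turn_leash] makes the turn locally constant in the radius; the
    interval of radii is connected. *)
Lemma turn_circle (F : R * R -> R * R) (c : R * R) (r s x y : R) : 0 < r -> r <= s ->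
  (forall z, z != c -> F z != 0 /\ {for z, continuous F}) ->
  turn (fun t => F (c + r *: cis t)) 0 (2 * pi) x ->
  turn (fun t => F (c + s *: cis t)) 0 (2 * pi) y -> x = y.
Proof.
move=> r0 rs hF tx ty.
have p0 : 0 <= 2 * pi :> R by rewrite mulr_ge0 // pi_ge0.
pose G rho t := F (c + rho *: cis t).
have ne rho t : 0 < rho -> c + rho *: cis t != c.
  move=> h; rewrite -subr_eq0 addrAC subrr add0r -enorm_gt0 enormZ enorm_cis mulr1.
  by rewrite normr_gt0 gt_eqF.
have G0 rho t : 0 < rho -> G rho t != 0 by move=> h; case: (hF _ (ne _ t h)).
have cG2 rho t : 0 < rho -> {for (rho, t), continuous (fun q : R * R => G q.1 q.2)}.
  move=> h; apply: (continuous_comp (f := fun q : R * R => c + q.1 *: cis q.2) (g := F));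
    last by case: (hF _ (ne rho t h)).
  apply: (@continuousD _ (R * R)%type); first exact: cst_continuous.
  apply: (@continuousZ _ (R * R)%type); first exact: cvg_fst.
  by apply: continuous_at_cis; exact: cvg_snd.
have cG rho : 0 < rho -> continuous (G rho).
  move=> h; apply: continuous_pt => t.
  apply: (continuous_comp (f := fun t => (rho, t)) (g := fun q : R * R => G q.1 q.2));
    last exact: cG2.
  by apply: continuous_at_pair; [exact: cst_continuous|exact: id].
have GL rho : G rho 0 = G rho (2 * pi) by rewrite /G cis2pi.
pose P rho := forall z, turn (G rho) 0 (2 * pi) z -> z = x.
suff Ps : P s by rewrite (Ps _ ty).
apply: (@connected_locally_invariant _ `[r, s] P r) => //.
- exact: segment_connected.
- by rewrite /= in_itv /= lexx.
- move=> z tz; apply: (turn_leash p0 (GL _) (GL _)) tz tx _ => t _; try exact: G0.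
  by apply: dot_gt0_not_opposite; rewrite dotvv exprn_gt0 // enorm_gt0 G0.
- move=> rho; rewrite /= in_itv /= => /andP[hr _].
  have rho0 : 0 < rho by apply: lt_le_trans hr.
  have hcov : near_covering `[0, 2 * pi :> R] by exact/compact_near_coveringP/segment_compact.
  have := hcov _ (nbhs rho) (fun rho' t => 0 < dot (G rho t) (G rho' t)).
  case=> [t _|].
    have : {for (rho, t), continuous (fun q : R * R => dot (G rho q.2) (G q.1 q.2))}.
      apply: continuous_at_dot; last exact: cG2.
      apply: (continuous_comp (f := snd) (g := G rho)); first exact: cvg_snd.
      exact: cG.
    have d0 : 0 < dot (G rho t) (G rho t) by rewrite dotvv exprn_gt0 // enorm_gt0 G0.
    move=> /cvgr_gt /(_ _ d0) [[A B] [/= hA hB] AB].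
    exists (B, A) => //= -[t' rho'] /= [Bt Ar]; exact: (AB (rho', t')).
  move=> e e0 he; exists e => // rho' hrho' /=.
  rewrite in_itv /= => /andP[hr' _].
  have rho'0 : 0 < rho' by apply: lt_le_trans hr'.
  have [z tz] := turn_ex p0 (cG _ rho0) (fun t _ => G0 _ t rho0).
  have [z' tz'] := turn_ex p0 (cG _ rho'0) (fun t _ => G0 _ t rho'0).
  have zz w w' : turn (G rho) 0 (2 * pi) w -> turn (G rho') 0 (2 * pi) w' -> w = w'.
    move=> tw tw'; apply: (turn_leash p0 (GL _) (GL _)) tw tw' _ => t ht; try exact: G0.
    by apply: dot_gt0_not_opposite; apply: he => //; rewrite /= in_itv.
  split=> h w tw; first by rewrite -(zz _ _ tz tw) (h _ tz).
  by rewrite (zz _ _ tw tz') (h _ tz').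
- by rewrite /= in_itv /= rs lexx.
Qed.

End Turning.

(** * Sets that do not separate the plane *)
Section NonSeparation.
Context {R : realType}.
Implicit Types (a c z u : R * R) (n m : int).

(** An arbitrary, discontinuous choice of argument. It enters [phase] only through integer multiples
    under [cis], where the choice cancels; hence [phase] is continuous off [a] and [c]. *)
Definition ang u : R := xget 0 [set t | argument t u].

Lemma ang_argument u : argument (ang u) u.
Proof. by have [t ht] := argument_ex u; exact: (xgetPex 0 (P := [set t | argument t u]) (ex_intro _ t ht)). Qed.

(* The phase of [(z - a) ^ n / (z - c) ^ m]. *)
Definition phase n m a c z : R * R :=
  cis (n%:~R * ang (z - a) - m%:~R * ang (z - c)).

Lemma phaseE n m a c z (s t : R) : z != a -> z != c ->
  argument s (z - a) -> argument t (z - c) ->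
  phase n m a c z = cis (n%:~R * s - m%:~R * t).
Proof.
move=> za zc hs ht.
have [k hk] : exists k : int, ang (z - a) - s = k%:~R * (2 * pi).
  by apply: (@argument_unique _ _ _ (z - a)) => //; rewrite ?subr_eq0 //; exact: ang_argument.
have [l hl] : exists k : int, ang (z - c) - t = k%:~R * (2 * pi).
  by apply: (@argument_unique _ _ _ (z - c)) => //; rewrite ?subr_eq0 //; exact: ang_argument.
rewrite /phase -[RHS](cisDzpi (n * k - m * l)); congr cis.
rewrite rmorphB /= !rmorphM /=; move: hk hl; set A := ang _; set B := ang _ => hk hl.
have -> : A = s + k%:~R * (2 * pi) by rewrite -hk; ring.
have -> : B = t + l%:~R * (2 * pi) by rewrite -hl; ring.
ring.
Qed.

Lemma continuous_at_local_argument a z0 : z0 != a ->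
  exists phi : R * R -> R, {for z0, continuous phi} /\
    \forall z \near z0, argument (phi z) (z - a) /\ z != a.
Proof.
move=> za.
have d0 : 0 < dot (z0 - a) (z0 - a).
  by rewrite dotvv exprn_gt0 // enorm_gt0 subr_eq0.
have csub : {for z0, continuous (fun z => z - a)}.
  by apply: (@continuousB _ (R * R)%type); [exact: id|exact: cst_continuous].
exists (fun z => ang (z0 - a) + atan (cross (z0 - a) (z - a) / dot (z0 - a) (z - a))); split.
  apply: (@continuousD _ R); first exact: cst_continuous.
  apply: continuous_at_atan_slope => //; last by rewrite gt_eqF.
  exact: cst_continuous.
have : {for z0, continuous (fun z => dot (z0 - a) (z - a))}.
  by apply: continuous_at_dot => //; exact: cst_continuous.
move=> /cvgr_gt /(_ _ d0); apply: filterS => z dz; split.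
  by apply: argument_atan => //; exact: ang_argument.
by apply: contraTneq dz => ->; rewrite subrr /dot /= !mulr0 addr0 ltxx.
Qed.

Lemma continuous_at_phase n m a c z0 : z0 != a -> z0 != c ->
  {for z0, continuous (phase n m a c)}.
Proof.
move=> za zc.
have [f [cf hf]] := continuous_at_local_argument za.
have [g [cg hg]] := continuous_at_local_argument zc.
apply: (@continuous_at_near _ _ (fun z => cis (n%:~R * f z - m%:~R * g z))).
  apply: continuous_at_cis; apply: (@continuousB _ R); apply: (@continuousM R) => //;
  exact: cst_continuous.
by apply: filterS2 hf hg => z [az nz] [az' nz']; exact: phaseE.
Qed.

(** On [V], which contains the singularity [a] of the phase, the phase is replaced by [cis H]. When
    [cis H] matches the phase on a set containing the frontier of [V], the result is a field of unit
    vectors with the single singularity [c]. *)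
Definition glued (V : set (R * R)) (H : R * R -> R) (r : R * R -> R * R) z :=
  if `[< V z >] then cis (H z) else r z.

Lemma continuous_at_glued (V K : set (R * R)) (H : R * R -> R) n m a c z :
  open V -> closed K -> closure V `<=` V `|` K -> V a -> ~ V c -> ~ K c -> ~ K a ->
  continuous H -> (forall z, K z -> cis (H z) = phase n m a c z) -> z != c ->
  {for z, continuous (glued V H (phase n m a c))}.
Proof.
move=> oV cK clV Va Vc Kc Ka cH hH zc.
have chH x : {for x, continuous (fun z => cis (H z))}.
  by apply: continuous_at_cis; exact: cH.
have [Vz|Vz] := pselect (V z).
  apply: continuous_at_near (chH z) _.
  by apply: filterS (open_nbhs_nbhs (conj oV Vz)) => y Vy; rewrite /glued asboolT.
have za : z != a by apply: contra_notN Vz => /eqP ->.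
have cp : {for z, continuous (phase n m a c)} by exact: continuous_at_phase.
have [Kz|Kz] := pselect (K z).
  apply: continuous_at_glue (chH z) cp (hH _ Kz) _ => y.
  by rewrite /glued; case: ifP; [left|right].
apply: continuous_at_near cp _.
have : (~` closure V) z by move=> /clV [].
move=> h; have := open_nbhs_nbhs (conj (closed_openC (@closed_closure _ V)) h).
apply: filterS => y ny; rewrite /glued asboolF // => Vy.
by apply: ny; exact: subset_closure.
Qed.

Lemma circle_sub (c : R * R) (r t : R) : c + r *: cis t - c = r *: cis t.
Proof. by rewrite addrAC subrr add0r. Qed.

Lemma argument_circle (r t : R) : 0 < r -> argument t (r *: cis t).
Proof. by move=> r0; rewrite /argument enormZ enorm_cis mulr1 gtr0_norm. Qed.

Lemma continuous_circle (c : R * R) (r : R) : continuous (fun t => c + r *: cis t).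
Proof.
apply: continuous_pt => t.
apply: (@continuousD _ (R * R)%type); first exact: cst_continuous.
apply: (@continuousZ _ (R * R)%type); first exact: cst_continuous.
by apply: continuous_at_cis; exact: id.
Qed.

Lemma circle_neq (c : R * R) (r t : R) : 0 < r -> c + r *: cis t != c.
Proof.
move=> h; rewrite -subr_eq0 circle_sub -enorm_gt0 enormZ enorm_cis mulr1.
by rewrite normr_gt0 gt_eqF.
Qed.

Lemma turn_phase_circle n m a c (r y : R) : 0 < r ->
  (forall t, c + r *: cis t != a) ->
  turn (fun t => c + r *: cis t - a) 0 (2 * pi) y ->
  turn (fun t => phase n m a c (c + r *: cis t)) 0 (2 * pi)
    (n%:~R * y - m%:~R * (2 * pi)).
Proof.
move=> r0 na [th cth [hth <-]]; exists (fun t => n%:~R * th t - m%:~R * t).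
  apply: continuous_pt => t.
  apply: (@continuousB _ R R); apply: (@continuousM R); try exact: cst_continuous.
    exact: cth.
  exact: id.
split=> [s hs|]; last by ring.
rewrite /argument (phaseE n m (na s) _ (hth s hs) (t := s)) ?circle_neq //.
  by rewrite enorm_cis scale1r.
by rewrite circle_sub; exact: argument_circle.
Qed.

Lemma enorm_pair1 : enorm ((1, 0) : R * R) = 1.
Proof. by rewrite -cis0 enorm_cis. Qed.

Lemma turn_cst (u : R * R) (s t : R) : turn (fun=> u) s t 0.
Proof.
exists (fun=> ang u); first exact: cst_continuous.
by split=> [? _|]; [exact: ang_argument|rewrite subrr].
Qed.

Lemma turn_near_0 a c (r y : R) : 0 < r -> r < enorm (a - c) ->
  turn (fun t => c + r *: cis t - a) 0 (2 * pi) y -> y = 0.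
Proof.
move=> r0 rac ty.
have p0 : 0 <= 2 * pi :> R by rewrite mulr_ge0 // pi_ge0.
have dp t : 0 < dot (c + r *: cis t - a) (c - a).
  have -> : dot (c + r *: cis t - a) (c - a) =
    enorm (c - a) ^+ 2 + dot (r *: cis t) (c - a).
    by rewrite -dotvv /dot /=; ring.
  have := dotN_le (r *: cis t) (c - a).
  rewrite enormZ enorm_cis mulr1 gtr0_norm // (enorm_distC c a) => h.
  by rewrite -subr_gt0 in rac; nra.
apply: (@turn_leash _ _ (fun=> c - a) _ _ y 0 p0 _ _ _ _ ty (turn_cst _ _ _)) => //.
- by rewrite cis2pi.
- by move=> s _; apply: contraTneq (dp s) => ->; rewrite /dot /= !mul0r addr0 ltxx.
- by move=> s _; apply: contraTneq (dp s) => ->; rewrite /dot /= !mulr0 addr0 ltxx.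
- by move=> s _; apply: dot_gt0_not_opposite.
Qed.

Lemma turn_far_2pi a c (r y : R) : enorm (a - c) < r ->
  turn (fun t => c + r *: cis t - a) 0 (2 * pi) y -> y = 2 * pi.
Proof.
move=> rac ty.
have r0 : 0 < r by apply: le_lt_trans rac; exact: enorm_ge0.
have p0 : 0 <= 2 * pi :> R by rewrite mulr_ge0 // pi_ge0.
have dp t : 0 < dot (c + r *: cis t - a) (r *: cis t).
  have -> : dot (c + r *: cis t - a) (r *: cis t) =
    enorm (r *: cis t) ^+ 2 + dot (c - a) (r *: cis t).
    by rewrite -dotvv /dot /=; ring.
  have := dotN_le (c - a) (r *: cis t).
  rewrite enormZ enorm_cis mulr1 gtr0_norm // (enorm_distC c a) => h.
  by rewrite -subr_gt0 in rac; nra.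
have tr : turn (fun t => r *: cis t) 0 (2 * pi) (2 * pi).
  exists id; first by move=> ?; exact: id.
  by split=> [s _|]; [exact: argument_circle|rewrite subr0].
apply: (turn_leash p0 _ _ _ _ ty tr).
- by rewrite cis2pi.
- by rewrite cis2pi.
- by move=> s _; apply: contraTneq (dp s) => ->; rewrite /dot /= !mul0r addr0 ltxx.
- by move=> s _; apply: contraTneq (dp s) => ->; rewrite /dot /= !mulr0 addr0 ltxx.
- by move=> s _; apply: dot_gt0_not_opposite.
Qed.

Lemma turn_ext (f g : R -> R * R) (s t y : R) : (forall x, f x = g x) ->
  turn f s t y -> turn g s t y.
Proof. by move=> fg; rewrite (_ : f = g) //; apply/funext. Qed.

Section Glued.
Variables (V K : set (R * R)) (h : R * R -> R) (n m : int) (a c : R * R).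
Hypotheses (oV : open V) (cK : closed K) (clV : closure V `<=` V `|` K).
Hypotheses (Va : V a) (Vc : ~ V c) (Kc : ~ K c) (Ka : ~ K a).
Hypotheses (ch : {within K, continuous h}).
Hypotheses (hK : forall z, K z -> cis (h z) = phase n m a c z).
Hypothesis small : exists rho, forall z, K z -> rho < `|z| -> `|h z| <= pi / 2.

(** On small circles about [c] the glued field is the phase itself, whose only turning there is the
    [- m] turns due to [z - c]. Since [c] is the only singularity, every larger circle has the same
    turn. *)
Lemma glued_extension_turn : exists2 H : R * R -> R,
  (exists rho, forall z, rho < `|z| -> `|H z| <= pi / 2) /\
  (forall z, z != c -> {for z, continuous (glued V H (phase n m a c))}) &
  exists2 r0, 0 < r0 & forall r s y, 0 < r -> r < r0 -> r <= s ->
    turn (fun t => glued V H (phase n m a c) (c + s *: cis t)) 0 (2 * pi) y ->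
    y = - m%:~R * (2 * pi).
Proof.
have [rho hrho] := small.
have pih : 0 < pi / 2 :> R by rewrite divr_gt0 // pi_gt0.
have [H [cH HK Hs]] := extension_small_at_infinity cK ch pih hrho.
have hH z : K z -> cis (H z) = phase n m a c z by move=> Kz; rewrite HK // hK.
exists H; first by split => // z zc; exact: (@continuous_at_glued V K).
have nc : (~` closure V) c by move=> /clV [].
have := open_nbhs_nbhs (conj (closed_openC (@closed_closure _ V)) nc).
move=> /nbhs_ballP[e /= e0 he].
have ac : 0 < enorm (a - c).
  by rewrite enorm_gt0 subr_eq0; apply: contra_notN Vc => /eqP <-.
(* Below [e] the circle misses [V]; below [enorm (a - c)] it does not enclose [a]. *)
exists (Num.min e (enorm (a - c))); first by rewrite lt_min e0.
move=> r s y r0; rewrite lt_min => /andP[re rac] rs ty.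
have na t : c + r *: cis t != a.
  apply: contraTneq rac => <-; rewrite circle_sub enormZ enorm_cis mulr1 gtr0_norm //.
  by rewrite ltxx.
have p0 : 0 <= 2 * pi :> R by rewrite mulr_ge0 // pi_ge0.
have [|t0 _|x tx] := @turn_ex _ (fun t => c + r *: cis t - a) 0 (2 * pi) p0.
- apply: continuous_pt => t; apply: (@continuousB _ (R * R)%type).
    exact: continuous_circle.
  exact: cst_continuous.
- by rewrite subr_eq0.
have x0 := turn_near_0 r0 rac tx; subst x.
have := turn_phase_circle n m r0 na tx; rewrite mulr0 sub0r -mulNr => tp.
apply/esym/(@turn_circle _ (glued V H (phase n m a c)) c r s) => //.
  move=> z zc; split; last exact: (@continuous_at_glued V K).
  by rewrite /glued; case: ifP => _; rewrite -enorm_gt0 enorm_cis.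
apply: turn_ext tp => t; rewrite /glued asboolF // => Vt.
apply: (he (c + r *: cis t)); last exact: subset_closure.
rewrite -ball_normE /= opprD addrA subrr add0r normrN.
by rewrite (le_lt_trans (normr_le_enorm _)) // enormZ enorm_cis mulr1 gtr0_norm.
Qed.

Lemma normr_circle_gt (r s t : R) : 0 < r -> s + enorm c <= r -> s <= enorm (c + r *: cis t).
Proof.
move=> r0 hs; have := enormD (c + r *: cis t) (- c).
rewrite circle_sub enormN enormZ enorm_cis mulr1 gtr0_norm //; lra.
Qed.

(** A large circle lies off the bounded set [V], so the glued field is again the phase there and
    turns [n - m] times, against [- m] on small circles. *)
Lemma no_phase_primitive_bounded rho : (forall z, V z -> `|z| <= rho) -> n = 0.
Proof.
move=> Vrho; have [H _ [r0 r00 hr]] := glued_extension_turn.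
have p0 := @pi_gt0 R.
(* The first three summands push the circle beyond norm [rho], the doubling because [enorm] is at
   most twice the sup norm; [enorm (a - c)] makes it enclose [a], and [r0] makes it larger than the
   small circle. *)
pose s := `|rho| *+ 2 + 1 + enorm c + enorm (a - c) + r0.
have e1 := enorm_ge0 c; have e2 := enorm_ge0 (a - c).
have sac : enorm (a - c) < s.
  by rewrite /s; have := normr_ge0 rho; lra.
have s0 : 0 < s by apply: le_lt_trans sac.
have [x tx] : exists x, turn (fun t => c + s *: cis t - a) 0 (2 * pi) x.
  apply: turn_ex; first by rewrite mulr_ge0 // ltW.
    apply: continuous_pt => t; apply: (@continuousB _ (R * R)%type).
      exact: continuous_circle.
    exact: cst_continuous.
  move=> t _; rewrite subr_eq0; apply: contraTneq sac => <-.
  by rewrite circle_sub enormZ enorm_cis mulr1 gtr0_norm // ltxx.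
have x2 := turn_far_2pi sac tx; subst x.
have na t : c + s *: cis t != a.
  apply: contraTneq sac => <-; rewrite circle_sub enormZ enorm_cis mulr1 gtr0_norm //.
  by rewrite ltxx.
have tp := turn_phase_circle n m s0 na tx.
have := hr (r0 / 2) s (n%:~R * (2 * pi) - m%:~R * (2 * pi)).
have -> : 0 < r0 / 2 by rewrite divr_gt0.
have -> : r0 / 2 < r0 by lra.
have -> : r0 / 2 <= s by rewrite /s; have := normr_ge0 rho; lra.
move=> /(_ isT isT isT); have ty : turn (fun t => glued V H (phase n m a c) (c + s *: cis t))
    0 (2 * pi) (n%:~R * (2 * pi) - m%:~R * (2 * pi)).
  apply: turn_ext tp => t; rewrite /glued asboolF // => /Vrho.
  apply/negP; rewrite -ltNge.
  have := @normr_circle_gt s (`|rho| *+ 2 + 1) t s0.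
  have := enorm_le_normr (c + s *: cis t); have := ler_norm rho.
  rewrite /s; lra.
move=> /(_ ty) e.
have : n%:~R * (2 * pi) = 0 :> R by move: e; rewrite mulNr; lra.
move/eqP; rewrite mulf_eq0 (gt_eqF (mulr_gt0 _ _)) // orbF intr_eq0.
by move/eqP.
Qed.

(** Here [V] may be unbounded. On a large circle the first coordinate of the glued field is
    nonnegative on both pieces: [H] is at most [pi / 2] in absolute value, and [z - a], [z - c] make
    an acute angle. The field is thus never opposite to [(1, 0)] and its turn is 0, against -1 turns
    on small circles. *)
Lemma no_phase_primitive_small : n = 1 -> m = 1 -> False.
Proof.
move=> n1 m1; have [H [[rho Hrho] cg] [r0 r00 hr]] := glued_extension_turn.
have p0 := @pi_gt0 R.
have pp : 0 <= 2 * pi :> R by rewrite mulr_ge0 // ltW.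
pose s := `|rho| *+ 2 + 1 + enorm c + enorm (a - c) + r0.
have e1 := enorm_ge0 c; have e2 := enorm_ge0 (a - c).
have sac : enorm (a - c) < s.
  by rewrite /s; have := normr_ge0 rho; lra.
have s0 : 0 < s by apply: le_lt_trans sac.
pose F t := glued V H (phase n m a c) (c + s *: cis t).
have F1 t : enorm (F t) = 1 by rewrite /F /glued; case: ifP; rewrite enorm_cis.
have F0 t : F t != 0 by rewrite -enorm_gt0 F1.
have cF : continuous F.
  apply: continuous_pt => t.
  apply: (continuous_comp (f := fun t => c + s *: cis t)).
    exact: continuous_circle.
  by apply: cg; exact: circle_neq.
have [x tx] := turn_ex pp cF (fun t _ => F0 t).
have x0 : x = 0.
  apply: (@turn_leash _ _ (fun=> (1, 0)) _ _ x 0 pp _ _ _ _ tx (turn_cst _ _ _)) => //.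
  - by rewrite /F cis2pi.
  - by move=> t _; rewrite -enorm_gt0 enorm_pair1.
  move=> t _; rewrite F1 enorm_pair1 mulr1 gt_eqF // (@lt_le_trans _ _ 0) ?ltrN10 //.
  rewrite /dot /= mulr1 mulr0 addr0 /F /glued; case: ifP => _.
    rewrite /cis /= cos_ge0_pihalf // -ler_norml Hrho //.
    have := @normr_circle_gt s (`|rho| *+ 2 + 1) t s0.
    have := enorm_le_normr (c + s *: cis t); have := ler_norm rho.
    rewrite /s; lra.
  rewrite /phase n1 m1 /= !mul1r; set z := c + _.
  have := dot_argument (ang_argument (z - c)) (ang_argument (z - a)).
  have -> : dot (z - c) (z - a) = enorm (z - c) ^+ 2 + dot (z - c) (c - a).
    by rewrite -dotvv /dot /=; ring.
  have := dotN_le (z - c) (c - a); rewrite /z circle_sub enormZ enorm_cis mulr1 gtr0_norm //.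
  rewrite (enorm_distC c a) => hd he; rewrite leNgt; apply/negP => cn.
  have h1 : 0 < s * (s - enorm (a - c)) by rewrite mulr_gt0 // subr_gt0.
  have h2 := mulr_ge0_le0 (mulr_ge0 (ltW s0) (enorm_ge0 (c + s *: cis t - a))) (ltW cn).
  by move: he hd h1 h2; rewrite mulrBr; lra.
have := hr (r0 / 2) s x.
have -> : 0 < r0 / 2 by rewrite divr_gt0.
have -> : r0 / 2 < r0 by lra.
have -> : r0 / 2 <= s by rewrite /s; have := normr_ge0 rho; lra.
move=> /(_ isT isT isT tx); rewrite x0 m1; lra.
Qed.

End Glued.
End NonSeparation.

(** * Phase primitives on the image of a proper path *)

Section ProperArc.
Context {R : realType}.
Variables (A : set R) (g : R -> R * R).
Hypotheses (cA : closed A) (cg : continuous g).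
Hypothesis proper : forall M, exists N, forall s, A s -> `|g s| <= M -> `|s| <= N.

Lemma closed_proper_image (B : set R) : closed B -> B `<=` A -> closed (g @` B).
Proof.
move=> cB BA z hz.
have [N hN] := proper (`|z| + 1).
have cC : compact (g @` (B `&` `[- N, N])).
  apply: continuous_compact; first exact: continuous_subspaceT.
  apply: (subclosed_compact _ (@segment_compact _ (- N) N)); last by move=> ? [].
  by apply: closedI => //; exact: interval_closed.
have := compact_closed (@norm_hausdorff _ (R * R)%type) cC.
move=> /(_ z) h; have [|s [Bs _] <-] := h; last by exists s.
move=> W Wz; have [w [[s Bs <-] [Ww wz]]] := hz _ (filterI Wz (nbhsx_ballx z 1 ltr01)).
exists (g s); split=> //; exists s => //; split=> //.
rewrite /= in_itv /= -ler_norml; apply: hN; first exact: BA.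
move: wz; rewrite -ball_normE /= => wz.
have -> : g s = z - (z - g s) by rewrite subKr.
by rewrite (le_trans (ler_normB _ _)) // lerD2l ltW.
Qed.

(** A proper continuous map is closed, so a continuous function of the parameter that is constant on
    the fibres of [g] descends to a continuous function on the image. *)
Lemma transport (phi : R -> R) : {within A, continuous phi} ->
  (forall s t, A s -> A t -> g s = g t -> phi s = phi t) ->
  exists h : R * R -> R, {within g @` A, continuous h} /\
    forall s, A s -> h (g s) = phi s.
Proof.
move=> cphi inj.
pose h z := phi (xget 0 [set s | A s /\ g s = z]).
have hg s : A s -> h (g s) = phi s.
  move=> As; have [h1 h2] := @xgetPex _ 0 [set t | A t /\ g t = g s] (ex_intro _ s (conj As erefl)).
  exact: inj.
exists h; split=> //; apply/continuous_closedP => W cW; apply/closed_subspaceP.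
move/continuous_closedP : cphi => /(_ _ cW) /closed_subspaceP [X cX XA].
exists (g @` (X `&` A)).
  by apply: closed_proper_image; [exact: closedI|move=> ? []].
apply/seteqP; split => z [].
  move=> [s [Xs As] <-] _; split; last by exists s.
  suff : W (h (g s)) by [].
  rewrite hg //; have [] // : (from_subspace A phi @^-1` W `&` A) s by rewrite -XA.
move=> hz [s As gs]; split; last by exists s.
exists s => //; split=> //; have : W (h z) by [].
by rewrite -gs hg // => hz'; have [] // : (X `&` A) s by rewrite XA.
Qed.

Lemma continuous_bounded_segment (N : R) : exists M, forall s, `|s| <= N -> `|g s| <= M.
Proof.
have : compact (g @` `[- N, N]).
  apply: continuous_compact; last exact: segment_compact.
  exact: continuous_subspaceT.
move=> /compact_bounded [M [Mr hM]]; exists (M + 1) => s sN.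
by apply: (hM (M + 1)); [rewrite ltrDl|exists s => //=; rewrite in_itv /= -ler_norml].
Qed.

Variables (V : set (R * R)) (phi alpha gamma : R -> R) (n m : int) (a c : R * R).
Hypotheses (oV : open V) (clV : closure V `<=` V `|` g @` A).
Hypotheses (Va : V a) (Vc : ~ V c) (Ac : ~ (g @` A) c) (Aa : ~ (g @` A) a).
Hypotheses (cphi : {within A, continuous phi}).
Hypothesis inj : forall s t, A s -> A t -> g s = g t -> phi s = phi t.
Hypothesis ha : forall s, A s -> argument (alpha s) (g s - a).
Hypothesis hc : forall s, A s -> argument (gamma s) (g s - c).
Hypothesis hphi : forall s, A s ->
  cis (phi s) = cis (n%:~R * alpha s - m%:~R * gamma s).
Hypothesis small : exists N, forall s, A s -> N < `|s| -> `|phi s| <= pi / 2.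

(** Reduces Borsuk's criterion to a computation in the parameter. Smallness for large [s] becomes
    smallness far out in the plane because [g] is bounded on segments. *)
Lemma arc_phase_primitive : exists h : R * R -> R, [/\ {within g @` A, continuous h},
  forall z, (g @` A) z -> cis (h z) = phase n m a c z &
  exists rho, forall z, (g @` A) z -> rho < `|z| -> `|h z| <= pi / 2].
Proof.
have [h [ch hg]] := transport cphi inj; exists h; split=> //.
  move=> _ [s As <-]; rewrite hg // hphi // (@phaseE _ _ _ _ _ _ (alpha s) (gamma s)) //.
  - by apply: contra_notN Aa => /eqP <-; exists s.
  - by apply: contra_notN Ac => /eqP <-; exists s.
  - exact: ha.
  - exact: hc.
have [N hN] := small; have [M hM] := continuous_bounded_segment N.
exists M => _ [s As <-] Mg; rewrite hg //; apply: hN => //.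
by rewrite ltNge; apply: contraTN Mg => /hM; rewrite leNgt.
Qed.

Lemma arc_exponent_eq0 rho : (forall z, V z -> `|z| <= rho) -> n = 0.
Proof.
have [h [ch hK hs]] := arc_phase_primitive.
exact: (no_phase_primitive_bounded oV (closed_proper_image cA (@subset_refl _ A))
  clV Va Vc Ac Aa ch hK hs).
Qed.

Lemma arc_not_separating : n = 1 -> m = 1 -> False.
Proof.
have [h [ch hK hs]] := arc_phase_primitive.
exact: (no_phase_primitive_small oV (closed_proper_image cA (@subset_refl _ A))
  clV Va Vc Ac Aa ch hK hs).
Qed.

End ProperArc.

Definition sft {R : realType} (P : R) (n : int) (p : R * R) : R * R :=
  p + (n%:~R * P, 0).

(* [A] and [B] are the two sides of the curve [G], invariant under the
   horizontal translations by multiples of [P]; [P] is 0 for closed curves. *)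
Record sides {R : realType} (P : R) (G A B : set (R * R)) : Prop := Sides {
  open_side1 : open A;
  open_side2 : open B;
  sides_cover : forall p, [\/ A p, B p | G p];
  sides_disjoint : forall p, A p -> ~ B p;
  side1_off : forall p, A p -> ~ G p;
  side2_off : forall p, B p -> ~ G p;
  side1_closure : G `<=` closure A;
  side2_closure : G `<=` closure B;
  side1_nonempty : A !=set0;
  side2_nonempty : B !=set0;
  side1_connected : forall V, open V -> V !=set0 -> V `<=` A ->
    closure V `<=` V `|` G -> A `<=` V;
  side2_connected : forall V, open V -> V !=set0 -> V `<=` B ->
    closure V `<=` V `|` G -> B `<=` V;
  side1_periodic : forall n p, A p -> A (sft P n p);
  side2_periodic : forall n p, B p -> B (sft P n p);
  curve_bounded_mod : exists M, forall p, G p -> exists n, `|sft P n p| <= M }.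

(** * Winding numbers of infinite arcs *)

Section Winding.
Context {R : realType}.
Implicit Types (g : R -> R * R) (p q a c : R * R) (s t w : R).

(** The sharper bound [pi / 2] is the smallness at infinity required of a phase primitive; it
    applies near the ends of an arc, where two base points are seen at an acute angle. *)
Lemma leash_half (J : set R) (d : R -> R) : is_interval J -> continuous d ->
  (forall s, J s -> 0 < cos (d s)) ->
  exists n : int, forall s, J s -> `|d s - n%:~R * (2 * pi)| < pi / 2.
Proof.
move=> iJ cd hJ; have [|n hn] := leash iJ cd.
  by move=> s Js; rewrite gt_eqF // (lt_trans _ (hJ _ Js)) // ltrN10.
exists n => s Js; have := hn _ Js; have := hJ _ Js.
have -> : cos (d s) = cos (d s - n%:~R * (2 * pi)).
  by have [] := cisDzpi (- n) (d s); rewrite mulrNz mulNr => ->.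
set x := d s - _; move=> cx xp; rewrite ltNge; apply/negP => hx.
have p0 := @pi_gt0 R.
have : cos `|x| <= cos (pi / 2).
  by rewrite leNgt ltr_cos ?in_itv /= ?normr_ge0 ?(ltW xp) -?leNgt //; lra.
rewrite cos_pihalf leNgt.
by have [_|_] := ger0P x; rewrite ?cosN cx.
Qed.

Lemma dot_far_gt0 a c p : enorm (a - c) < enorm (p - a) -> 0 < dot (p - a) (p - c).
Proof.
move=> h; have -> : dot (p - a) (p - c) = enorm (p - a) ^+ 2 + dot (p - a) (a - c).
  by rewrite -dotvv /dot /=; ring.
have := dotN_le (p - a) (a - c).
have : 0 < enorm (p - a) * (enorm (p - a) - enorm (a - c)).
  by rewrite mulr_gt0 ?subr_gt0 // (le_lt_trans (enorm_ge0 _) h).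
by rewrite mulrBr; lra.
Qed.

Lemma cos_argument_gt0 (u v : R * R) s t : argument s u -> argument t v ->
  0 < dot u v -> 0 < cos (s - t).
Proof.
move=> hu hv; rewrite -cosN opprB (dot_argument hu hv) => h.
rewrite ltNge; apply: contraTN h => h; rewrite -leNgt.
by rewrite mulr_ge0_le0 // mulr_ge0 // enorm_ge0.
Qed.

Lemma arc_ends g G M : arc_param g G -> exists N, forall s,
  (N < s -> M < (g s).1) /\ (s < - N -> (g s).1 < - M).
Proof.
move=> [_ _ _ hN hp].
move/cvgryPgt : hp => /(_ M) [A [_ hA]].
move/cvgrNyPlt : hN => /(_ (- M)) [B [_ hB]].
exists (Num.max A (- B)) => s; split=> hs.
  by apply: hA; apply: le_lt_trans hs; rewrite le_max lexx.
by apply: hB; apply: lt_le_trans hs _; rewrite lerNl le_max lexx orbT.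
Qed.

Lemma arc_proper g G M : arc_param g G -> exists N, forall s, `|g s| <= M -> `|s| <= N.
Proof.
move=> hg; have [N hN] := arc_ends M hg; exists N => s hs.
have h1 : `|(g s).1| <= M by apply: le_trans hs; rewrite prod_normE le_max lexx.
move: h1; rewrite !ler_norml => /andP[h1 h2]; have [k1 k2] := hN s.
apply/andP; split; rewrite leNgt; apply/negP.
  by move/k2; rewrite ltNge h1.
by move/k1; rewrite ltNge h2.
Qed.

Lemma continuous_within_comp (T U W : topologicalType) (A : set U) (f : T -> U) (h : U -> W) :
  continuous f -> (forall x, A (f x)) -> {within A, continuous h} -> continuous (h \o f).
Proof.
move=> cf Af /subspace_continuousP ch x N Nx.
have h1 : \forall z \near f x, A z -> N (h z) by exact: (ch _ (Af x) _ Nx).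
have h2 : \forall y \near x, A (f y) -> N (h (f y)) by exact: (cf x _ h1).
suff : \forall y \near x, N (h (f y)) by [].
by apply: filterS h2 => y; apply.
Qed.

(** The change of parameter is continuous by [transport], and it preserves each end because the
    abscissa distinguishes the ends, so the same argument function, reparametrized, keeps its
    limits. *)
Lemma winding_reparam g g' G p w : arc_param g G -> arc_param g' G ->
  winding_number g p w -> winding_number g' p w.
Proof.
move=> hg hg' [th [a [b [cth hth la lb ->]]]].
have [cg ig rg _ _] := hg; have [cg' _ rg' _ _] := hg'.
have prop M : exists N, forall s, [set: R] s -> `|g s| <= M -> `|s| <= N.
  by have [N hN] := arc_proper M hg; exists N => s _; exact: hN.
have [h [ch hgs]] := @transport _ setT g (@closedT _) cg prop id
  (continuous_subspaceT (fun x => cvg_id)) (fun s t _ _ e => ig s t e).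
have [psi hpsi] : exists psi : R -> R, forall s, psi s = h (g' s) by exists (h \o g').
have gG s : (g @` setT) (g' s) by rewrite rg -rg'; exists s.
have gpsi s : g (psi s) = g' s.
  by rewrite hpsi; have [t _ <-] := gG s; rewrite hgs.
have cpsi : continuous psi.
  rewrite (_ : psi = h \o g'); last exact/funext.
  exact: continuous_within_comp cg' gG ch.
have bd M : exists2 B, 0 <= B & forall s, `|s| <= M -> `|(g s).1| <= B.
  have [B hB] := continuous_bounded_segment cg M; exists `|B| => // s sM.
  by apply: le_trans (le_trans (hB s sM) (ler_norm _)); rewrite prod_normE le_max lexx.
(* Otherwise [psi s] is either in a bounded segment, where the abscissa is at most [B'], or so far
   to the left that the abscissa is negative; both contradict an abscissa of [g' s] above [B']. *)
have psiy : psi s @[s --> +oo] --> +oo.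
  apply/cvgryPgt => M; have [B B0 hB] := bd `|M|.
  have [N hN] := arc_ends 0 hg; have [B' B'0 hB'] := bd (Num.max `|M| N).
  have [N' hN'] := arc_ends B' hg'; exists N'; split; first exact: num_real.
  move=> s /= hs; rewrite ltNge; apply/negP => hp.
  have := (hN' s).1 hs; rewrite -gpsi.
  have [le|gt] := leP (- Num.max `|M| N) (psi s).
    have : `|psi s| <= Num.max `|M| N.
      rewrite ler_norml le /= (le_trans hp) // le_max; apply/orP; left; exact: ler_norm.
    by move/hB'; rewrite ler_norml => /andP[_ h1]; rewrite ltNge h1.
  have : psi s < - N by apply: lt_le_trans gt _; rewrite lerN2 le_max lexx orbT.
  by move/(hN (psi s)).2; rewrite oppr0; lra.
have psiNy : psi s @[s --> -oo] --> -oo.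
  apply/cvgrNyPlt => M; have [B B0 hB] := bd `|M|.
  have [N hN] := arc_ends 0 hg; have [B' B'0 hB'] := bd (Num.max `|M| N).
  have [N' hN'] := arc_ends B' hg'; exists (- N'); split; first exact: num_real.
  move=> s /= hs; rewrite ltNge; apply/negP => hp.
  have := (hN' s).2 hs; rewrite -gpsi.
  have [le|gt] := leP (psi s) (Num.max `|M| N).
    have : `|psi s| <= Num.max `|M| N.
      rewrite ler_norml le andbT (le_trans _ hp) // lerNl le_max.
      by rewrite -normrN ler_norm.
    by move/hB'; rewrite ler_norml => /andP[h1 _]; rewrite ltNge h1.
  have : N < psi s by apply: le_lt_trans gt; rewrite le_max lexx orbT.
  by move/(hN (psi s)).1; lra.
exists (th \o psi), a, b; split=> //.
- by move=> s; apply: continuous_comp; [exact: cpsi|exact: cth].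
- by move=> s; rewrite -gpsi; exact: hth.
- exact: cvg_comp psiNy la.
- exact: cvg_comp psiy lb.
Qed.

Lemma winding_ends g p w : winding_number g p w -> exists (th : R -> R) (a b : R),
  [/\ continuous th, forall s, argument (th s) (g s - p),
   forall e, 0 < e -> exists N, forall s,
     (N < s -> `|th s - b| < e) /\ (s < - N -> `|th s - a| < e)
   & w * (2 * pi) = b - a].
Proof.
move=> [th [a [b [cth hth la lb ->]]]]; exists th, a, b; split=> //; last first.
  by rewrite divfK // mulf_neq0 // gt_eqF // pi_gt0.
move=> e e0.
move/cvgrPdist_lt : lb => /(_ _ e0) [A [_ hA]].
move/cvgrPdist_lt : la => /(_ _ e0) [B [_ hB]].
exists (Num.max A (- B)) => s; split=> hs; rewrite distrC.
  by apply: hA; apply: le_lt_trans hs; rewrite le_max lexx.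
by apply: hB; apply: lt_le_trans hs _; rewrite lerNl le_max lexx orbT.
Qed.

(** The two arguments stay within [pi / 2] of each other up to one fixed number of full turns, so
    their increments differ by at most [pi]. The bound [2^-1] suffices later because the two
    admissible values lie at distance 1. *)
Lemma winding_close g p q w w' : (forall s, 0 < dot (g s - p) (g s - q)) ->
  winding_number g p w -> winding_number g q w' -> `|w - w'| <= 2^-1.
Proof.
move=> hd /winding_ends[th [a [b [cth hth lth hw]]]].
move=> /winding_ends[th' [a' [b' [cth' hth' lth' hw']]]].
have cd : continuous (fun s => th s - th' s).
  by apply: continuous_pt => s; apply: (@continuousB _ R R); [exact: cth|exact: cth'].
have [|k hk] := @leash_half setT _ (fun _ _ _ _ _ _ => I) cd.
  by move=> s _; exact: cos_argument_gt0 (hth s) (hth' s) (hd s).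
have p0 := @pi_gt0 R.
have : `|(w - w') * (2 * pi)| <= pi.
  apply/ler_addgt0Pr => e e0; have e4 : 0 < e / 4 by rewrite divr_gt0.
  have [N hN] := lth _ e4; have [N' hN'] := lth' _ e4.
  pose s := Num.max `|N| `|N'| + 1.
  have hs : N < s /\ N' < s.
    have := ler_norm N; have := ler_norm N'.
    have : `|N| <= Num.max `|N| `|N'| by rewrite le_max lexx.
    have : `|N'| <= Num.max `|N| `|N'| by rewrite le_max lexx orbT.
    rewrite /s; split; lra.
  have h1 := (hN s).1 hs.1; have h2 := (hN' s).1 hs.2.
  have h3 : `|th (- s) - a| < e / 4 by apply: (hN (- s)).2; rewrite ltrN2 hs.1.
  have h4 : `|th' (- s) - a'| < e / 4 by apply: (hN' (- s)).2; rewrite ltrN2 hs.2.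
  have := hk s Logic.I; have := hk (- s) Logic.I.
  rewrite mulrBl hw hw'; move: h1 h2 h3 h4; rewrite !ltr_norml ler_norml; lra.
rewrite normrM [X in _ * X]gtr0_norm ?mulr_gt0 // mulrA mulrC -ler_pdivlMl //.
rewrite mulVf ?gt_eqF //; lra.
Qed.

End Winding.

(** * Sides of a periodic arc *)
Section PeriodicSides.
Context {R : realType}.
Variables (P : R) (G : set (R * R)) (g : R -> R * R).
Hypotheses (P0 : 0 < P) (hg : arc_param g G).
Hypothesis perG : xperiodic_set P G.
Hypothesis wind : forall p, ~ G p -> arc_winding G p (- 2^-1) \/ arc_winding G p 2^-1.
Implicit Types (p a c : R * R) (s t w : R).

Lemma arc_windingP p w : arc_winding G p w <-> ~ G p /\ winding_number g p w.
Proof.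
split=> -[Gp]; last by move=> h; split=> //; exists g.
by move=> [g' hg' h]; split=> //; exact: winding_reparam hg' hg h.
Qed.

Lemma closed_arc : closed G.
Proof.
have [cg _ rg _ _] := hg; rewrite -rg.
apply: (@closed_proper_image _ setT g cg) => //.
by move=> M; have [N hN] := arc_proper M hg; exists N => s _; exact: hN.
Qed.

Lemma arc_neq p s : ~ G p -> 0 < enorm (g s - p).
Proof.
have [_ _ rg _ _] := hg.
by rewrite enorm_gt0 subr_eq0; apply: contra_notN => /eqP <-; rewrite -rg; exists s.
Qed.

Lemma sftD m n p : sft P m (sft P n p) = sft P (m + n) p.
Proof. by apply: plane_eq; rewrite /sft /= ?intrD; ring. Qed.

Lemma sft0 p : sft P 0 p = p.
Proof. by apply: plane_eq; rewrite /sft /= ?mul0r addr0. Qed.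

Lemma sftK n : cancel (sft P n) (sft P (- n)).
Proof. by move=> p; rewrite sftD addNr sft0. Qed.

Lemma xperiodic_sft n p : G p -> G (sft P n p).
Proof.
have h1 q : G q -> G (sft P 1 q).
  by move=> Gq; rewrite -perG; exists q => //; rewrite /sft mul1r.
have h2 q : G q -> G (sft P (- 1) q).
  rewrite -{1}perG => -[r Gr <-].
  have -> : r + (P, 0) = sft P 1 r by rewrite /sft mul1r.
  by rewrite sftD addNr sft0.
have hn (k : nat) : forall q, G q -> G (sft P k q) /\ G (sft P (- k%:Z) q).
  elim: k => [|k IH] q Gq; first by rewrite oppr0 sft0.
  have [i1 i2] := IH _ Gq; rewrite intS opprD -!sftD.
  by split; [exact: h1|exact: h2].
move=> Gp; case: n => k; first by have [] := hn k p Gp.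
by rewrite NegzE; have [] := hn k.+1 p Gp.
Qed.

Lemma xperiodic_sftE n p : G (sft P n p) <-> G p.
Proof.
by split=> h; [rewrite -(sftK n p)|]; exact: xperiodic_sft.
Qed.

Lemma arc_winding_sft n p w : arc_winding G p w -> arc_winding G (sft P n p) w.
Proof.
move=> [Gp [g' hg' [th [a [b [cth hth la lb hw]]]]]]; split; first by rewrite xperiodic_sftE.
have [cg' ig' rg' lN ly] := hg'.
exists (fun s => sft P n (g' s)).
  split.
  - apply: continuous_pt => s; apply: (@continuousD _ (R * R)%type); last exact: cst_continuous.
    exact: cg'.
  - by move=> s t /addIr; exact: ig'.
  - apply/seteqP; split=> z.
      by move=> [s _ <-]; apply: xperiodic_sft; rewrite -rg'; exists s.
    rewrite -(xperiodic_sftE (- n)) -{1}rg' => -[s _ e]; exists s => //.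
    by rewrite e -{1}(opprK n) sftK.
  - apply/cvgrNyPlt => M; move/cvgrNyPlt : lN => /(_ (M - n%:~R * P)).
    by apply: filterS => s /=; rewrite ltrBrDr.
  - apply/cvgryPgt => M; move/cvgryPgt : ly => /(_ (M - n%:~R * P)).
    by apply: filterS => s /=; rewrite ltrBlDr.
exists th, a, b; split=> // s.
have -> : sft P n (g' s) - sft P n p = g' s - p by apply: plane_eq; rewrite /sft /=; ring.
exact: hth.
Qed.

Lemma arc_winding_disjoint p : arc_winding G p (- 2^-1) -> ~ arc_winding G p 2^-1.
Proof.
move=> /arc_windingP[Gp h1] /arc_windingP[_ h2].
have : `|- 2^-1 - 2^-1 : R| <= 2^-1.
  apply: winding_close h1 h2 => s.
  by rewrite dotvv exprn_gt0 // arc_neq.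
rewrite -opprD normrN gtr0_norm ?addr_gt0 ?invr_gt0 //; lra.
Qed.

(** A nearby point sees the arc at acute angles to [p], so its winding number differs by at most
    [2^-1]; as every point off the arc has winding number [2^-1] or [- 2^-1], the value cannot
    change. *)
Lemma open_arc_winding w : w = 2^-1 \/ w = - 2^-1 -> open [set p | arc_winding G p w].
Proof.
move=> hw; rewrite openE => p Gp /=.
have nG : (~` G) p by case: Gp.
have := open_nbhs_nbhs (conj (closed_openC closed_arc) nG).
move=> /nbhs_ballP[e /= e0 he].
apply/nbhs_ballP; exists (e / 2); first by rewrite /= divr_gt0.
move=> q hq; have nq : ~ G q by apply: (he q); apply: le_ball hq; lra.
have {}hq : enorm (p - q) < e.
  move: hq; rewrite -ball_normE /= => hq; apply: le_lt_trans (enorm_le_normr _) _; lra.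
have far s : e <= enorm (g s - p).
  apply: le_trans (normr_le_enorm _); rewrite leNgt; apply/negP => h.
  have [_ _ rg _ _] := hg; have /(_ (g s)) : ball p e `<=` ~` G by [].
  rewrite -ball_normE /= distrC => /(_ h); apply; by rewrite -rg; exists s.
have [w' hw' Wq] : exists2 w', w' = 2^-1 \/ w' = - 2^-1 & arc_winding G q w'.
  by have [h|h] := wind nq; [exists (- 2^-1); [right|]|exists 2^-1; [left|]].
suff -> : w = w' by [].
move/arc_windingP : Gp => [_ Gp]; move/arc_windingP : (Wq) => [_ Gq].
have : `|w - w'| <= 2^-1.
  apply: winding_close Gp Gq => s; apply: dot_far_gt0.
  exact: lt_le_trans hq (far s).
by case: hw => ->; case: hw' => -> //; rewrite ler_norml; lra.
Qed.

(** Far along either end [a] and [c] are seen at an acute angle, so the arguments agree there up to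
    [k] or [l] whole turns. Whether [k = l] decides whether the arc separates the two points. *)
Lemma arc_argument_gap a c (tha thc : R -> R) : continuous tha -> continuous thc ->
  (forall s, argument (tha s) (g s - a)) -> (forall s, argument (thc s) (g s - c)) ->
  exists N (k l : int), forall s,
   (N < s -> `|tha s - thc s - k%:~R * (2 * pi)| < pi / 2) /\
   (s < - N -> `|tha s - thc s - l%:~R * (2 * pi)| < pi / 2).
Proof.
move=> ca cc ha hc.
have [N hN] := arc_ends (`|a.1| + enorm (a - c)) hg.
have cd : continuous (fun s => tha s - thc s).
  by apply: continuous_pt => s; apply: (@continuousB _ R R); [exact: ca|exact: cc].
have gap s : `|a.1| + enorm (a - c) < `|(g s).1| -> 0 < cos (tha s - thc s).
  move=> h; apply: cos_argument_gt0 (ha s) (hc s) _; apply: dot_far_gt0.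
  apply: lt_le_trans (norm1_le_enorm _); rewrite /=.
  by have := ler_normD ((g s).1 - a.1) a.1; rewrite subrK; lra.
have [|k hk] := @leash_half _ `]N, +oo[ _ (@interval_is_interval _ _) cd.
  move=> s /=; rewrite in_itv /= andbT => /(hN s).1 h; apply: gap.
  exact: lt_le_trans h (ler_norm _).
have [|l hl] := @leash_half _ `]-oo, (- N)[ _ (@interval_is_interval _ _) cd.
  move=> s /=; rewrite in_itv /= => /(hN s).2 h; apply: gap.
  by have := ler_norm (- (g s).1); rewrite normrN; lra.
exists N, k, l => s; split=> hs; first by apply: hk; rewrite /= in_itv /= hs.
by apply: hl; rewrite /= in_itv.
Qed.

(** If [closure V] missed [p], it would miss a sub-arc around it, and the frontier of [V] would lie
    on two disjoint rays of the arc. Whole turns can be removed on each ray independently, which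
    gives a phase primitive small at infinity: the rays do not separate [a] from [c]. *)
Lemma arc_side_closure (V W : set (R * R)) : open V -> open W ->
  (forall p, V p -> ~ W p) -> (forall p, [\/ V p, W p | G p]) ->
  (forall p, V p -> ~ G p) -> (forall p, W p -> ~ G p) ->
  (forall p, ~ G p -> exists w, winding_number g p w) ->
  V !=set0 -> W !=set0 -> G `<=` closure V.
Proof.
move=> oV oW VW cov VG WG hw [a Va] [c Wc] p Gp; apply: contrapT => np.
have [cg ig rg _ _] := hg.
have [s0 _ gs0] : range g p by rewrite rg.
have := open_nbhs_nbhs (conj (closed_openC (@closed_closure _ V)) np).
rewrite -gs0 => /cg /nbhs_ballP[e /= e0 he].
have clW z : closure V z -> ~ W z.
  by move=> hz Wz; have [y [Vy Wy]] := hz _ (open_nbhs_nbhs (conj oW Wz)); exact: (VW y).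
pose A := `]-oo, (s0 - e)] `|` `[(s0 + e), +oo[ : set R.
have cA : closed A by apply: closedU; exact: interval_closed.
have prop M : exists N, forall s, A s -> `|g s| <= M -> `|s| <= N.
  by have [N hN] := arc_proper M hg; exists N => s _; exact: hN.
have clV : closure V `<=` V `|` g @` A.
  move=> z hz; have [Vz|/(clW _ hz)//|] := cov z; [by left|rewrite -rg => -[s _ gs]].
  right; exists s => //; rewrite /A /= !in_itv /= andbT.
  have [h1|h1] := leP s (s0 - e); first by left.
  have [h2|h2] := leP (s0 + e) s; first by right.
  exfalso; have : (~` closure V) (g s) by apply: he; rewrite /ball /= ltr_norml; lra.
  by rewrite gs.
have Vc : ~ V c by move=> /VW.
have nGA z : ~ G z -> ~ (g @` A) z by move=> + [s _ gs]; rewrite -gs -rg; apply; exists s.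
have [wa /winding_ends[tha [xa [ya [ca ha _ _]]]]] := hw a (VG _ Va).
have [wc /winding_ends[thc [xc [yc [cc hc _ _]]]]] := hw c (WG _ Wc).
have [N [k [l hN]]] := arc_argument_gap ca cc ha hc.
(* The jump from [l] to [k] at [s0] is harmless: it lies in the gap of [A]. *)
pose phi s := tha s - thc s - (if s < s0 then l else k)%:~R * (2 * pi).
have cd (n : int) : continuous (fun s => tha s - thc s - n%:~R * (2 * pi)).
  apply: continuous_pt => s; apply: (@continuousB _ R R); last exact: cst_continuous.
  by apply: (@continuousB _ R R); [exact: ca|exact: cc].
apply: (@arc_not_separating _ A g cA cg prop V phi tha thc 1 1 a c oV clV Va Vc) => //.
- by apply: nGA; exact: WG.
- by apply: nGA; exact: VG.
- apply: withinU_continuous; try exact: interval_closed.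
    apply: (@subspace_eq_continuous _ _ _ (fun s => tha s - thc s - l%:~R * (2 * pi))).
      move=> s; rewrite inE /= in_itv /= => hs; transitivity (phi s) => //; rewrite /phi ifT //; lra.
    exact: continuous_subspaceT.
  apply: (@subspace_eq_continuous _ _ _ (fun s => tha s - thc s - k%:~R * (2 * pi))).
    move=> s; rewrite inE /= in_itv /= andbT => hs; transitivity (phi s) => //; rewrite /phi ifF //.
    by apply/negbTE; rewrite -leNgt; lra.
  exact: continuous_subspaceT.
- by move=> s t _ _ /ig ->.
- by move=> s _; rewrite /phi -mulNr -mulrNz cisDzpi !mul1r.
exists (Num.max `|N| `|s0|) => s _; rewrite gt_max => /andP[h1 h2].
rewrite /phi ltW //; have := ler_norm N; have := ler_norm s0; have := ler_norm (- s0).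
rewrite normrN; move: h1 h2; have [s_0|s_0] := ger0P s => h1 h2 h3 h4 h5.
  by rewrite ifF; [apply: (hN s).1; lra|apply/negbTE; rewrite -leNgt; lra].
by rewrite ifT; [apply: (hN s).2; lra|lra].
Qed.

(** Equal winding numbers force the same number of whole turns at both ends, so one continuous [phi]
    serves on the entire arc and a point [c] outside [V] cannot be separated from [a]. *)
Lemma arc_side_connected w (V : set (R * R)) : open V -> V !=set0 ->
  (forall p, V p -> arc_winding G p w) -> closure V `<=` V `|` G ->
  forall p, arc_winding G p w -> V p.
Proof.
move=> oV [a Va] hV clV c hc0; apply: contrapT => Vc.
have [cg ig rg _ _] := hg.
have /arc_windingP[Ga /winding_ends[tha [xa [ya [ca ha la wa]]]]] := hV a Va.
have /arc_windingP[Gc /winding_ends[thc [xc [yc [cc hc lc wc]]]]] := hc0.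
have [N [k [l hN]]] := arc_argument_gap ca cc ha hc.
have p0 := @pi_gt0 R.
have kl : l = k.
  (* With each limit approximated within [pi / 8], the error at each end is below [pi / 2 + pi / 4];
     the two together stay below [2 * pi], which makes the integer [k - l] vanish. *)
  have p8 : 0 < pi / 8 :> R by rewrite divr_gt0.
  have [Na hNa] := la _ p8; have [Nc hNc] := lc _ p8.
  pose s := `|N| + `|Na| + `|Nc| + 1.
  have hs : [/\ N < s, Na < s & Nc < s].
    have := ler_norm N; have := ler_norm Na; have := ler_norm Nc.
    have := normr_ge0 N; have := normr_ge0 Na; have := normr_ge0 Nc.
    by rewrite /s; split; lra.
  case: hs => s1 s2 s3.
  have := (hNa s).1 s2; have := (hNc s).1 s3; have := (hN s).1 s1.
  have := (hNa (- s)).2; have := (hNc (- s)).2; have := (hN (- s)).2.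
  rewrite !ltrN2 => /(_ s1) h1 /(_ s3) h2 /(_ s2) h3 h4 h5 h6.
  have : `|(k - l)%:~R * (2 * pi)| < 2 * pi :> R.
    rewrite intrB mulrBl; move: h1 h2 h3 h4 h5 h6 wa wc; rewrite !ltr_norml.
    set K := k%:~R * _; set L := l%:~R * _; set W := w * _; lra.
  rewrite normrM [X in _ * X]gtr0_norm ?mulr_gt0 // gtr_pMl ?mulr_gt0 //.
  rewrite -intr_norm ltrz1 => nm; clear -nm; lia.
have clV' : closure V `<=` V `|` g @` setT by rewrite rg.
have prop M : exists N, forall s, [set: R] s -> `|g s| <= M -> `|s| <= N.
  by have [N' hN'] := arc_proper M hg; exists N' => s _; exact: hN'.
pose phi s := tha s - thc s - k%:~R * (2 * pi).
apply: (@arc_not_separating _ setT g (@closedT _) cg prop V phi tha thc 1 1 a c oV clV' Va Vc) => //.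
- by rewrite rg.
- by rewrite rg.
- apply: continuous_subspaceT; apply: continuous_pt => s.
  apply: (@continuousB _ R R); last exact: cst_continuous.
  by apply: (@continuousB _ R R); [exact: ca|exact: cc].
- by move=> s t _ _ /ig ->.
- by move=> s _; rewrite /phi -mulNr -mulrNz cisDzpi !mul1r.
exists `|N| => s _ h1; rewrite /phi ltW //; have := ler_norm N.
move: h1; have [s_0|s_0] := ger0P s => h1 h2; first by apply: (hN s).1; lra.
by rewrite -{1}kl; apply: (hN s).2; lra.
Qed.

Lemma arc_bounded_mod : exists M, forall p, G p -> exists n, `|sft P n p| <= M.
Proof.
have [cg ig rg _ _] := hg.
have [N hN] := arc_ends P hg; have [M hM] := continuous_bounded_segment cg N.
exists M => p Gp; pose n := Num.floor (p.1 / P); exists (- n).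
have : G (sft P (- n) p) by exact: xperiodic_sft.
rewrite -rg => -[s _ gs]; rewrite -gs; apply: hM.
have : 0 <= (g s).1 < P.
  rewrite gs /sft /= mulrNz mulNr; have := floor_itv (p.1 / P); rewrite -/n.
  by rewrite ler_pdivlMr // ltr_pdivrMr // intrD mulrDl mul1r; lra.
move=> /andP[h1 h2]; rewrite ler_norml; have [k1 k2] := hN s.
apply/andP; split; rewrite leNgt; apply/negP.
  by move/k2; lra.
by move/k1; lra.
Qed.

(** For [e = 1] the arc lies above [p], so all directions stay in one open half turn of width [pi].
    A total increment of [+ pi] would have to start at the edge pointing right, but the left end of
    the arc has smaller abscissa than [p]. The case [e = -1] is the mirror image. *)
Lemma winding_sign (e : R) p w : e = 1 \/ e = -1 ->
  (forall s, 0 < e * (g s - p).2) -> winding_number g p w -> w <> e / 2.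
Proof.
move=> he hs /winding_ends[th [a [b [cth hth lth hw]]]] we.
have p0 := @pi_gt0 R.
have cd : continuous (fun s => th s - e * (pi / 2)).
  by apply: continuous_pt => s; apply: (@continuousB _ R R); [exact: cth|exact: cst_continuous].
have e2 : e * e = 1 by case: he => ->; ring.
have [|k hk] := @leash_half _ setT _ (fun _ _ _ _ _ _ => I) cd.
  move=> s _; have -> : cos (th s - e * (pi / 2)) = e * sin (th s).
    case: he => ->; first by rewrite !mul1r cosBpihalf.
    by rewrite !mulN1r opprK cosDpihalf.
  have := hs s; rewrite hth /= /GRing.scale /= => h.
  rewrite ltNge; apply: contraTN h => h; rewrite -leNgt.
  by rewrite mulrCA mulr_ge0_le0 // enorm_ge0.
have [N hN] := arc_ends (`|p.1|) hg.
have le1 : forall d, 0 < d -> exists s, [/\ s < - N, `|th s - a| < d & exists t, `|th t - b| < d].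
  move=> d d0; have [N1 hN1] := lth _ d0; pose s := `|N| + `|N1| + 1.
  have [h1 h2] : N < s /\ N1 < s.
    have := ler_norm N; have := ler_norm N1; have := normr_ge0 N; have := normr_ge0 N1.
    by rewrite /s; split; lra.
  exists (- s); split; first by rewrite ltrN2.
    by apply: (hN1 (- s)).2; rewrite ltrN2.
  by exists s; apply: (hN1 s).1.
have ba : b - a = e * pi by rewrite -hw we; field.
have d0 : 0 < pi / 8 :> R by rewrite divr_gt0.
have [s [sN sa [t tb]]] := le1 _ d0.
have gs : (g s - p).1 < 0.
  by have := (hN s).2 sN; have := ler_norm (- p.1); rewrite normrN /=; lra.
have : 0 < cos (th s - k%:~R * (2 * pi)).
  apply: cos_gt0_pihalf; have := hk s Logic.I; have := hk t Logic.I.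
  move: sa tb; rewrite !ltr_norml; set K := k%:~R * _ => sa tb.
  by case: he ba => -> ba hs1 ht1; apply/andP; split; lra.
have -> : cos (th s - k%:~R * (2 * pi)) = cos (th s).
  by have [] := cisDzpi (- k) (th s); rewrite mulrNz mulNr => ->.
move: gs; rewrite hth /= /GRing.scale /= => gs; apply/negP; rewrite -leNgt.
rewrite leNgt; apply: contraTN gs => h; rewrite -leNgt.
by rewrite mulr_ge0 ?enorm_ge0 // ltW.
Qed.

Lemma arc_far : exists M, forall p, (M < p.2 -> upper_compl G p) /\ (p.2 < - M -> lower_compl G p).
Proof.
have [cg ig rg _ _] := hg.
have [M hM] := arc_bounded_mod; exists M.
have hy q : G q -> `|q.2| <= M.
  move=> /hM[n]; rewrite prod_normE ge_max => /andP[_].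
  by rewrite /sft /= addr0.
have gy s : `|(g s).2| <= M by apply: hy; rewrite -rg; exists s.
move=> p; split=> hp.
  have nG : ~ G p by move=> /hy; rewrite ler_norml; lra.
  have [h|//] := wind nG; have /arc_windingP[_ h'] := h.
  exfalso; apply: (@winding_sign (-1) p _ _ _ h'); [by right| |by rewrite mulN1r].
  by move=> s; have := gy s; rewrite ler_norml /=; lra.
have nG : ~ G p by move=> /hy; rewrite ler_norml; lra.
have [//|h] := wind nG; have /arc_windingP[_ h'] := h.
exfalso; apply: (@winding_sign 1 p _ _ _ h'); [by left| |by rewrite mul1r].
by move=> s; have := gy s; rewrite ler_norml /=; lra.
Qed.

Lemma periodic_arc_sides : sides P G (lower_compl G) (upper_compl G).
Proof.
have [M hM] := arc_far.
have lo : lower_compl G !=set0 by exists (0, - M - 1); apply: (hM _).2 => /=; lra.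
have up : upper_compl G !=set0 by exists (0, M + 1); apply: (hM _).1 => /=; lra.
have olo : open (lower_compl G) by apply: open_arc_winding; right.
have oup : open (upper_compl G) by apply: open_arc_winding; left.
have lG p : lower_compl G p -> ~ G p by case.
have uG p : upper_compl G p -> ~ G p by case.
have hw p : ~ G p -> exists w, winding_number g p w.
  by move=> /wind [] /arc_windingP[_ h]; eexists; exact: h.
have cov p : [\/ lower_compl G p, upper_compl G p | G p].
  have [Gp|/wind[h|h]] := pselect (G p); first by constructor 3.
    by constructor 1.
  by constructor 2.
split=> //.
- by move=> p; exact: arc_winding_disjoint.
- by apply: (@arc_side_closure _ (upper_compl G)) => //; exact: arc_winding_disjoint.
- apply: (@arc_side_closure _ (lower_compl G)) => //.
    by move=> p h1 h2; exact: arc_winding_disjoint h2 h1.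
  by move=> p; case: (cov p); [constructor 2|constructor 1|constructor 3].
- by move=> V oV V0 VA clV p; apply: arc_side_connected.
- by move=> V oV V0 VA clV p; apply: arc_side_connected.
- by move=> n p; exact: arc_winding_sft.
- by move=> n p; exact: arc_winding_sft.
- exact: arc_bounded_mod.
Qed.

End PeriodicSides.

(** * Components of open sets of the plane *)

Section PlaneComponents.
Context {R : realType}.
Implicit Types (U : set (R * R)) (p q : R * R).

Lemma continuous_affine p q : continuous (fun t : R => p + t *: q).
Proof.
apply: continuous_pt => t; apply: (@continuousD _ (R * R)%type); first exact: cst_continuous.
by apply: (@continuousZ _ (R * R)%type); [exact: id|exact: cst_continuous].
Qed.

Lemma ball_component U p q e : ball p e `<=` U -> ball p e q ->
  connected_component U p q.
Proof.
move=> bU bq; have e0 : 0 < e.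
  by move: bq; rewrite -ball_normE /=; apply: le_lt_trans; exact: normr_ge0.
apply: (@connected_component_max _ _ ((fun t : R => p + t *: (q - p)) @` `[0, 1])).
- by exists 0; rewrite /= ?in_itv /= ?lexx ?ler01 // scale0r addr0.
- move=> _ [t + <-]; rewrite /= in_itv /= => /andP[t0 t1]; apply: bU.
  move: bq; rewrite -!ball_normE /= opprD addrA subrr add0r normrN normrZ (ger0_norm t0).
  by rewrite distrC; apply: le_lt_trans; rewrite ler_piMl.
- apply: connected_continuous_connected; first exact: segment_connected.
  exact/continuous_subspaceT/continuous_affine.
- by exists 1; rewrite /= ?in_itv /= ?lexx ?ler01 // scale1r subrKC.
Qed.

Lemma near_same_component U p : open U -> U p ->
  \forall q \near p, connected_component U q = connected_component U p.
Proof.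
move=> oU Up; have /nbhs_ballP[e /= e0 he] := open_nbhs_nbhs (conj oU Up).
apply/nbhs_ballP; exists e => // q bq; apply/esym/same_connected_component.
exact: ball_component bq.
Qed.

Lemma open_connected_component U p : open U -> open (connected_component U p).
Proof.
move=> oU; rewrite openE => q pq.
have Uq := connected_component_sub pq.
apply: filterS2 (near_same_component oU Uq) (open_nbhs_nbhs (conj oU Uq)) => r e Ur.
rewrite (same_connected_component pq) -e; exact: connected_component_refl.
Qed.

Lemma closure_connected_component U p : open U ->
  closure (connected_component U p) `&` U `<=` connected_component U p.
Proof.
move=> oU q [clq Uq]; have [r [pr e]] := clq _ (near_same_component oU Uq).
have {}e : connected_component U r = connected_component U q by [].
by rewrite (same_connected_component pr) e; exact: connected_component_refl.
Qed.

End PlaneComponents.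

Lemma dotZ {R : realType} (x : R) (u w : R * R) : dot (x *: u) w = x * dot u w.
Proof. by rewrite /dot /= /GRing.scale /=; ring. Qed.

(** * Sides of a closed curve *)
Section ClosedCurve.
Context {R : realType}.
Variables (G : set (R * R)) (g : R -> R * R).
Hypothesis hg : closed_param g G.
Implicit Types (p q a c : R * R) (s t : R).

Lemma closed_param_int n s : g (s + n%:~R) = g s.
Proof.
have [_ pg _ _] := hg.
have nat_case (k : nat) : forall t, g (t + k%:R) = g t.
  by elim: k => [|k IH] t; rewrite ?addr0 // -natr1 addrA pg IH.
case: n => k; first exact: nat_case.
by rewrite NegzE -(nat_case k.+1 (s + _)) mulrNz subrK.
Qed.

Lemma closed_param_unit t p : G p -> exists2 s, t <= s < t + 1 & g s = p.
Proof.
have [_ _ _ rg] := hg; rewrite -rg => -[s _ <-].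
exists (s + (- Num.floor (s - t))%:~R); last exact: closed_param_int.
by have := floor_itv (s - t); rewrite mulrNz intrD; lra.
Qed.

Lemma closed_param_inj s t : g s = g t -> `|s - t| < 1 -> s = t.
Proof.
have [_ _ ig _] := hg => gst st.
have h (x : R) : 0 <= x + (- Num.floor x)%:~R < 1.
  by have := floor_itv x; rewrite mulrNz intrD; lra.
have e : s + (- Num.floor s)%:~R = t + (- Num.floor t)%:~R.
  by apply: ig; rewrite // !closed_param_int.
have st' : s - t = (Num.floor s - Num.floor t)%:~R by move: e; rewrite intrB !mulrNz; lra.
move: st; rewrite st' -intr_norm ltrz1 => nm.
have n0 : Num.floor s - Num.floor t = 0 by clear -nm; lia.
by move: st'; rewrite n0 => /eqP; rewrite subr_eq0 => /eqP.
Qed.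

Lemma closed_param_loop : g 0 = g 1.
Proof. by rewrite -(closed_param_int 1 0) add0r. Qed.

Lemma closed_param_image : g @` `[0, 1] = G.
Proof.
have [_ _ _ rg] := hg; apply/seteqP; split=> p; first by move=> [s _ <-]; rewrite -rg; exists s.
move=> /(closed_param_unit 0)[s hs gs]; exists s => //; rewrite /= in_itv /=; lra.
Qed.

Lemma proper_segment (a b M : R) : exists N, forall s, `[a, b]%classic s -> `|g s| <= M -> `|s| <= N.
Proof.
exists (`|a| + `|b|) => s; rewrite /= in_itv /= => /andP[h1 h2] _.
have := ler_norm b; have := ler_norm (- a); rewrite normrN ler_norml.
by have := normr_ge0 a; have := normr_ge0 b; lra.
Qed.

Lemma closed_curve : closed G.
Proof.
have [cg _ _ _] := hg; rewrite -closed_param_image.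
apply: (@closed_proper_image _ `[0, 1] g cg) => //; last exact: interval_closed.
by move=> M; exact: proper_segment.
Qed.

Let oG : open (~` G) := closed_openC closed_curve.

Lemma curve_bounded : exists M, forall p, G p -> `|p| <= M.
Proof.
have [cg _ _ _] := hg; have [M hM] := continuous_bounded_segment cg 1.
exists M => p; rewrite -closed_param_image => -[s + <-].
by rewrite /= in_itv /= => h; apply: hM; rewrite ler_norml; lra.
Qed.

(** The radial ray outward from [p] avoids the curve, and it is connected and unbounded. *)
Lemma curve_far_ext M p : (forall p, G p -> `|p| <= M) -> `|M| < `|p| -> ext_compl G p.
Proof.
move=> hM Mp; have p0 : 0 < `|p| by apply: le_lt_trans Mp.
have off t : 1 <= t -> ~ G (t *: p).
  move=> t1 /hM; apply/negP; rewrite -ltNge normrZ ger0_norm ?(le_trans _ t1) //.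
  by apply: le_lt_trans (ler_norm _) (lt_le_trans Mp _); rewrite ler_peMl.
split; first by rewrite -[p]scale1r; apply: off.
have ray : (fun t => 0 + t *: p) @` `[1, +oo[ `<=` connected_component (~` G) p.
  apply: connected_component_max.
  - by exists 1; rewrite /= ?in_itv /= ?lexx // scale1r add0r.
  - by move=> _ [t + <-]; rewrite /= in_itv /= andbT add0r; exact: off.
  - apply: connected_continuous_connected.
      exact/connected_intervalP/interval_is_interval.
    exact/continuous_subspaceT/continuous_affine.
move=> [N [_ hN]].
pose t := 1 + (`|N| + 1) / `|p|.
have t1 : 1 <= t by rewrite lerDl divr_ge0 // addr_ge0.
have := hN (`|N| + 1); have -> : N < `|N| + 1 by have := ler_norm N; lra.
move=> /(_ isT (t *: p)); have rt : connected_component (~` G) p (t *: p).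
  by apply: ray; exists t; rewrite /= ?in_itv /= ?t1 // add0r.
move=> /(_ rt); apply/negP; rewrite -ltNge normrZ ger0_norm ?(le_trans _ t1) //.
by rewrite mulrDl mul1r divfK ?gt_eqF //; lra.
Qed.

Lemma int_compl_bounded M p : (forall p, G p -> `|p| <= M) -> int_compl G p -> `|p| <= `|M|.
Proof.
move=> hM [_ bp]; rewrite leNgt; apply/negP => h.
by have [_] := curve_far_ext hM h.
Qed.

Lemma open_int_compl : open (int_compl G).
Proof.
rewrite openE => p [Gp bp]; apply: filterS2 (near_same_component oG Gp)
  (open_nbhs_nbhs (conj oG Gp)) => q e Gq.
by split=> //; rewrite e.
Qed.

Lemma open_ext_compl : open (ext_compl G).
Proof.
rewrite openE => p [Gp bp]; apply: filterS2 (near_same_component oG Gp)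
  (open_nbhs_nbhs (conj oG Gp)) => q e Gq.
by split=> //; rewrite e.
Qed.

Lemma closed_curve_neq p s : ~ G p -> g s - p != 0.
Proof.
have [_ _ _ rg] := hg.
by rewrite subr_eq0; apply: contra_notN => /eqP <-; rewrite -rg; exists s.
Qed.

Lemma continuous_sub_cst p : continuous (fun s => g s - p).
Proof.
have [cg _ _ _] := hg; apply: continuous_pt => s.
by apply: (@continuousB _ (R * R)%type); [exact: cg|exact: cst_continuous].
Qed.

Lemma curve_lift p s t : s <= t -> ~ G p -> exists2 th : R -> R, continuous th &
  forall x, s <= x <= t -> argument (th x) (g x - p).
Proof.
move=> st Gp; apply: lift_argument => //; first exact: continuous_sub_cst.
by move=> x _; exact: closed_curve_neq.
Qed.

(** The turn is locally constant in the base point, hence constant on a component; an unbounded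
    component contains a point so distant that the whole curve lies in a half plane as seen from
    it. *)
Lemma ext_compl_turn p x : ext_compl G p -> turn (fun s => g s - p) 0 1 x -> x = 0.
Proof.
move=> [Gp ub]; have [M hM] := curve_bounded.
(* Beyond [4 * |M| + 1] the sup norm of [q - g s] exceeds [3 * |M| + 1], while the Euclidean norm of
   [g s] is at most [2 * |M|]. *)
have [q Cq Mq] : exists2 q, connected_component (~` G) p q & 4 * `|M| + 1 < `|q|.
  apply: contrapT => h; apply: ub; exists (4 * `|M| + 1); split; first exact: num_real.
  move=> N hN q Cq; apply: le_trans (ltW hN); rewrite leNgt; apply/negP => h'.
  by apply: h; exists q.
have Gq : ~ G q by exact: connected_component_sub Cq.
have loop r : g 0 - r = g 1 - r by rewrite closed_param_loop.
suff H : turn (fun s => g s - q) 0 1 x -> x = 0.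
  pose P r := turn (fun s => g s - r) 0 1 x -> x = 0.
  apply: (@connected_locally_invariant _ (connected_component (~` G) p) P q) => //.
  - exact: component_connected.
  - move=> y Cy; have Gy := connected_component_sub Cy.
    have /nbhs_ballP[e /= e0 he] := open_nbhs_nbhs (conj oG Gy).
    apply/nbhs_ballP; exists (e / 2); first by rewrite /= divr_gt0.
    move=> z bz _; have Gz : ~ G z by apply: (he z); apply: le_ball bz; lra.
    have tt u v : turn (fun s => g s - y) 0 1 u -> turn (fun s => g s - z) 0 1 v -> u = v.
      move=> tu tv; apply: (@turn_leash _ _ _ 0 1 u v ler01 (loop y) (loop z) _ _ tu tv).
      - by move=> s _; exact: closed_curve_neq.
      - by move=> s _; exact: closed_curve_neq.
      move=> s _; apply/dot_gt0_not_opposite/dot_far_gt0.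
      apply: le_lt_trans (enorm_le_normr _) _.
      apply: lt_le_trans (normr_le_enorm _).
      have : e <= `|g s - y|.
        rewrite leNgt; apply/negP => h; apply: (he (g s)).
          by rewrite -ball_normE /= distrC.
        by have [_ _ _ <-] := hg; exists s.
      by move: bz; rewrite -ball_normE /=; lra.
    have [u tu] := @turn_ex _ _ 0 1 ler01 (@continuous_sub_cst y)
      (fun s _ => closed_curve_neq s Gy).
    have [v tv] := @turn_ex _ _ 0 1 ler01 (@continuous_sub_cst z)
      (fun s _ => closed_curve_neq s Gz).
    have uv := tt _ _ tu tv.
    split=> h tx; apply: h; first by have := tu; rewrite (tt _ _ tu tx).
    by have := tv; rewrite -(tt _ _ tx tv).
  - exact: connected_component_refl.
move=> tx.
have dq s : 0 < dot (g s - q) (- q).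
  have gs : `|g s| <= `|M|.
    by apply: le_trans (hM _ _) (ler_norm _); have [_ _ _ <-] := hg; exists s.
  have -> : dot (g s - q) (- q) = dot (q - g s) (q - 0) by rewrite /dot /=; ring.
  apply: dot_far_gt0; rewrite subr0.
  apply: le_lt_trans (enorm_le_normr _) (lt_le_trans _ (normr_le_enorm _)).
  by have := ler_normD (q - g s) (g s); rewrite subrK; have := normr_ge0 M; lra.
apply: (@turn_leash _ _ (fun=> - q) 0 1 x 0 ler01 (loop q) _ _ _ tx (turn_cst _ _ _)) => //.
- by move=> s _; exact: closed_curve_neq.
- by move=> s _; apply: contraTneq (dq s) => ->; rewrite /dot /= !mulr0 addr0 ltxx.
- by move=> s _; exact: dot_gt0_not_opposite.
Qed.

Lemma turn_lift p (th : R -> R) : continuous th ->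
  (forall s, 0 <= s <= 1 -> argument (th s) (g s - p)) ->
  turn (fun s => g s - p) 0 1 (th 1 - th 0).
Proof. by move=> cth hth; exists th. Qed.

Lemma lift_turn_int p (th : R -> R) : ~ G p ->
  (forall s, 0 <= s <= 1 -> argument (th s) (g s - p)) ->
  exists n : int, th 1 - th 0 = n%:~R * (2 * pi).
Proof.
move=> Gp hth; apply: (argument_unique (closed_curve_neq 1 Gp)); first by apply: hth; rewrite ler01 lexx.
by rewrite -closed_param_loop; apply: hth; rewrite lexx ler01.
Qed.

Lemma closed_param_eq01 (phi : R -> R) s t : phi 0 = phi 1 ->
  `[0, 1]%classic s -> `[0, 1]%classic t -> g s = g t -> phi s = phi t.
Proof.
rewrite /= !in_itv /= => e01 /andP[s0 s1] /andP[t0 t1] gst.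
have [lt|ge] := ltP `|s - t| 1; first by rewrite (closed_param_inj gst lt).
have [[-> ->]|[-> ->]] // : s = 0 /\ t = 1 \/ s = 1 /\ t = 0.
by move: ge; have [h|h] := leP 0 (s - t); [rewrite ger0_norm // => ge; right|
  rewrite ltr0_norm // => ge; left]; split; lra.
Qed.

Lemma component_closure p : closure (connected_component (~` G) p) `<=`
  connected_component (~` G) p `|` G.
Proof.
move=> q clq; have [Gq|Gq] := pselect (G q); [by right|left].
exact: closure_connected_component.
Qed.

Lemma far_ext_compl : exists p, ext_compl G p.
Proof.
have [M hM] := curve_bounded; exists (`|M| + 1, 0); apply: (curve_far_ext hM).
have h : 0 < `|M| + 1 by rewrite ltr_wpDl.
by rewrite prod_normE lt_max /= (gtr0_norm h) ltrDl ltr01.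
Qed.

Lemma small_on_segment (phi : R -> R) (a b : R) : exists N, forall s,
  `[a, b]%classic s -> N < `|s| -> `|phi s| <= pi / 2.
Proof.
exists (`|a| + `|b|) => s; rewrite /= in_itv /= => /andP[h1 h2].
have : `|s| <= `|a| + `|b|.
  have := ler_norm b; have := ler_norm (- a); rewrite normrN ler_norml.
  by have := normr_ge0 a; have := normr_ge0 b; lra.
by rewrite leNgt => /negP h3 h4.
Qed.

(** If the turn were 0, the argument of [g s - p] would close up and descend to the curve. That is a
    primitive of the phase with exponents 1 and 0, which the bounded form of Borsuk's criterion
    excludes. *)
Lemma int_compl_turn p x : int_compl G p -> turn (fun s => g s - p) 0 1 x -> x != 0.
Proof.
move=> ip [th cth [hth hx]]; apply/eqP => x0; have [Gp bp] := ip.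
have [cg _ _ _] := hg; have [c Ec] := far_ext_compl.
have [M hM] := curve_bounded.
have CM q : connected_component (~` G) p q -> `|q| <= `|M|.
  move=> Cq; apply: (int_compl_bounded hM); split; first exact: connected_component_sub Cq.
  by rewrite -(same_connected_component Cq).
have [thc cthc hthc] := curve_lift ler01 Ec.1.
suff : 1 = 0 :> int by [].
have cI : closed `[0, 1 : R] by exact: interval_closed.
apply: (@arc_exponent_eq0 _ `[0, 1] g cI cg _ (connected_component (~` G) p) th th thc 1 0 p c).
- by move=> N; exact: proper_segment.
- exact: open_connected_component.
- by rewrite closed_param_image; exact: component_closure.
- exact: connected_component_refl.
- move=> Cc; case: Ec => Gc; apply.
  by rewrite -(same_connected_component Cc).
- by rewrite closed_param_image; case: Ec.
- by rewrite closed_param_image.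
- exact: continuous_subspaceT.
- by move=> s t; apply: closed_param_eq01; move: hx; rewrite x0 => /eqP; rewrite subr_eq0 => /eqP.
- by move=> s; rewrite /= in_itv; exact: hth.
- by move=> s; rewrite /= in_itv; exact: hthc.
- by move=> s _; rewrite mul1r mul0r subr0.
- exact: small_on_segment.
- exact: CM.
Qed.

(** Removing an open sub-arc around the missed point leaves a simple arc, on which arguments lift
    without any closing condition; such an arc does not separate [a] from [c]. *)
Lemma closed_curve_side_closure (V W : set (R * R)) : open V -> open W ->
  (forall p, V p -> ~ W p) -> (forall p, [\/ V p, W p | G p]) ->
  (forall p, V p -> ~ G p) -> (forall p, W p -> ~ G p) ->
  V !=set0 -> W !=set0 -> G `<=` closure V.
Proof.
move=> oV oW VW cov VG WG [a Va] [c Wc] p Gp; apply: contrapT => np.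
have [cg _ _ rg] := hg.
have [s0 _ gs0] := closed_param_unit 0 Gp.
have := open_nbhs_nbhs (conj (closed_openC (@closed_closure _ V)) np).
rewrite -gs0 => /cg /nbhs_ballP[e' /= e'0 he'].
(* The bound [1 / 4] keeps the remaining parameter interval non-empty, and [e > 0] keeps it shorter
   than a period, so that [g] is injective on it. *)
pose e := Num.min e' (1 / 4).
have e0 : 0 < e by rewrite lt_min e'0 divr_gt0.
have e1 : e <= 1 / 4 by rewrite ge_min lexx orbT.
have he s : `|s - s0| < e -> ~ closure V (g s).
  move=> hs; apply: he'; rewrite /ball /= distrC; apply: lt_le_trans hs _.
  by rewrite ge_min lexx.
have clW z : closure V z -> ~ W z.
  by move=> hz Wz; have [y [Vy Wy]] := hz _ (open_nbhs_nbhs (conj oW Wz)); exact: (VW y).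
pose A := `[s0 + e, s0 + 1 - e]%classic.
have cA : closed A by exact: interval_closed.
have clV : closure V `<=` V `|` g @` A.
  move=> z hz; have [Vz|/(clW _ hz)//|Gz] := cov z; [by left|right].
  have [s hs gs] := closed_param_unit s0 Gz; exists s => //.
  rewrite /A /= in_itv /=; apply/andP; split; rewrite leNgt; apply/negP => h.
    by apply: (he s); rewrite ?gs // ltr_norml; lra.
  apply: (he (s - 1)); first by rewrite ltr_norml; lra.
  by rewrite -(closed_param_int 1) subrK gs.
have Vc : ~ V c by move=> /VW.
have nGA z : ~ G z -> ~ (g @` A) z by move=> + [s _ gs]; rewrite -gs -rg; apply; exists s.
have ab : s0 + e <= s0 + 1 - e by lra.
have [tha ca ha] := curve_lift ab (VG _ Va).
have [thc cc hc] := curve_lift ab (WG _ Wc).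
apply: (@arc_not_separating _ A g cA cg _ V (fun s => tha s - thc s) tha thc 1 1 a c oV clV Va Vc) => //.
- by move=> N; exact: proper_segment.
- by apply: nGA; exact: WG.
- by apply: nGA; exact: VG.
- apply: continuous_subspaceT; apply: continuous_pt => s.
  by apply: (@continuousB _ R R); [exact: ca|exact: cc].
- move=> s t; rewrite /A /= !in_itv /= => hs ht gst; rewrite (closed_param_inj gst) //.
  by rewrite ltr_norml; lra.
- by move=> s _; rewrite !mul1r.
- exact: small_on_segment.
Qed.

(** The points [a] and [c] have [m] and [n] turns, not known to be equal. The crossed combination
    [n * tha - m * thc] closes up in any case, so the bounded criterion gives [n = 0], against
    [int_compl_turn]. This is why the phase carries general exponents. *)
Lemma int_compl_connected V : open V -> V !=set0 -> V `<=` int_compl G ->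
  closure V `<=` V `|` G -> int_compl G `<=` V.
Proof.
move=> oV [a Va] VD clV c Dc; apply: contrapT => Vc.
have [cg _ _ _] := hg; have [M hM] := curve_bounded.
have [tha ca ha] := curve_lift ler01 (VD _ Va).1.
have [thc cc hc] := curve_lift ler01 Dc.1.
have [m hm] := lift_turn_int (VD _ Va).1 ha.
have [n hn] := lift_turn_int Dc.1 hc.
suff n0 : n = 0.
  by have /eqP := int_compl_turn Dc (turn_lift cc hc); apply; rewrite hn n0 mul0r.
have cI : closed `[0, 1 : R] by exact: interval_closed.
apply: (@arc_exponent_eq0 _ `[0, 1] g cI cg _ V
  (fun s => n%:~R * tha s - m%:~R * thc s) tha thc n m a c) => //.
- by move=> N; exact: proper_segment.
- by rewrite closed_param_image.
- by rewrite closed_param_image; case: Dc.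
- by rewrite closed_param_image; case: (VD _ Va).
- apply: continuous_subspaceT; apply: continuous_pt => s.
  apply: (@continuousB _ R R); apply: (@continuousM R); try exact: cst_continuous.
    exact: ca.
  exact: cc.
- move=> s t; apply: (closed_param_eq01 (phi := fun s => n%:~R * tha s - m%:~R * thc s)).
  apply/eqP; rewrite eq_sym -subr_eq0; apply/eqP.
  transitivity (n%:~R * (tha 1 - tha 0) - m%:~R * (thc 1 - thc 0)); first by ring.
  by rewrite hm hn; ring.
- exact: small_on_segment.
- by move=> z /VD; exact: int_compl_bounded hM.
Qed.

(** Both turns vanish, so the plain difference of arguments closes up; as [V] may be unbounded, the
    criterion used is the one with smallness at infinity, which is vacuous on a compact curve. *)
Lemma ext_compl_connected V : open V -> V !=set0 -> V `<=` ext_compl G ->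
  closure V `<=` V `|` G -> ext_compl G `<=` V.
Proof.
move=> oV [a Va] VE clV c Ec; apply: contrapT => Vc.
have [cg _ _ _] := hg.
have [tha ca ha] := curve_lift ler01 (VE _ Va).1.
have [thc cc hc] := curve_lift ler01 Ec.1.
have wa := ext_compl_turn (VE _ Va) (turn_lift ca ha).
have wc := ext_compl_turn Ec (turn_lift cc hc).
have cI : closed `[0, 1 : R] by exact: interval_closed.
apply: (@arc_not_separating _ `[0, 1] g cI cg _ V
  (fun s => tha s - thc s) tha thc 1 1 a c) => //.
- by move=> N; exact: proper_segment.
- by rewrite closed_param_image.
- by rewrite closed_param_image; case: Ec.
- by rewrite closed_param_image; case: (VE _ Va).
- apply: continuous_subspaceT; apply: continuous_pt => s.
  by apply: (@continuousB _ R R); [exact: ca|exact: cc].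
- by move=> s t; apply: (closed_param_eq01 (phi := fun s => tha s - thc s)); lra.
- by move=> s _; rewrite !mul1r.
- exact: small_on_segment.
Qed.

(* For [q+] and [q-] close to a regular point, on either side of the curve, the
   phase of [(g - q+) / (g - q-)] crosses [-1] exactly once, so the winding
   numbers about them differ and one of the two is inside. *)
Lemma regular_int_compl : (forall s, derivable g s 1) -> derive1 g 0 != 0 ->
  int_compl G !=set0.
Proof.
move=> dg v0; have [cg _ _ rg] := hg; pose v : R * R := derive1 g 0.
have {}v0 : v != 0 by [].
have vv : 0 < dot v v by rewrite dotvv exprn_gt0 // enorm_gt0.
have [del del0 hdel] : exists2 del, 0 < del & forall h, 0 < `|h| < del ->
    0 < h^-1 * dot (g h - g 0) v.
  have cv : h^-1 *: (g (h + 0) - g 0) @[h --> 0^'] --> v.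
    have := dg 0; rewrite /derivable.
    have -> : (fun h : R => h^-1 *: ((g \o shift 0) (h *: 1) - g 0)) =
       (fun h => h^-1 *: (g (h + 0) - g 0)).
      by apply/funext => h; rewrite /= [h%:A]mulr1.
    exact.
  have cd : {for v, continuous (fun z : R * R => dot z v)}.
    by apply: continuous_at_dot; [exact: id|exact: cst_continuous].
  have hz : \forall z \near v, 0 < dot z v by exact: cvgr_gt cd _ vv.
  have : \forall h \near 0^', 0 < dot (h^-1 *: (g (h + 0) - g 0)) v by exact: cv _ hz.
  move=> /nbhs_ballP[e /= e0 he]; exists e => // h /andP[h0 he'].
  have := he h; rewrite /ball /= sub0r normrN => /(_ he').
  rewrite -normr_gt0 => /(_ h0); rewrite addr0 /dot /GRing.scale /= => H.
  by rewrite mulrDr !mulrA.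
pose d := Num.min del (1 / 4).
have d0 : 0 < d by rewrite lt_min del0 divr_gt0.
have d1 : d <= 1 / 4 by rewrite ge_min lexx orbT.
have dpos s : 0 < s < d -> 0 < dot (g s - g 0) v.
  move=> /andP[s0 sd]; have := hdel s; rewrite gtr0_norm // s0 (lt_le_trans sd) ?ge_min ?lexx //.
  by move=> /(_ isT); rewrite pmulr_rgt0 // invr_gt0.
have dneg s : 1 - d < s < 1 -> dot (g s - g 0) v < 0.
  move=> hs; rewrite -(subrK 1 s) -[X in g X](_ : s - 1 + 1%:~R = _) // closed_param_int.
  have := hdel (s - 1); rewrite ltr0_norm; last by lra.
  have -> : 0 < - (s - 1) < del.
    have : d <= del by rewrite ge_min lexx.
    by move=> h; lra.
  by move=> /(_ isT); rewrite nmulr_rgt0 // invr_lt0; lra.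
have [eta eta0 heta] : exists2 eta, 0 < eta & forall s, d <= s <= 1 - d -> eta <= enorm (g s - g 0).
  have dd : d <= 1 - d by lra.
  have [|c cI hc] := @EVT_min R (fun s => enorm (g s - g 0)) _ _ dd.
    apply: continuous_subspaceT; apply: continuous_pt => s; apply: continuous_at_enorm.
    exact: continuous_sub_cst.
  exists (enorm (g c - g 0)); last by move=> s hs; apply: hc; rewrite in_itv.
  move: cI; rewrite in_itv /= => cI; rewrite enorm_gt0 subr_eq0; apply/eqP => /closed_param_inj e.
  by have := e; rewrite subr0 ltr_norml => /(_ ltac:(lra)); lra.
have v1 : 0 < enorm v by rewrite enorm_gt0.
(* [k] scales the normal [n], which is [v] turned by a right angle, to length [eta / 2]: less than
   the distance from [g 0] to the part of the curve with parameters in [[d, 1 - d]]. *)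
pose k := eta / 2 / enorm v.
have k0 : 0 < k by rewrite !divr_gt0.
pose n : R * R := (- (k * v.2), k * v.1).
have nE : enorm n = k * enorm v.
  rewrite -[k in RHS]gtr0_norm // -enormZ /enorm /n /GRing.scale /= !exprMn sqrrN !exprMn.
  by rewrite addrC.
have nn : enorm n < eta by rewrite nE divfK ?gt_eqF //; lra.
have crossn z : cross n z = - k * dot z v by rewrite /cross /dot /n /=; ring.
have n0 : 0 < enorm n by rewrite nE mulr_gt0.
have dnv : dot n v = 0 by rewrite /dot /n /=; ring.
have off (e : R) : e = 1 \/ e = -1 -> ~ G (g 0 + e *: n).
  move=> he /(closed_param_unit 0)[s + gs]; rewrite add0r => hs.
  have e1 : `|e| = 1 by case: he => ->; rewrite ?normrN normr1.
  have zn : g s - g 0 = e *: n by rewrite gs addrAC subrr add0r.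
  have zv : dot (g s - g 0) v = 0.
    by rewrite zn dotZ dnv mulr0.
  have [s0|s0] := ltP 0 s; last first.
    have s00 : s = 0 by lra.
    move: zn; rewrite s00 subrr => /esym zn0.
    by have := n0; rewrite -[enorm n]mul1r -e1 -enormZ zn0 enorm0 ltxx.
  have [s1|s1] := ltP s d; first by have := dpos s; rewrite zv ltxx s0 s1 => /(_ isT).
  have [s2|s2] := ltP (1 - d) s.
    have s3 : 1 - d < s < 1 by lra.
    by have := dneg s s3; rewrite zv ltxx.
  have s3 : d <= s <= 1 - d by lra.
  by have := heta s s3; rewrite zn enormZ e1 mul1r leNgt nn.
pose q1 := g 0 + n; pose q2 := g 0 - n.
have G1 : ~ G q1 by have := off 1; rewrite scale1r; apply; left.
have G2 : ~ G q2 by have := off (-1); rewrite scaleN1r; apply; right.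
have side q : ~ G q -> ~ ext_compl G q -> int_compl G q.
  by move=> Gq nq; split=> //; apply: contrapT => h; apply: nq.
apply: contrapT => no.
have E1 : ext_compl G q1 by apply: contrapT => h; apply: no; exists q1; exact: side.
have E2 : ext_compl G q2 by apply: contrapT => h; apply: no; exists q2; exact: side.
have [th1 c1 h1] := curve_lift ler01 G1.
have [th2 c2 h2] := curve_lift ler01 G2.
have t1 := ext_compl_turn E1 (turn_lift c1 h1).
have t2 := ext_compl_turn E2 (turn_lift c2 h2).
(* [e s] is the angle from [g s - q2] to [g s - q1]. By [cosE] its cosine is -1 only if [g s] is
   closer to [g 0] than [enorm n]; by [sinE] its sine has the sign opposite to [dot (g s - g 0) v],
   so it is negative just after 0 and positive just before 1. *)
pose e s := th1 s - th2 s.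
have ce : continuous e.
  by apply: continuous_pt => s; apply: (@continuousB _ R R); [exact: c1|exact: c2].
have pos s : 0 < enorm (g s - q2) * enorm (g s - q1).
  by rewrite mulr_gt0 // enorm_gt0 closed_curve_neq.
have cosE s : 0 <= s <= 1 ->
    enorm (g s - g 0) ^+ 2 - enorm n ^+ 2 = enorm (g s - q2) * enorm (g s - q1) * cos (e s).
  move=> hs; rewrite -(dot_argument (h2 s hs) (h1 s hs)) -!dotvv /q1 /q2 /dot /=; ring.
have sinE s : 0 <= s <= 1 ->
    - 2 * k * dot (g s - g 0) v = enorm (g s - q2) * enorm (g s - q1) * sin (e s).
  move=> hs; rewrite -(cross_argument (h2 s hs) (h1 s hs)).
  transitivity (2 * cross n (g s - g 0)); first by rewrite crossn; ring.
  by rewrite /q1 /q2 /cross /=; ring.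
have sinN s : 0 < s < d -> sin (e s) < 0.
  move=> hs; rewrite -(pmulr_rlt0 _ (pos s)) -sinE; last by lra.
  by have := mulr_gt0 k0 (dpos s hs); lra.
have sinP s : 1 - d < s < 1 -> 0 < sin (e s).
  move=> hs; rewrite -(pmulr_rgt0 _ (pos s)) -sinE; last by lra.
  have h : k * dot (g s - g 0) v < 0 by rewrite pmulr_rlt0 // dneg.
  by move: h; lra.
have sin0 s : cos (e s) = -1 -> sin (e s) = 0.
  by move=> h; have := cos2Dsin2 (e s); rewrite h sqrrN expr1n => /eqP; rewrite addrC -subr_eq0 addrK sqrf_eq0 => /eqP.
have [|j hj] := @leash _ `]0, 1[ e (@interval_is_interval _ _) ce.
  move=> s; rewrite /= in_itv /= => /andP[s0 s1]; apply/eqP => /[dup] ce1 /sin0 se0.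
  have [l1|l1] := ltP s d; first by have := sinN s; rewrite se0 ltxx s0 l1 => /(_ isT).
  have [l2|l2] := ltP (1 - d) s; first by have := sinP s; rewrite se0 ltxx s1 l2 => /(_ isT).
  have := cosE s; rewrite ce1 => /(_ ltac:(lra)).
  have hn : enorm n < enorm (g s - g 0) by apply: lt_le_trans nn _; apply: heta; lra.
  have : enorm n ^+ 2 < enorm (g s - g 0) ^+ 2 by rewrite ltrXn2r ?enorm_ge0.
  by have := pos s; lra.
have cj x : cos (e x - j%:~R * (2 * pi)) = cos (e x) /\ sin (e x - j%:~R * (2 * pi)) = sin (e x).
  by have [] := cisDzpi (- j) (e x); rewrite mulrNz mulNr => -> ->.
have cend s : s = 0 \/ s = 1 -> cos (e s) = -1.
  move=> hs; have s01 : 0 <= s <= 1 by case: hs => ->; rewrite ?lexx ?ler01.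
  have gs : g s = g 0 by case: hs => -> //; rewrite closed_param_loop.
  have := cosE s s01; have := pos s; rewrite gs.
  have -> : g 0 - q1 = - n by rewrite /q1 opprD addrA subrr add0r.
  have -> : g 0 - q2 = n by rewrite /q2 opprB addrCA subrr addr0.
  rewrite subrr enorm0 enormN -expr2 => p2 h.
  apply: (mulfI (lt0r_neq0 p2)); rewrite -h; ring.
(* The signs of the sine place [e] below the centre of its band just after 0 and above it just
   before 1. As both turns vanish, [e 0 = e 1], so both equal the centre, where the cosine is 1 and
   not -1. *)
have ej0 : e 0 <= j%:~R * (2 * pi).
  rewrite leNgt; apply/negP => lt.
  have /cvgr_gt /(_ _ lt) /nbhs_ballP[r /= r0 hr] := ce 0.
  pose s := Num.min r d / 2.
  have m0 : 0 < Num.min r d by rewrite lt_min r0.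
  have mr : Num.min r d <= r by rewrite ge_min lexx.
  have md : Num.min r d <= d by rewrite ge_min lexx orbT.
  have ssd : 0 < s < d by rewrite /s; lra.
  have := hr s; rewrite /ball /= sub0r normrN gtr0_norm; last by lra.
  move=> /(_ ltac:(rewrite /s; lra)) l.
  have := hj s; rewrite /= in_itv /= => /(_ ltac:(lra)); rewrite ltr_norml => /andP[_ l2].
  have : 0 < sin (e s - j%:~R * (2 * pi)) by apply: sin_gt0_pi; rewrite subr_gt0 l.
  by rewrite (cj s).2; have := sinN s ssd; lra.
have ej1 : j%:~R * (2 * pi) <= e 1.
  rewrite leNgt; apply/negP => lt.
  have /cvgr_lt /(_ _ lt) /nbhs_ballP[r /= r0 hr] := ce 1.
  pose s := 1 - Num.min r d / 2.
  have m0 : 0 < Num.min r d by rewrite lt_min r0.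
  have mr : Num.min r d <= r by rewrite ge_min lexx.
  have md : Num.min r d <= d by rewrite ge_min lexx orbT.
  have ssd : 1 - d < s < 1 by rewrite /s; lra.
  have := hr s; rewrite /ball /= gtr0_norm; last by lra.
  move=> /(_ ltac:(rewrite /s; lra)) l.
  have := hj s; rewrite /= in_itv /= => /(_ ltac:(lra)); rewrite ltr_norml => /andP[l2 _].
  have : 0 < sin (- (e s - j%:~R * (2 * pi))).
    by apply: sin_gt0_pi; rewrite oppr_gt0 subr_lt0 l ltrNl.
  by rewrite trigo.sinN (cj s).2; have := sinP s ssd; lra.
have := cend 0 (or_introl erefl); have -> : e 0 = j%:~R * (2 * pi).
  by apply/eqP; rewrite eq_le ej0 /=; move: ej1; rewrite /e; lra.
by have /= := congr1 fst (@cisDzpi R j 0); rewrite add0r cos0 => ->; lra.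
Qed.

Lemma sft_period0 n p : sft 0 n p = p.
Proof. by apply: plane_eq; rewrite /sft /= ?mulr0 addr0. Qed.

Lemma closed_curve_sides : int_compl G !=set0 -> sides 0 G (int_compl G) (ext_compl G).
Proof.
move=> iG; have eG : ext_compl G !=set0 by have [p Ep] := far_ext_compl; exists p.
have cov p : [\/ int_compl G p, ext_compl G p | G p].
  have [Gp|Gp] := pselect (G p); first by constructor 3.
  have [b|b] := pselect (bounded_set (connected_component (~` G) p)).
    by constructor 1.
  by constructor 2.
have oi := open_int_compl; have oe := open_ext_compl.
split=> //.
- by move=> p [_ h] [_].
- by move=> p [].
- by move=> p [].
- by apply: (@closed_curve_side_closure _ (ext_compl G)) => //; [move=> p [_ h] [_]|move=> p []|move=> p []].
- apply: (@closed_curve_side_closure _ (int_compl G)) => //; [move=> p [_ h] [_] //| |by move=> p []|by move=> p []].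
  by move=> p; case: (cov p); [constructor 2|constructor 1|constructor 3].
- exact: int_compl_connected.
- exact: ext_compl_connected.
- by move=> n p; rewrite sft_period0.
- by move=> n p; rewrite sft_period0.
have [M hM] := curve_bounded; exists M => p Gp; exists 0; rewrite sft_period0; exact: hM.
Qed.

End ClosedCurve.

(** * The minimum principle *)
Section Calculus.
Context {R : realType}.
Implicit Types (f : R * R -> R) (p q v : R * R) (s t : R).

Lemma is_derive_line f p v s (d : R) : is_derive (p + s *: v) v f d ->
  is_derive s (1 : R) (fun t => f (p + t *: v)) d.
Proof.
move=> [cf ef].
have e : (fun h : R => h^-1 *: (((fun t => f (p + t *: v)) \o shift s) (h *: 1) - f (p + s *: v))) =
  (fun h : R => h^-1 *: ((f \o shift (p + s *: v)) (h *: v) - f (p + s *: v))).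
  apply/funext => h /=; congr (_ *: (f _ - _)).
  by rewrite [h%:A]mulr1 scalerDl addrCA.
by split; [rewrite /derivable e|rewrite /derive e].
Qed.

Lemma MVT_slope (phi psi : R -> R) a b : a < b ->
  (forall s, a <= s <= b -> is_derive s (1 : R) phi (psi s)) ->
  exists2 c, a < c < b & phi b - phi a = psi c * (b - a).
Proof.
move=> ab h.
have [||c] := @MVT R phi psi a b ab.
- by move=> x; rewrite in_itv /= => hx; apply: h; lra.
- apply: derivable_within_continuous => x; rewrite in_itv /= => hx.
  by have [] := h x hx.
by rewrite in_itv /= => hc e; exists c.
Qed.

(** A negative [kappa] would give [psi c < psi 0 < psi c'] for all [c' < 0 < c] near 0, while the
    mean value theorem on the two sides of the minimum yields such points with [0 <= psi c] and
    [psi c' <= 0]. *)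
Lemma second_derivative_test (phi psi : R -> R) (r kappa : R) : 0 < r ->
  (forall s, `|s| < r -> is_derive s (1 : R) phi (psi s)) ->
  is_derive (0 : R) (1 : R) psi kappa ->
  (forall s, `|s| < r -> phi 0 <= phi s) -> 0 <= kappa.
Proof.
move=> r0 hphi [cpsi epsi] hmin; rewrite leNgt; apply/negP => k0.
have : h^-1 *: (psi h - psi 0) @[h --> 0^'] --> kappa.
  rewrite -epsi /derive; move: cpsi; rewrite /derivable.
  have -> : (fun h : R => h^-1 *: ((psi \o shift 0) (h *: 1) - psi 0)) =
     (fun h => h^-1 *: (psi h - psi 0)).
    by apply/funext => h; rewrite /= [h%:A]mulr1 addr0.
  exact.
move/cvgr_lt => /(_ _ k0) /nbhs_ballP[e /= e0 he].
have hq h : 0 < `|h| < e -> h^-1 * (psi h - psi 0) < 0.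
  move=> /andP[h0 h1]; apply: (he h); first by rewrite /ball /= sub0r normrN.
  by rewrite -normr_gt0.
pose d := Num.min r e / 2.
have m0 : 0 < Num.min r e by rewrite lt_min r0.
have mr : Num.min r e <= r by rewrite ge_min lexx.
have me : Num.min r e <= e by rewrite ge_min lexx orbT.
have d0 : 0 < d by rewrite /d; lra.
have dr : d < r by rewrite /d; lra.
have de : d < e by rewrite /d; lra.
have [|c /andP[c0 cd] hc] := @MVT_slope phi psi 0 d d0.
  by move=> s hs; apply: hphi; rewrite ltr_norml; lra.
have [||c' /andP[c'0 c'd] hc'] := @MVT_slope phi psi (- d) 0 _ _; first by lra.
  by move=> s hs; apply: hphi; rewrite ltr_norml; lra.
have p1 : 0 <= psi c.
  have : phi 0 <= phi d by apply: hmin; rewrite gtr0_norm.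
  by rewrite -subr_ge0 hc subr0 pmulr_lge0.
have p2 : psi c' <= 0.
  have : phi 0 <= phi (- d) by apply: hmin; rewrite normrN gtr0_norm.
  by rewrite -subr_le0 hc' sub0r opprK pmulr_lle0.
have h1 : psi c < psi 0.
  have := hq c; rewrite gtr0_norm // c0 (lt_trans cd de) => /(_ isT).
  by rewrite pmulr_rlt0 ?invr_gt0 // subr_lt0.
have h2 : psi 0 < psi c'.
  have := hq c'; rewrite ltr0_norm // oppr_gt0 c'd ltrNl (lt_trans _ c'0) ?ltrN2 // => /(_ isT).
  by rewrite nmulr_rlt0 ?invr_lt0 // subr_gt0.
lra.
Qed.

(** Derivatives are carried as witnesses along the axes, so that subtraction and restriction act on
    them directly and the second derivative test applies one axis at a time. *)
Definition laplace (W : set (R * R)) f := exists fx fy fxx fyy : R * R -> R,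
  forall p, W p -> [/\ is_derive p (e_x : R * R) f (fx p), is_derive p (e_y : R * R) f (fy p),
    is_derive p (e_x : R * R) fx (fxx p), is_derive p (e_y : R * R) fy (fyy p)
    & fxx p + fyy p = 0].

Lemma laplaceB (W : set (R * R)) f g : laplace W f -> laplace W g ->
  laplace W (fun p => f p - g p).
Proof.
move=> [fx [fy [fxx [fyy hf]]]] [gx [gy [gxx [gyy hg]]]].
exists (fun p => fx p - gx p), (fun p => fy p - gy p),
  (fun p => fxx p - gxx p), (fun p => fyy p - gyy p) => p Wp.
have [f1 f2 f3 f4 f5] := hf p Wp; have [g1 g2 g3 g4 g5] := hg p Wp.
split; [exact: is_deriveB|exact: is_deriveB|exact: is_deriveB|exact: is_deriveB|].
by move: f5 g5; lra.
Qed.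

Lemma laplace_sub (W W' : set (R * R)) f : W `<=` W' -> laplace W' f -> laplace W f.
Proof.
by move=> WW [fx [fy [fxx [fyy hf]]]]; exists fx, fy, fxx, fyy => p /WW; exact: hf.
Qed.

Lemma laplace_cst (W : set (R * R)) (c : R) : laplace W (fun=> c).
Proof.
exists (fun=> 0), (fun=> 0), (fun=> 0), (fun=> 0) => p _.
by split; rewrite ?addr0 //; exact: is_derive_cst.
Qed.

Lemma within_continuousB (W : set (R * R)) f g : {within W, continuous f} ->
  {within W, continuous g} -> {within W, continuous (fun p => f p - g p)}.
Proof. by move=> cf cg x; apply: (@continuousB _ R (subspace W)); [exact: cf|exact: cg]. Qed.

Lemma is_derive_shift_id (c s : R) : is_derive s (1 : R) (fun t : R => c + t) (1 : R).
Proof.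
have h := is_deriveD (is_derive_cst c s (1 : R)) (is_derive_id s (1 : R)).
by apply: is_derive_eq h _; rewrite add0r.
Qed.

Lemma is_derive_quadratic (k c s : R) :
  is_derive s (1 : R) (fun t : R => k * (c + t) ^+ 2) (2 * k * (c + s)).
Proof.
have h1 := is_derive_shift_id c s; have h := is_deriveZ k (is_deriveM h1 h1).
have e : (k \*: ((fun t : R => c + t) * (fun t : R => c + t)))%R = (fun t : R => k * (c + t) ^+ 2) :> (R -> R) by [].
rewrite e in h; apply: is_derive_eq h _; rewrite /GRing.scale /= ; ring.
Qed.

(* Subtracting [eps * y ^ 2] makes the Laplacian negative, which excludes an
   interior minimum; the ordinate is unaffected by the translations [sft]. *)
Lemma min_principle (P : R) (W : set (R * R)) f : open W ->
  (exists M, forall p, W p -> exists n, `|sft P n p| <= M) ->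
  (forall n p, W p -> W (sft P n p)) ->
  (forall n p, closure W p -> f (sft P n p) = f p) ->
  {within closure W, continuous f} -> laplace W f ->
  (forall p, closure W p -> ~ W p -> 0 <= f p) ->
  forall p, closure W p -> 0 <= f p.
Proof.
move=> oW [M hM] perW perf cf lapf hb p0 clp0; rewrite leNgt; apply/negP => fp0.
have Wp0 : W p0 by apply: contrapT => /(hb _ clp0); rewrite leNgt fp0.
pose K := closure W `&` [set p | `|p| <= M].
have cK : compact K.
  apply: (@bounded_closed_compact_plane _ _ M); last by move=> p [].
  apply: closedI; first exact: closed_closure.
  by apply: (preimage_closed _ (@closed_le R M)) => x _; exact: norm_continuous.
have rep p : W p -> exists2 q, K q /\ W q & f q = f p /\ q.2 = p.2.
  move=> Wp; have [n hn] := hM p Wp; exists (sft P n p).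
    by split; [split=> //; exact/subset_closure/perW|exact: perW].
  by split; [apply: perf; exact: subset_closure|rewrite /sft /= addr0].
have K0 : K !=set0 by have [q [Kq _] _] := rep _ Wp0; exists q.
have M0 : 0 <= M by have [q [_ hq]] := K0; exact: le_trans (normr_ge0 _) hq.
(* Chosen so that [eps * M ^ 2 < - f p0]: the minimum point of the perturbed function then still has
   [f q < 0], hence lies in [W] and not on its boundary. *)
pose eps := - f p0 / (M ^+ 2 + 1).
have D0 : 0 < M ^+ 2 + 1 by rewrite ltr_pwDr // sqr_ge0.
have eps0 : 0 < eps by rewrite divr_gt0 // oppr_gt0.
have epsM : eps * M ^+ 2 < - f p0.
  have : eps * (M ^+ 2 + 1) = - f p0 by rewrite divfK // gt_eqF.
  by rewrite mulrDr mulr1; lra.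
pose fe p := f p - eps * p.2 ^+ 2.
have cfe : {within K, continuous fe}.
  apply: within_continuousB; first by apply: continuous_subspaceW cf => ? [].
  apply: continuous_subspaceT; apply: continuous_pt => z.
  apply: (@continuousM R); first exact: cst_continuous.
  by apply: (@continuousM R); exact: cvg_snd.
have [q /[!inE] Kq hq] := compact_EVT_min K0 cK cfe.
have hqW p : W p -> fe q <= fe p.
  move=> /rep[p' [Kp' _] [e1 e2]]; rewrite {2}/fe -e1 -e2.
  by apply: hq; rewrite inE.
have q2 : q.2 ^+ 2 <= M ^+ 2.
  have : `|q.2| <= M by apply: le_trans Kq.2; rewrite prod_normE le_max lexx orbT.
  by rewrite -(@ler_pXn2r _ 2) ?nnegrE // real_normK ?num_real.
have fq : f q < 0.
  have := hqW _ Wp0; rewrite /fe; have := sqr_ge0 p0.2 => h1 h2.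
  have h3 : eps * q.2 ^+ 2 <= eps * M ^+ 2 by rewrite ler_pM2l.
  have h4 : 0 <= eps * p0.2 ^+ 2 by rewrite mulr_ge0 // ltW.
  lra.
have Wq : W q by apply: contrapT => /(hb _ Kq.1); rewrite leNgt fq.
have [fx [fy [fxx [fyy hl]]]] := lapf.
have /nbhs_ballP[r /= r0 hr] := open_nbhs_nbhs (conj oW Wq).
have onW v s : `|v| = 1 -> `|s| < r -> W (q + s *: v).
  move=> v1 sr; apply: hr; rewrite -ball_normE /= opprD addrA subrr add0r normrN.
  by rewrite normrZ v1 mulr1.
have nx : `|e_x : R * R| = 1 by rewrite prod_normE /= normr1 normr0; apply: max_l.
have ny : `|e_y : R * R| = 1 by rewrite prod_normE /= normr1 normr0; apply: max_r.
have at0 v : q + 0 *: v = q by rewrite scale0r addr0.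
have [_ _ dxx dyy fxxyy] := hl q Wq.
have hx : 0 <= fxx q.
  apply: (@second_derivative_test (fun s => f (q + s *: e_x)) (fun s => fx (q + s *: e_x)) r) => //.
  - by move=> s sr; apply: is_derive_line; have [] := hl _ (onW _ _ nx sr).
  - by apply: is_derive_line; rewrite at0.
  move=> s sr; have := hqW _ (onW _ _ nx sr).
  by rewrite /fe at0 /= /GRing.scale /= mulr0 addr0; lra.
have hy : 0 <= fyy q - 2 * eps.
  pose phi s := f (q + s *: e_y) - eps * (q.2 + s) ^+ 2.
  apply: (@second_derivative_test phi (fun s => fy (q + s *: e_y) - 2 * eps * (q.2 + s)) r) => //.
  - move=> s sr; apply: is_deriveB; first by apply: is_derive_line; have [] := hl _ (onW _ _ ny sr).
    exact: is_derive_quadratic.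
  - apply: is_deriveB; first by apply: is_derive_line; rewrite at0.
    have h := is_deriveZ (2 * eps) (is_derive_shift_id q.2 0).
    by apply: is_derive_eq h _; rewrite /GRing.scale /= mulr1.
  move=> s sr; have := hqW _ (onW _ _ ny sr).
  by rewrite /phi /fe at0 /= /GRing.scale /= mulr1 addr0.
lra.
Qed.

End Calculus.

(** * Comparison of capacitary potentials *)
Section Comparison.
Context {R : realType}.
Implicit Types (f U V : R * R -> R) (gU gV : R * R -> R * R) (p q v : R * R) (P : R).

Lemma within_continuous_comp (T T' T'' : topologicalType) (X : set T') (Y : set T)
    (f : T -> T') (h : T' -> T'') : continuous f -> (forall x, Y x -> X (f x)) ->
  {within X, continuous h} -> {within Y, continuous (h \o f)}.
Proof.
move=> cf Xf /subspace_continuousP ch; apply/subspace_continuousP => x Yx N Nx.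
have h1 : \forall z \near f x, X z -> N (h z) by exact: (ch _ (Xf x Yx) _ Nx).
have h2 : \forall y \near x, X (f y) -> N (h (f y)) by exact: (cf x _ h1).
suff : \forall y \near x, Y y -> N (h (f y)) by [].
by apply: filterS h2 => y hy /Xf.
Qed.

Lemma increment_small (phi psi : R -> R) (h m e : R) :
  (forall s, `|s| <= `|h| -> is_derive s (1 : R) phi (psi s)) ->
  (forall s, `|s| <= `|h| -> `|psi s - m| <= e) ->
  `|phi h - phi 0 - m * h| <= e * `|h|.
Proof.
move=> hd hm; have [->|h0] := eqVneq h 0; first by rewrite subrr mulr0 subrr !normr0 mulr0.
suff [c hc ->] : exists2 c, `|c| <= `|h| & phi h - phi 0 = psi c * h.
  by rewrite -mulrBl normrM ler_wpM2r // hm.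
have [lt|gt] := ltP 0 h.
  have [|c hc e1] := @MVT_slope R phi psi 0 h lt.
    by move=> s hs; apply: hd; rewrite (gtr0_norm lt) ger0_norm; lra.
  by exists c; rewrite ?e1 ?subr0 // (gtr0_norm lt) gtr0_norm; lra.
have {gt}lt : h < 0 by rewrite lt_neqAle h0.
have [|c hc e1] := @MVT_slope R phi psi h 0 lt.
  by move=> s hs; apply: hd; rewrite (ltr0_norm lt) ler0_norm; lra.
exists c; first by rewrite (ltr0_norm lt) ltr0_norm; lra.
by rewrite -opprB e1 sub0r mulrN opprK.
Qed.

(** The increment is split into a horizontal and a vertical leg; the mean value theorem on each leg
    and continuity of the partial derivatives at [p] bound the error by [e * |h|]. *)
Lemma is_derive_direction (W : set (R * R)) f (F : R * R -> R * R) p v : open W ->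
  (forall q, W q -> is_derive q (e_x : R * R) f (F q).1 /\ is_derive q (e_y : R * R) f (F q).2) ->
  W p -> {for p, continuous F} -> is_derive p v f (dot v (F p)).
Proof.
move=> oW hF Wp cF.
suff H : h^-1 *: ((f \o shift p) (h *: v) - f p) @[h --> 0^'] --> dot v (F p).
  by apply: DeriveDef; [exact: (cvgP _ H)|exact: cvg_lim H].
apply/cvgrPdist_le => e e0.
(* [k] bounds the lengths of both legs together: [|h| * k < r] keeps them in the ball, and the
   tolerance [e / k] on each adds up to at most [e]. *)
pose k := `|v.1| + `|v.2| + 1.
have k0 : 0 < k by rewrite ltr_wpDl // addr_ge0.
have /nbhs_ballP[r1 /= r10 hr1] := open_nbhs_nbhs (conj oW Wp).
move/cvgrPdist_le : cF => /(_ _ (divr_gt0 e0 k0)) /nbhs_ballP[r2 /= r20 hr2].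
pose r := Num.min r1 r2.
have r0 : 0 < r by rewrite lt_min r10.
apply/nbhs_ballP; exists (r / k); first by rewrite /= divr_gt0.
move=> h; rewrite /ball /= sub0r normrN => hr hn0.
have hk : `|h| * k < r by rewrite -ltr_pdivlMr.
have inb (a b : R) : `|a| <= `|h| * `|v.1| -> `|b| <= `|h| * `|v.2| ->
    W (p + (a, b)) /\ `|F p - F (p + (a, b))| <= e / k.
  move=> ha hb; have bl : ball p r (p + (a, b)).
    rewrite -ball_normE /= opprD addrA subrr add0r normrN prod_normE /= gt_max.
    have := normr_ge0 v.1; have := normr_ge0 v.2; have := normr_ge0 h.
    by rewrite /k in hk; move=> z1 z2 z3; apply/andP; split; nra.
  split; first by apply: hr1; apply: le_ball bl; rewrite ge_min lexx.
  by apply: hr2; apply: le_ball bl; rewrite ge_min lexx orbT.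
have ex s : s *: e_x = (s, 0) :> R * R.
  by apply: plane_eq; rewrite /= /GRing.scale /= ?mulr1 ?mulr0.
have ey s : s *: e_y = (0, s) :> R * R.
  by apply: plane_eq; rewrite /= /GRing.scale /= ?mulr1 ?mulr0.
have z0 : 0 <= `|h| * `|v.2| by rewrite mulr_ge0.
have h1 : `|f (p + (h * v.1, 0)) - f p - (F p).1 * (h * v.1)| <= e / k * `|h * v.1|.
  have := @increment_small (fun s => f (p + s *: e_x)) (fun s => (F (p + s *: e_x)).1) (h * v.1) (F p).1 (e / k).
  rewrite !ex -[(0, 0)]/(0 : R * R) addr0 normrM; apply=> s hs.
    have [] := inb s 0; rewrite ?normr0 // => Ws _.
    by apply: is_derive_line; rewrite ex; case: (hF _ Ws).
  have [] := inb s 0; rewrite ?normr0 // => _; rewrite ex distrC.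
  by apply: le_trans; rewrite [leRHS]prod_normE le_max lexx.
have h2 : `|f (p + (h * v.1, h * v.2)) - f (p + (h * v.1, 0)) - (F p).2 * (h * v.2)| <= e / k * `|h * v.2|.
  have := @increment_small (fun s => f (p + (h * v.1, 0) + s *: e_y))
    (fun s => (F (p + (h * v.1, 0) + s *: e_y)).2) (h * v.2) (F p).2 (e / k).
  have pe s : p + (h * v.1, 0) + s *: e_y = p + (h * v.1, s).
    by rewrite ey; apply: plane_eq => /=; ring.
  rewrite !pe normrM; apply=> s hs.
    have [] := inb (h * v.1) s; rewrite ?normrM // => Ws _.
    by apply: is_derive_line; rewrite pe; case: (hF _ Ws).
  have [] := inb (h * v.1) s; rewrite ?normrM // => _; rewrite pe distrC.
  by apply: le_trans; rewrite [leRHS]prod_normE le_max lexx orbT.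
have ph : h *: v + p = p + (h * v.1, h * v.2) by apply: plane_eq; rewrite /= /GRing.scale /=; ring.
rewrite ph; set D := f (p + _) - f p.
have hD : `|D - h * dot v (F p)| <= e * `|h|.
  have -> : D - h * dot v (F p) = (f (p + (h * v.1, 0)) - f p - (F p).1 * (h * v.1)) +
    (f (p + (h * v.1, h * v.2)) - f (p + (h * v.1, 0)) - (F p).2 * (h * v.2)).
    by rewrite /D /dot; ring.
  apply: le_trans (ler_normD _ _) (le_trans (lerD h1 h2) _).
  rewrite !normrM -mulrDr -mulrDr mulrCA mulrC ler_wpM2r //.
  by rewrite mulrAC ler_pdivrMr // ler_pM2l // /k; lra.
have -> : dot v (F p) - h^-1 *: D = h^-1 * (h * dot v (F p) - D).
  by rewrite mulrBr mulKf.
by rewrite normrM normfV distrC mulrC ler_pdivrMr ?normr_gt0.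
Qed.

(** The region is [A2 & B1]: inside the second curve and outside the first. Both forms of the strict
    order are stored so that the record is symmetric under exchange of the sides. *)
Record annulus P (G1 A1 B1 G2 A2 B2 : set (R * R)) U gU : Prop := Annulus {
  inner_sides : sides P G1 A1 B1;
  outer_sides : sides P G2 A2 B2;
  inner_lt : closure A1 `<=` A2;
  outer_lt : closure B2 `<=` B1;
  annulus_bounded_mod : exists M, forall p, (A2 `&` B1) p -> exists n, `|sft P n p| <= M;
  potential_continuous : {within closure (A2 `&` B1), continuous U};
  potential_periodic : forall n p, closure (A2 `&` B1) p -> U (sft P n p) = U p;
  potential_harmonic : laplace (A2 `&` B1) U;
  potential_inner : forall p, G1 p -> U p = 0;
  potential_outer : forall p, G2 p -> U p = 1;
  gradient_derive : forall p, (A2 `&` B1) p ->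
    is_derive p (e_x : R * R) U (gU p).1 /\ is_derive p (e_y : R * R) U (gU p).2;
  gradient_continuous : {within closure (A2 `&` B1), continuous gU} }.

Lemma sides_dual P (G A B : set (R * R)) : sides P G A B -> sides P G B A.
Proof.
case=> *; split=> //.
- by move=> p; have [] : [\/ A p, B p | G p] by []; [constructor 2|constructor 1|constructor 3].
- by move=> p Bp Ap; match goal with H : forall p, A p -> ~ B p |- _ => exact: (H p) end.
Qed.

(** Turning the region inside out exchanges the values 0 and 1 of the potential and keeps the norm
    of its gradient, so each estimate at the inner curve has an outer counterpart. *)
Lemma annulus_dual P G1 A1 B1 G2 A2 B2 U gU : annulus P G1 A1 B1 G2 A2 B2 U gU ->
  annulus P G2 B2 A2 G1 B1 A1 (fun p => 1 - U p) (fun p => - gU p).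
Proof.
case=> s1 s2 l1 l2 bd cU pU hU u0 u1 dU cg; split; rewrite ?(setIC B1 A2) //.
- exact: sides_dual.
- exact: sides_dual.
- by apply: within_continuousB => //; apply: continuous_subspaceT; exact: cst_continuous.
- by move=> n p cl; rewrite pU.
- by apply: laplaceB => //; exact: laplace_cst.
- by move=> p /u1 ->; rewrite subrr.
- by move=> p /u0 ->; rewrite subr0.
- move=> p /dU[d1 d2]; split.
    have h := is_deriveB (is_derive_cst (1 : R) p (e_x : R * R)) d1.
    by apply: is_derive_eq h _; rewrite sub0r.
  have h := is_deriveB (is_derive_cst (1 : R) p (e_y : R * R)) d2.
  by apply: is_derive_eq h _; rewrite sub0r.
- by move=> x; apply: (@continuousN _ (R * R)%type (subspace _)); exact: cg.
Qed.

Lemma side_closure P (G A B : set (R * R)) : sides P G A B -> closure A `<=` A `|` G.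
Proof.
move=> s p clp; have [Ap|Bp|Gp] := sides_cover s p; [by left| |by right].
have [q [Aq Bq]] := clp _ (open_nbhs_nbhs (conj (open_side2 s) Bp)).
by have := sides_disjoint s Aq Bq.
Qed.

Lemma sft_continuous P n : continuous (sft P n : R * R -> R * R).
Proof.
apply: continuous_pt => p; apply: (@continuousD _ (R * R)%type); last exact: cst_continuous.
exact: id.
Qed.

Lemma closure_sft P (W : set (R * R)) n p : (forall n p, W p -> W (sft P n p)) ->
  closure W p -> closure W (sft P n p).
Proof.
move=> hW clp N Np; have := clp _ (@sft_continuous P n p _ Np).
by move=> [q [Wq Nq]]; exists (sft P n q); split=> //; exact: hW.
Qed.

Lemma potential_ge0 P G1 A1 B1 G2 A2 B2 U gU : annulus P G1 A1 B1 G2 A2 B2 U gU ->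
  forall p, closure (A2 `&` B1) p -> 0 <= U p.
Proof.
case=> s1 s2 l1 l2 bd cU pU hU u0 u1 dU cg.
apply: (@min_principle R P) => //.
- by apply: openI; [exact: open_side1 s2|exact: open_side2 s1].
- by move=> n p [Ap Bp]; split; [exact: side1_periodic s2 _ _ Ap|exact: side2_periodic s1 _ _ Bp].
move=> p clp nW.
have [clA clB] : closure A2 p /\ closure B1 p.
  by split; apply: closureS clp => ? [].
have [Ap|/u1 ->//] := side_closure s2 clA.
have [Bp|/u0 ->//] := side_closure (sides_dual s1) clB.
by case: nW.
Qed.

Lemma potential_le1 P G1 A1 B1 G2 A2 B2 U gU : annulus P G1 A1 B1 G2 A2 B2 U gU ->
  forall p, closure (A2 `&` B1) p -> U p <= 1.
Proof.
move=> /annulus_dual /potential_ge0 h p clp; rewrite -subr_ge0; apply: h.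
by rewrite setIC.
Qed.

Section Ordered.
Variables (P : R) (G1 A1 B1 G2 A2 B2 H1 C1 D1 H2 C2 D2 : set (R * R)).
Variables (U V : R * R -> R) (gU gV : R * R -> R * R).
Hypotheses (hU : annulus P G1 A1 B1 G2 A2 B2 U gU) (hV : annulus P H1 C1 D1 H2 C2 D2 V gV).
Hypotheses (AC2 : A2 `<=` C2) (DB1 : D1 `<=` B1).

Let subU : A2 `&` D1 `<=` A2 `&` B1. Proof. by move=> p [? /DB1]. Qed.
Let subV : A2 `&` D1 `<=` C2 `&` D1. Proof. by move=> p [/AC2]. Qed.

(** A frontier point of [A2 & D1] is on [G2], where [U = 1] dominates [V], or on [H1], where [V = 0]
    is dominated by [U]; the minimum principle applies to [U - V]. *)
Lemma potential_le p : closure (A2 `&` D1) p -> V p <= U p.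
Proof.
have s2 := outer_sides hU; have t1 := inner_sides hV.
move=> clp; rewrite -subr_ge0; move: p clp.
apply: (@min_principle R P).
- by apply: openI; [exact: open_side1 s2|exact: open_side2 t1].
- by have [M hM] := annulus_bounded_mod hU; exists M => p /subU /hM.
- by move=> n p [Ap Bp]; split; [exact: side1_periodic s2 _ _ Ap|exact: side2_periodic t1 _ _ Bp].
- move=> n p clp; rewrite (potential_periodic hU) ?(potential_periodic hV) //.
    exact: closureS clp.
  exact: closureS clp.
- apply: within_continuousB.
    by apply: continuous_subspaceW (potential_continuous hU); exact: closureS.
  by apply: continuous_subspaceW (potential_continuous hV); exact: closureS.
- apply: laplaceB.
    exact: laplace_sub (potential_harmonic hU).
  exact: laplace_sub (potential_harmonic hV).
move=> p clp nW; rewrite subr_ge0.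
have clU : closure (A2 `&` B1) p by exact: closureS clp.
have clV : closure (C2 `&` D1) p by exact: closureS clp.
have [clA clD] : closure A2 p /\ closure D1 p.
  by split; apply: closureS clp => ? [].
have [Ap|/(potential_outer hU) ->] := side_closure s2 clA; last exact: potential_le1 hV _ clV.
have [Dp|/(potential_inner hV) ->] := side_closure (sides_dual t1) clD; last exact: potential_ge0 hU _ clU.
by case: nW.
Qed.

(* Starting near the contact point [p] and moving in the direction of the
   gradient of the smaller potential, one cannot leave its domain, because that
   potential increases while it vanishes on the boundary. *)
Lemma gradient_le p : G1 p -> H1 p -> enorm (gV p) <= enorm (gU p).
Proof.
move=> Gp Hp; rewrite leNgt; apply/negP => lt.
have s1 := inner_sides hU; have s2 := outer_sides hU.
have t1 := inner_sides hV; have t2 := outer_sides hV.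
set L := enorm (gU p) in lt; set M := enorm (gV p) in lt.
have L0 : 0 <= L by exact: enorm_ge0.
(* Along the segment [V] gains at least [M - e = L + 3 * e] per unit and starts from a nonnegative
   value; [U] gains at most [L + e] and starts below [2 * e * r]. After length [r] this gives
   [U < V], against [potential_le]. *)
pose e := (M - L) / 4.
have e0 : 0 < e by rewrite divr_gt0 // subr_gt0.
have eE : M = L + 4 * e by rewrite /e; lra.
clearbody e.
have M0 : 0 < M by apply: le_lt_trans lt.
pose v := M^-1 *: gV p.
have v1 : enorm v = 1 by rewrite enormZ gtr0_norm ?invr_gt0 // mulVf // gt_eqF.
have Ap : A2 p by apply: (inner_lt hU); exact: side1_closure s1 _ Gp.
have oA := open_side1 s2; have oD := open_side2 t1.
have clW : closure (A2 `&` D1) p.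
  move=> N Np; have [q [Dq [Aq Nq]]] := side2_closure t1 Hp (filterI (open_nbhs_nbhs (conj oA Ap)) Np).
  by exists q.
have clU : closure (A2 `&` B1) p by exact: closureS clW.
have clV : closure (C2 `&` D1) p by exact: closureS clW.
have near_grad (X : set (R * R)) (gX : R * R -> R * R) : {within X, continuous gX} -> X p ->
    exists2 r, 0 < r & forall q, X q -> `|p - q| < r -> enorm (gX q - gX p) < e.
  move=> /subspace_continuousP cX Xp.
  have e2 : 0 < e / 2 by rewrite divr_gt0.
  have /cvgrPdist_lt /(_ _ e2) := cX p Xp.
  move=> /nbhs_ballP[r /= r0 hr]; exists r => // q Xq pq.
  apply: le_lt_trans (enorm_le_normr _) _; rewrite distrC.
  have : `|gX p - gX q| < e / 2 by apply: hr => //; rewrite -ball_normE.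
  lra.
have [r1 r10 hr1] := near_grad _ _ (gradient_continuous hU) clU.
have [r2 r20 hr2] := near_grad _ _ (gradient_continuous hV) clV.
have /nbhs_ballP[r3 /= r30 hr3] := open_nbhs_nbhs (conj oA Ap).
pose r := Num.min r1 (Num.min r2 r3) / 4.
have m0 : 0 < Num.min r1 (Num.min r2 r3) by rewrite !lt_min r10 r20.
have r0 : 0 < r by rewrite divr_gt0.
have [m1 m2 m3] : [/\ 4 * r <= r1, 4 * r <= r2 & 4 * r <= r3].
  have -> : 4 * r = Num.min r1 (Num.min r2 r3) by rewrite /r; lra.
  by rewrite !ge_min !lexx !orbT.
clearbody r.
have [q [[Aq Dq] pq Uq]] : exists q, [/\ (A2 `&` D1) q, `|p - q| < r & U q < 2 * e * r].
  have er : 0 < 2 * e * r by rewrite mulr_gt0 // mulr_gt0.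
  have /subspace_continuousP /(_ p clU) cU := potential_continuous hU.
  have /cvgrPdist_lt /(_ _ er) := cU.
  move=> /nbhs_ballP[r4 /= r40 hr4].
  have m : 0 < Num.min r r4 by rewrite lt_min r0.
  have [q [Wq]] := clW _ (nbhsx_ballx p _ m).
  rewrite -ball_normE /= lt_min => /andP[q1 q2]; exists q; split=> //.
  have : `|U p - U q| < 2 * e * r.
    apply: hr4; first by rewrite -ball_normE.
    by apply: subset_closure; exact: subU.
  by rewrite (potential_inner hU Gp) sub0r normrN; apply: le_lt_trans; exact: ler_norm.
have inball s : 0 <= s <= r -> `|p - (q + s *: v)| < 4 * r.
  move=> /andP[s0 sr]; rewrite opprD addrA; apply: le_lt_trans (ler_normB _ _) _.
  rewrite normrZ ger0_norm //.
  have v1' : `|v| <= 1 by rewrite -v1 normr_le_enorm.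
  have : s * `|v| <= r by apply: le_trans sr; rewrite ler_piMr.
  by move: pq; lra.
have inA s : 0 <= s <= r -> A2 (q + s *: v).
  by move=> hs; apply: hr3; rewrite -ball_normE /=; apply: lt_le_trans (inball s hs) m3.
have derV s : (C2 `&` D1) (q + s *: v) ->
    is_derive s (1 : R) (fun t => V (q + t *: v)) (dot v (gV (q + s *: v))).
  move=> W; apply: is_derive_line.
  apply: (is_derive_direction (W := C2 `&` D1)) => //.
  - by apply: openI => //; exact: open_side1 t2.
  - exact: gradient_derive hV.
  have oW : open (C2 `&` D1) by apply: openI => //; exact: open_side1 t2.
  have cW : {within C2 `&` D1, continuous gV}.
    by apply: continuous_subspaceW (gradient_continuous hV); exact: subset_closure.
  by move: cW; rewrite continuous_open_subspace // => /(_ (q + s *: v)); apply; rewrite inE.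
have derU s : (A2 `&` B1) (q + s *: v) ->
    is_derive s (1 : R) (fun t => U (q + t *: v)) (dot v (gU (q + s *: v))).
  move=> W; apply: is_derive_line.
  have oW : open (A2 `&` B1) by apply: openI => //; exact: open_side2 s1.
  apply: (is_derive_direction (W := A2 `&` B1)) => //.
    exact: gradient_derive hU.
  have cW : {within A2 `&` B1, continuous gU}.
    by apply: continuous_subspaceW (gradient_continuous hU); exact: subset_closure.
  by move: cW; rewrite continuous_open_subspace // => /(_ (q + s *: v)); apply; rewrite inE.
have slopeV s : 0 <= s <= r -> D1 (q + s *: v) -> M - e <= dot v (gV (q + s *: v)).
  move=> hs Ds; set z := q + s *: v.
  have zV : closure (C2 `&` D1) z by apply: subset_closure; split=> //; exact/AC2/inA.
  have := hr2 z zV (lt_le_trans (inball s hs) m2).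
  have := dotN_le v (gV z - gV p); rewrite v1 mul1r.
  have -> : dot v (gV z) = dot v (gV z - gV p) + dot v (gV p) by rewrite /dot /=; ring.
  have -> : dot v (gV p) = M.
    by rewrite /v dotZ dotvv -/M expr2 mulKf // gt_eqF.
  lra.
have slopeU s : 0 <= s <= r -> D1 (q + s *: v) -> dot v (gU (q + s *: v)) <= L + e.
  move=> hs Ds; set z := q + s *: v.
  have zU : closure (A2 `&` B1) z by apply: subset_closure; split; [exact: inA|exact: DB1].
  have := hr1 z zU (lt_le_trans (inball s hs) m1).
  have := dot_le v (gU z); rewrite v1 mul1r.
  have := enormD (gU z - gU p) (gU p); rewrite subrK -/L; lra.
(* The end point is only asked to be in the closure, so that the estimate also applies at the first
   exit from [D1]. *)
have climb t : 0 < t <= r -> (forall s, 0 <= s < t -> D1 (q + s *: v)) ->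
    closure (C2 `&` D1) (q + t *: v) -> (M - e) * t <= V (q + t *: v).
  move=> /andP[t0 tr] hD clt.
  have [||c] := @MVT R (fun s => V (q + s *: v)) (fun s => dot v (gV (q + s *: v))) 0 t t0.
  - move=> x; rewrite in_itv /= => /andP[x0 xt]; apply: derV.
    by split; [apply/AC2/inA; lra|apply: hD; lra].
  - suff : {within `[0, t], continuous (V \o (fun s : R => q + s *: v))} by [].
    apply: within_continuous_comp (potential_continuous hV).
      exact: continuous_affine.
    move=> x; rewrite /= in_itv /= => /andP[x0]; rewrite le_eqVlt => /orP[/eqP ->//|xt].
    by apply: subset_closure; split; [apply/AC2/inA; lra|apply: hD; lra].
  rewrite in_itv /= => /andP[c0 ct]; rewrite subr0 scale0r addr0 => hc.
  have V0 : 0 <= V q.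
    by apply: (potential_ge0 hV); apply: subset_closure; split=> //; exact: AC2.
  have : (M - e) * t <= dot v (gV (q + c *: v)) * t.
    by rewrite ler_pM2r //; apply: slopeV; [lra|apply: hD; lra].
  by lra.
have Me : 0 < M - e by lra.
have stay s : 0 <= s <= r -> D1 (q + s *: v).
  move=> hs; apply: contrapT => nD.
  pose S := [set t | 0 <= t <= r /\ ~ D1 (q + t *: v)].
  have hS : has_inf S by split; [exists s|exists 0 => t [/andP[]]].
  have i0 : 0 <= inf S by apply: lb_le_inf; [exists s|move=> t [/andP[]]].
  have ir : inf S <= r by apply: le_trans (andP hs).2; apply: ge_inf => //; case: hS.
  have before t : 0 <= t < inf S -> D1 (q + t *: v).
    move=> /andP[t0 ti]; have tr : t <= r by apply: ltW; apply: lt_le_trans ti ir.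
    apply: contrapT => nt; move: ti; rewrite ltNge => /negP; apply.
    by apply: ge_inf; [case: hS|split=> //; rewrite t0].
  have nDi : ~ D1 (q + inf S *: v).
    move=> Di; have := @continuous_affine R q v (inf S) _ (open_nbhs_nbhs (conj oD Di)).
    move=> /nbhs_ballP[d /= d0 hd]; have [t [ht nt] htd] := inf_adherent d0 hS.
    have it : inf S <= t by apply: ge_inf; [case: hS|split].
    apply: nt; apply: hd; rewrite -ball_normE /= ltr_norml.
    by lra.
  have ipos : 0 < inf S.
    rewrite lt_neqAle i0 andbT; apply: contra_notN nDi => /eqP <-.
    by rewrite scale0r addr0.
  have clD : closure D1 (q + inf S *: v).
    move=> N Ni; have := @continuous_affine R q v (inf S) _ Ni.
    move=> /nbhs_ballP[d /= d0 hd]; pose t := Num.max 0 (inf S - d / 2).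
    have [t0 ti] : 0 <= t /\ t < inf S by rewrite /t le_max lexx gt_max ipos; split=> //=; lra.
    exists (q + t *: v); split; first by apply: before; rewrite t0.
    apply: hd; rewrite -ball_normE /= ltr_norml.
    have : inf S - d / 2 <= t by rewrite le_max lexx orbT.
    by lra.
  have Ci : C2 (q + inf S *: v) by apply/AC2/inA; rewrite i0.
  have := climb (inf S); rewrite ipos ir => /(_ isT before).
  have [//|Hi] := side_closure (sides_dual t1) clD.
  rewrite (potential_inner hV Hi) => h.
  have : (M - e) * inf S <= 0.
    apply: h => N Ni.
    have [z [Dz [Cz Nz]]] := clD _ (filterI (open_nbhs_nbhs (conj (open_side1 t2) Ci)) Ni).
    by exists z.
  by apply/negP; rewrite -ltNge mulr_gt0.
have rr : 0 <= r <= r by rewrite lexx ltW.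
have Wr : (A2 `&` D1) (q + r *: v) by split; [exact: inA|exact: stay].
have up : (M - e) * r <= V (q + r *: v).
  apply: climb; rewrite ?r0 ?lexx //; first by move=> s hs; apply: stay; lra.
  by apply: subset_closure; exact: subV.
have [|c /andP[c0 cr]] := @MVT_slope R (fun s => U (q + s *: v)) (fun s => dot v (gU (q + s *: v))) 0 r r0.
  by move=> s hs; apply: derU; split; [exact: inA|exact/DB1/stay].
rewrite subr0 scale0r addr0 => hc.
have : dot v (gU (q + c *: v)) * r <= (L + e) * r.
  by rewrite ler_pM2r //; apply: slopeU; [lra|apply: stay; lra].
have := potential_le (subset_closure Wr).
move: up hc Uq; rewrite eE; set D := dot _ _; clearbody D; lra.
Qed.

End Ordered.

End Comparison.

(** * Continuation along an ordered family *)
Section Sides.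
Context {R : realType}.
Implicit Types (P : R) (G A B H C D : set (R * R)).

Lemma side_open_disjoint (A B : set (R * R)) p : open B -> (forall q, A q -> ~ B q) ->
  closure A p -> ~ B p.
Proof.
by move=> oB AB clA Bp; have [q [Aq Bq]] := clA _ (open_nbhs_nbhs (conj oB Bp)); exact: (AB q).
Qed.

(** Each point of [G] is a limit of points of [A], so the open set [D], which is disjoint from [A],
    avoids [G] as well. *)
Lemma sides_le P G A B H C D : sides P G A B -> sides P H C D -> A `<=` C -> D `<=` B.
Proof.
move=> s t AC p Dp; have AD q : A q -> ~ D q by move=> /AC Cq Dq; exact: (sides_disjoint t Cq Dq).
have nA := side_open_disjoint (open_side2 t) AD.
by case: (sides_cover s p) => // [/AD//|/(side1_closure s)/nA].
Qed.

Lemma sides_lt P G A B H C D : sides P G A B -> sides P H C D ->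
  closure A `<=` C -> closure D `<=` B.
Proof.
move=> s t AC p clD; have nC := side_open_disjoint (open_side1 t) (sides_disjoint (sides_dual t)) clD.
by case: (sides_cover s p) => // h; exfalso; apply: nC; apply: AC;
  [exact: subset_closure|exact: side1_closure s _ h].
Qed.

(** The curve is recovered as what the closure of one side adds to it; equality of curves thus
    reduces to equality of sides. *)
Lemma sides_eq P G A B H D : sides P G A B -> sides P H A D -> G = H.
Proof.
have h X Y B' D' : sides P X A B' -> sides P Y A D' -> X `<=` Y.
  move=> s t p Xp; have [Ap|//] := side_closure t (side1_closure s Xp).
  by have := side1_off s Ap.
by move=> s t; apply/seteqP; split; [exact: h s t|exact: h t s].
Qed.

Lemma closed_sides P G A B : sides P G A B -> closed G.
Proof.
move=> s; have -> : G = ~` (A `|` B).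
  apply/seteqP; split=> p.
    by move=> Gp [/(side1_off s)|/(side2_off s)]; apply.
  by case: (sides_cover s p) => // h []; [left|right].
apply: open_closedC; apply: openU; [exact: open_side1 s|exact: open_side2 s].
Qed.

Lemma connected_side P G A B (X : set (R * R)) p : sides P G A B -> connected X ->
  (forall q, X q -> ~ G q) -> X p -> A p -> X `<=` A.
Proof.
move=> s cX XG Xp Ap q Xq.
apply: (@connected_locally_invariant _ X A p) => // y Xy.
case: (sides_cover s y) => [Ay|By|/(XG y Xy)//].
  by apply: filterS (open_nbhs_nbhs (conj (open_side1 s) Ay)).
apply: filterS (open_nbhs_nbhs (conj (open_side2 s) By)) => z Bz _.
by split=> h; [have := sides_disjoint s h By|have := sides_disjoint s h Bz].
Qed.

Lemma ball_side P G A B z y (r : R) : sides P G A B -> (forall q, ball z r q -> ~ G q) ->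
  ball z r y -> A y -> A z.
Proof.
move=> s hb by_ Ay.
have zy := ball_component (@subset_refl _ (ball z r)) by_.
apply: (connected_side s (@component_connected _ (ball z r) z) _ zy Ay).
  by move=> q /connected_component_sub; exact: hb.
apply: connected_component_refl.
apply: ballxx; move: by_; rewrite -ball_normE /=; apply: le_lt_trans; exact: normr_ge0.
Qed.

Lemma sft_sub P n (p q : R * R) : sft P n p - sft P n q = p - q.
Proof. by apply: plane_eq; rewrite /sft /=; ring. Qed.

(** A Lebesgue number: the curve is compact modulo the translations, under which [C] is
    invariant. *)
Lemma uniform_ball P G A B C : sides P G A B -> open C -> G `<=` C ->
  (forall n p, C p -> C (sft P n p)) ->
  exists2 r, 0 < r & forall q, G q -> ball q r `<=` C.
Proof.
move=> s oC GC perC; have [M hM] := curve_bounded_mod s.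
have cK : compact (G `&` [set p | `|p| <= M]).
  apply: (@bounded_closed_compact_plane _ _ M); last by move=> p [].
  apply: closedI; first exact: closed_sides s.
  by apply: (preimage_closed _ (@closed_le R M)) => x _; exact: norm_continuous.
have := (@compact_near_coveringP _ _).1 cK _ (nbhs (0 : R)) (fun r q => ball q r `<=` C) _.
case=> [q [Gq _]|e /= e0 he].
  have /nbhs_ballP[e /= e0 he] := open_nbhs_nbhs (conj oC (GC q Gq)).
  exists (ball q (e / 2), ball 0 (e / 2)).
    by split=> /=; apply: nbhsx_ballx; rewrite divr_gt0.
  move=> [q' r] /= [bq' br] z bz; apply: he.
  have -> : e = e / 2 + e / 2 by lra.
  apply: ball_triangle bq' _; apply: le_ball bz.
  by move: br; rewrite /ball /= sub0r normrN; have := ler_norm r; lra.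
exists (e / 2); first by rewrite divr_gt0.
move=> q Gq z bz; have [n hn] := hM q Gq.
have Gn : G (sft P n q).
  case: (sides_cover s (sft P n q)) => // h; exfalso.
    by have := side1_periodic s (- n) h; rewrite sftK => /(side1_off s); apply.
  by have := side2_periodic s (- n) h; rewrite sftK => /(side2_off s); apply.
rewrite -(sftK P n z); apply: perC.
apply: (he (e / 2)) (conj Gn hn) _ _.
  by rewrite /ball /= sub0r normrN gtr0_norm ?divr_gt0 //; lra.
by move: bz; rewrite -!ball_normE /= sft_sub.
Qed.

End Sides.

Section Family.
Context {R : realType}.
Implicit Types (u : R).

Section OneCurve.
Variables (P : R) (G A B : R -> set (R * R)) (H C D : set (R * R)).
Hypothesis hs : forall u, 0 <= u <= 1 -> sides P (G u) (A u) (B u).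
Hypothesis ht : sides P H C D.
Hypothesis mono : forall u u', 0 <= u <= 1 -> 0 <= u' <= 1 -> u < u' -> A u `<=` A u'.
Hypothesis cont : forall u, 0 <= u <= 1 -> forall r, 0 < r -> exists2 del, 0 < del &
  forall u', 0 <= u' <= 1 -> `|u - u'| < del ->
  forall q, G u' q -> exists2 q', G u q' & `|q - q'| < r.

(** The union [W] of the earlier sides is open in [A u], and its closure adds only points of [G u]:
    around any other point a small ball avoids the curves close to [G u], so it lies on one side of
    each of them. By connectedness [W] is all of [A u]. *)
Lemma family_le_sup u : 0 < u <= 1 -> (forall u', 0 <= u' < u -> A u' `<=` C) -> A u `<=` C.
Proof.
clear ht; move=> /andP[u0 u1] hC; have uI : 0 <= u <= 1 by rewrite ltW.
have s := hs uI.
pose W := \bigcup_(x in [set x | 0 <= x < u]) A x.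
have WA : W `<=` A u.
  by move=> p [x /= /andP[x0 xu]]; apply: mono => //; rewrite x0 ltW // (lt_le_trans xu).
suff : A u `<=` W by move=> AW p /AW[x /= hx]; exact: hC.
apply: (side1_connected s) => //.
- apply: bigcup_open => x /= /andP[x0 xu].
  by apply: (open_side1 (hs _)); rewrite x0 ltW // (lt_le_trans xu).
- have I0 : 0 <= (0 : R) <= 1 by rewrite lexx ler01.
  by have [p Ap] := side1_nonempty (hs I0); exists p; exists 0; rewrite /= ?lexx.
move=> z clz; have [Gz|Gz] := pselect (G u z); [by right|left].
have cG := closed_openC (closed_sides s).
have /nbhs_ballP[e /= e0 he] := open_nbhs_nbhs (conj cG Gz).
pose r := e / 2; have r0 : 0 < r by rewrite divr_gt0.
have [del del0 hdel] := cont uI r0.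
have [y [[x /= /andP[x0 xu] Axy] bzy]] := clz _ (nbhsx_ballx z r r0).
(* Raising [x] to within [del] of [u] brings [G x'] close to [G u], and monotonicity keeps [y] in
   [A x']. *)
pose x' := Num.max x (u - del / 2).
have xx' : x <= x' by rewrite le_max lexx.
have x'u : x' < u by rewrite gt_max xu /=; lra.
have x'd : u - del / 2 <= x' by rewrite le_max lexx orbT.
have x'I : 0 <= x' <= 1 by lra.
exists x'; first by rewrite /= (le_trans x0 xx').
have Ay : A x' y.
  move: xx'; rewrite le_eqVlt => /orP[/eqP <-//|lt].
  by apply: mono Axy => //; rewrite x0 ltW // (lt_le_trans xu).
apply: (ball_side (hs x'I) _ bzy Ay) => q bq Gq.
have [|q' Gq' qq'] := hdel x' x'I _ q Gq; first by rewrite ltr_norml; lra.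
apply: (he q') => //; move: bq; rewrite -!ball_normE /= => bq.
have -> : z - q' = (z - q) + (q - q') by rewrite addrA subrK.
by apply: le_lt_trans (ler_normD _ _) _; rewrite /r in bq qq'; lra.
Qed.

(** Without contact [G u] lies in [C] with a uniform margin, so nearby curves do too. The side
    [A u'] could then meet [D] only by containing all of it, since no point of its curve is in [D];
    the anchor [q0], common to [D] and every [B u'], rules this out. *)
Lemma family_le_open u : 0 <= u <= 1 -> A u `<=` C -> (forall p, G u p -> ~ H p) ->
  (exists q, D q /\ forall u', 0 <= u' <= 1 -> B u' q) ->
  exists2 del, 0 < del & forall u', 0 <= u' <= 1 -> `|u - u'| < del -> A u' `<=` C.
Proof.
move=> uI AC GH [q0 [Dq0 Bq0]]; have s := hs uI.
have GC : G u `<=` C.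
  move=> p Gp; have [//|/(GH p Gp)//] := side_closure ht (closureS AC (side1_closure s Gp)).
have [r r0 hr] := uniform_ball s (open_side1 ht) GC (side1_periodic ht).
have [del del0 hdel] := cont uI r0; exists del => // u' u'I uu'.
have s' := hs u'I.
have G'C : G u' `<=` C.
  move=> q Gq; have [q' Gq' qq'] := hdel u' u'I uu' q Gq; apply: (hr q') => //.
  by rewrite -ball_normE /= distrC.
have AD p : A u' p -> ~ D p.
  move=> Ap Dp; suff /(_ q0 Dq0)[Aq0 _] : D `<=` A u' `&` D by exact: (sides_disjoint s' Aq0 (Bq0 _ u'I)).
  apply: (side2_connected ht).
  - by apply: openI; [exact: open_side1 s'|exact: open_side2 ht].
  - by exists p.
  - by move=> z [].
  move=> z clz; have clA : closure (A u') z by apply: closureS clz => ? [].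
  have clD : closure D z by apply: closureS clz => ? [].
  have [Dz|Hz] := side_closure (sides_dual ht) clD; [left|by right].
  split=> //; have [//|/G'C Cz] := side_closure s' clA.
  by have := sides_disjoint ht Cz Dz.
move=> p Ap; case: (sides_cover ht p) => // [/(AD p Ap)//|Hp].
have [q [Dq Aq]] := side2_closure ht Hp (open_nbhs_nbhs (conj (open_side1 s') Ap)).
by have := AD q Aq Dq.
Qed.

End OneCurve.

(* Continuation: the set of parameters for which the order with the fixed pair
   holds is closed, and open as long as there is no contact. *)
Lemma family_le P (G1 A1 B1 G2 A2 B2 : R -> set (R * R)) (H1 C1 D1 H2 C2 D2 : set (R * R)) :
  (forall u, 0 <= u <= 1 -> sides P (G1 u) (A1 u) (B1 u)) ->
  (forall u, 0 <= u <= 1 -> sides P (G2 u) (A2 u) (B2 u)) ->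
  sides P H1 C1 D1 -> sides P H2 C2 D2 ->
  (forall u u', 0 <= u <= 1 -> 0 <= u' <= 1 -> u < u' -> A1 u `<=` A1 u') ->
  (forall u u', 0 <= u <= 1 -> 0 <= u' <= 1 -> u < u' -> A2 u `<=` A2 u') ->
  (forall u, 0 <= u <= 1 -> forall r, 0 < r -> exists2 del, 0 < del &
    forall u', 0 <= u' <= 1 -> `|u - u'| < del ->
    forall q, G1 u' q -> exists2 q', G1 u q' & `|q - q'| < r) ->
  (forall u, 0 <= u <= 1 -> forall r, 0 < r -> exists2 del, 0 < del &
    forall u', 0 <= u' <= 1 -> `|u - u'| < del ->
    forall q, G2 u' q -> exists2 q', G2 u q' & `|q - q'| < r) ->
  (exists q, D1 q /\ forall u', 0 <= u' <= 1 -> B1 u' q) ->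
  (exists q, D2 q /\ forall u', 0 <= u' <= 1 -> B2 u' q) ->
  A1 0 `<=` C1 -> A2 0 `<=` C2 ->
  (forall u, 0 <= u < 1 -> A1 u `<=` C1 -> A2 u `<=` C2 ->
    (forall p, G1 u p -> ~ H1 p) /\ (forall p, G2 u p -> ~ H2 p)) ->
  A1 1 `<=` C1 /\ A2 1 `<=` C2.
Proof.
move=> s1 s2 t1 t2 m1 m2 c1 c2 n1 n2 i1 i2 touch.
pose S := [set u | 0 <= u <= 1 /\ (A1 u `<=` C1 /\ A2 u `<=` C2)].
have S0 : S 0 by split; rewrite ?lexx ?ler01.
have hS : has_sup S by split; [exists 0|exists 1 => u [/andP[]]].
have b0 : 0 <= sup S by apply: ub_le_sup => //; case: hS.
have b1 : sup S <= 1 by apply: ge_sup => [|u [/andP[]]//]; exists 0.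
set u := sup S in b0 b1.
have below u' : 0 <= u' < u -> A1 u' `<=` C1 /\ A2 u' `<=` C2.
  move=> /andP[u0 uu]; have d0 : 0 < u - u' by rewrite subr_gt0.
  have [x [xI [x1 x2]]] := sup_adherent d0 hS; rewrite -/u subKr => ux.
  have u'I : 0 <= u' <= 1 by rewrite u0 (le_trans (ltW uu)).
  by split; [apply: subset_trans x1; exact: m1|apply: subset_trans x2; exact: m2].
have uI : 0 <= u <= 1 by rewrite b0.
have Su : A1 u `<=` C1 /\ A2 u `<=` C2.
  have [le|lt] := leP u 0.
    by have -> : u = 0 by apply/eqP; rewrite eq_le le.
  have u01 : 0 < u <= 1 by rewrite lt.
  split.
    by apply: (@family_le_sup P G1 A1 B1) => // u' hu'; case: (below u' hu').
  by apply: (@family_le_sup P G2 A2 B2) => // u' hu'; case: (below u' hu').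
have [le|lt] := leP 1 u.
  by have <- : u = 1 by apply/eqP; rewrite eq_le b1.
have [no1 no2] := touch u (introT andP (conj b0 lt)) Su.1 Su.2.
have [d1 d10 hd1] := @family_le_open P G1 A1 B1 _ _ _ s1 t1 c1 u uI Su.1 no1 n1.
have [d2 d20 hd2] := @family_le_open P G2 A2 B2 _ _ _ s2 t2 c2 u uI Su.2 no2 n2.
pose d := Num.min (1 - u) (Num.min d1 d2) / 2.
have [m10 m20 m30] : [/\ 2 * d <= 1 - u, 2 * d <= d1 & 2 * d <= d2].
  have -> : 2 * d = Num.min (1 - u) (Num.min d1 d2) by rewrite /d; lra.
  by rewrite !ge_min !lexx !orbT.
have d0 : 0 < d by rewrite divr_gt0 // !lt_min d10 d20 subr_gt0 lt.
clearbody d.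
have udI : 0 <= u + d <= 1 by lra.
have ud : `|u - (u + d)| = d by rewrite opprD addrA subrr add0r normrN gtr0_norm.
have : u + d <= u.
  apply: ub_le_sup; first by case: hS.
  split=> //; split; [apply: hd1|apply: hd2]; rewrite // ud; lra.
by rewrite gerDl leNgt d0.
Qed.

End Family.

Section Contact.
Context {R : realType}.

(** An outer contact is an inner one for the dual annuli. Duality also reverses which pair is the
    smaller, which is why the second speeds must be ordered the other way. *)
Lemma no_contact (P : R) G1 A1 B1 G2 A2 B2 H1 C1 D1 H2 C2 D2 U V gU gV (a1 a2 : R * R -> R)
    (l1 l2 m1 m2 : R) :
  annulus P G1 A1 B1 G2 A2 B2 U gU -> annulus P H1 C1 D1 H2 C2 D2 V gV ->
  (forall p, 0 < a1 p) -> (forall p, 0 < a2 p) ->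
  (forall p, G1 p -> enorm (gU p) = l1 * a1 p) -> (forall p, G2 p -> enorm (gU p) = l2 * a2 p) ->
  (forall p, H1 p -> enorm (gV p) = m1 * a1 p) -> (forall p, H2 p -> enorm (gV p) = m2 * a2 p) ->
  l1 < m1 -> m2 < l2 -> A1 `<=` C1 -> A2 `<=` C2 ->
  (forall p, G1 p -> ~ H1 p) /\ (forall p, G2 p -> ~ H2 p).
Proof.
move=> hU hV a10 a20 e1 e2 e3 e4 lm1 lm2 AC1 AC2.
have DB1 := sides_le (inner_sides hU) (inner_sides hV) AC1.
split=> p Gp Hp.
  have := gradient_le hU hV AC2 DB1 Gp Hp.
  by rewrite e1 // e3 // ler_pM2r // leNgt lm1.
have := gradient_le (annulus_dual hV) (annulus_dual hU) DB1 AC2 Hp Gp.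
by rewrite !enormN e2 // e4 // ler_pM2r // leNgt lm2.
Qed.

End Contact.

(** * The three settings *)
Section Settings.
Context {R : realType}.
Implicit Types (S : setting R) (G : set (R * R)) (p : R * R).

Definition period S : R :=
  match S with Annular => 0 | Periodic P => P | PeriodicIn P _ _ _ => P end.

(** Non-emptiness of the first side matters for closed curves: it is supplied by regularity for the
    members of the family and by the order for the fixed solution. Periodic arcs provide it
    themselves. *)
Lemma curve_sides S G : valid_setting S -> curve S G -> compl1 S G !=set0 ->
  sides (period S) G (compl1 S G) (compl2 S G).
Proof.
case: S => [|P|P ? ? ?] /=.
- by move=> _ [g hg] iG; exact: closed_curve_sides hg iG.
- by move=> P0 [[g hg] pG wG] _; exact: periodic_arc_sides P0 hg pG wG.
- by move=> [P0 _] [[g hg] pG wG] _; exact: periodic_arc_sides P0 hg pG wG.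
Qed.

Lemma curve_side1_nonempty S G : valid_setting S -> S <> Annular -> curve S G ->
  compl1 S G !=set0.
Proof.
case: S => [//|P|P ? ? ?] /=.
- by move=> P0 _ [[g hg] pG wG]; exact: side1_nonempty (periodic_arc_sides P0 hg pG wG).
- by move=> [P0 _] _ [[g hg] pG wG]; exact: side1_nonempty (periodic_arc_sides P0 hg pG wG).
Qed.

Lemma curve_C3_side1_nonempty S rho G : valid_setting S -> curve S G -> curve_C3 S rho G ->
  compl1 S G !=set0.
Proof.
move=> hS cG; case: (pselect (S = Annular)) => [->|nS]; last first.
  by move=> _; exact: curve_side1_nonempty.
move=> [g hg [h0 h1 _]]; apply: (regular_int_compl hg); last exact: h1.
by move=> s; exact: (h0 0%N).
Qed.

(** The periodic order is a disjunction about lower or upper complements; passing to the opposite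
    sides turns the second alternative into the first. *)
Lemma curve_leP S G G' : sides (period S) G (compl1 S G) (compl2 S G) ->
  sides (period S) G' (compl1 S G') (compl2 S G') ->
  curve_le S G G' -> compl1 S G `<=` compl1 S G'.
Proof.
case: S => [|P|P ? ? ?] //= s t [//|h];
  exact: sides_le (sides_dual t) (sides_dual s) h.
Qed.

Lemma curve_ltP S G G' : sides (period S) G (compl1 S G) (compl2 S G) ->
  sides (period S) G' (compl1 S G') (compl2 S G') ->
  curve_lt S G G' -> closure (compl1 S G) `<=` compl1 S G'.
Proof.
case: S => [|P|P ? ? ?] //= s t [//|h];
  exact: sides_lt (sides_dual t) (sides_dual s) h.
Qed.

Lemma strip_bounded_mod (P : R) (G1 G2 : set (R * R)) : 0 < P ->
  periodic_arc P G1 -> periodic_arc P G2 ->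
  exists M, forall p, (lower_compl G2 `&` upper_compl G1) p -> exists n, `|sft P n p| <= M.
Proof.
move=> P0 [[g1 h1] p1 w1] [[g2 h2] p2 w2].
have s1 := periodic_arc_sides P0 h1 p1 w1; have s2 := periodic_arc_sides P0 h2 p2 w2.
have [M1 hM1] := arc_far P0 h1 p1 w1; have [M2 hM2] := arc_far P0 h2 p2 w2.
exists (P + `|M1| + `|M2|) => p [lp up]; pose n := Num.floor (p.1 / P); exists (- n).
have y1 : p.2 <= M2.
  by rewrite leNgt; apply/negP => /(hM2 p).1 h; exact: (sides_disjoint s2 lp h).
have y2 : - M1 <= p.2.
  by rewrite leNgt; apply/negP => /(hM1 p).2 h; exact: (sides_disjoint s1 h up).
have : 0 <= p.1 + (- n)%:~R * P < P.
  rewrite mulrNz mulNr; have := floor_itv (p.1 / P); rewrite -/n.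
  by rewrite ler_pdivlMr // ltr_pdivrMr // intrD mulrDl mul1r; lra.
move=> /andP[x1 x2]; rewrite prod_normE ge_max /sft /= addr0 !ler_norml.
have := ler_norm M1; have := ler_norm M2; have := normr_ge0 M1; have := normr_ge0 M2.
by move=> z1 z2 z3 z4; apply/andP; split; apply/andP; split; lra.
Qed.

Lemma classical_solution_annulus S (a1 a2 : R * R -> R) (lam : R * R)
    (G : set (R * R) * set (R * R)) : valid_setting S ->
  classical_solution S a1 a2 lam G -> compl1 S G.1 !=set0 ->
  exists (U : R * R -> R) (gU : R * R -> R * R),
  [/\ annulus (period S) G.1 (compl1 S G.1) (compl2 S G.1)
        G.2 (compl1 S G.2) (compl2 S G.2) U gU,
      forall p, G.1 p -> enorm (gU p) = lam.1 * a1 p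
    & forall p, G.2 p -> enorm (gU p) = lam.2 * a2 p].
Proof.
move=> hS [[c1 c2 lt _] [U [gU [[cU pU [[dU d1U d2U] lapU] u0 u1] [[dU' _ _] cg gE] e1 e2]]]] n1.
have n2 : compl1 S G.2 !=set0.
  have [e|nS] := pselect (S = Annular); last exact: curve_side1_nonempty.
  by subst S; have [p Dp] := n1; exists p; apply: lt; exact: subset_closure.
have s1 := curve_sides hS c1 n1; have s2 := curve_sides hS c2 n2.
have lt1 := curve_ltP s1 s2 lt.
have perO n p : Omega S G p -> Omega S G (sft (period S) n p).
  by move=> [Ap Bp]; split; [exact: side1_periodic s2 _ _ Ap|exact: side2_periodic s1 _ _ Bp].
exists U, gU; split=> //; split=> //.
- exact: (sides_lt s1 s2 lt1).
- case: S hS c1 c2 lt cU pU dU d1U d2U lapU dU' cg gE n1 n2 s1 s2 lt1 perO {e1 e2} => [|P|P X X1 X2] hS c1 c2 *.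
  + have [g hg] := c2; have [M hM] := curve_bounded hg; exists `|M| => p [ip _].
    by exists 0; rewrite sft_period0; exact: (int_compl_bounded hM ip).
  + exact: strip_bounded_mod.
  + by case: hS => P0 _; exact: strip_bounded_mod.
- move=> n p; have h1 q : closure (Omega S G) q -> U (sft (period S) 1 q) = U q.
    case: S pU {hS c1 c2 lt cU dU d1U d2U lapU dU' cg gE n1 n2 s1 s2 lt1 perO} => [|P|P X X1 X2] /= pU clq.
    - by rewrite sft_period0.
    - by rewrite /sft mul1r; exact: pU.
    - by rewrite /sft mul1r; exact: pU.
  have hn (k : nat) : forall q, closure (Omega S G) q -> U (sft (period S) k q) = U q.
    elim: k => [|k IH] q clq; first by rewrite sft0.
    by rewrite intS -sftD h1 ?IH //; apply: closure_sft.
  case: n => k clp; first exact: hn.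
  (* Periodicity is given for forward shifts; a backward shift is undone by a forward one applied at
     the shifted point, which is still in the closure. *)
  rewrite NegzE -[RHS](_ : U (sft (period S) k.+1 (sft (period S) (- k.+1%:Z) p)) = _).
    by rewrite hn //; exact: closure_sft.
  by rewrite sftD subrr sft0.
- exists ('D_e_x U), ('D_e_y U), ('D_e_x ('D_e_x U)), ('D_e_y ('D_e_y U)) => p Op.
  have [x1 y1] := dU p Op; have [dx _ _] := d1U; have [dy _ _] := d2U.
  have [x2 _] := dx p Op; have [_ y2] := dy p Op.
  by split; [exact: (derivableP x1)|exact: (derivableP y1)|exact: (derivableP x2)
    |exact: (derivableP y2)|exact: (lapU p Op)].
move=> p Op; rewrite gE //=; have [x1 y1] := dU p Op.
by split; [exact: (derivableP x1)|exact: (derivableP y1)].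
Qed.

Lemma hausdorff_dist_lt (A B : set (R * R)) (r : R) : (hausdorff_dist A B < r%:E)%E ->
  forall q, A q -> exists2 q', B q' & `|q - q'| < r.
Proof.
rewrite /hausdorff_dist gt_max => /andP[h _] q Aq.
have hq : (setdist q B < r%:E)%E.
  by apply: le_lt_trans h; apply: ereal_sup_ubound; exists q.
apply: contrapT => no; move: hq; apply/negP; rewrite -leNgt.
apply: le_ereal_inf_tmp => _ [q' Bq' <-]; rewrite lee_fin leNgt; apply/negP => lt.
by apply: no; exists q' => //; apply: le_lt_trans lt; exact: normr_le_enorm.
Qed.

Lemma hausdorff_cvg_near (F : R -> set (R * R)) (t : R) :
  (hausdorff_dist (F s) (F t) @[s --> t] --> 0%E) -> forall r, 0 < r ->
  exists2 del, 0 < del & forall s, `|t - s| < del ->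
    forall q, F s q -> exists2 q', F t q' & `|q - q'| < r.
Proof.
move=> cF r r0; have h0 : (0 < r%:E)%E by rewrite lte_fin.
have := cF _ (open_ereal_lt' h0) => /nbhs_ballP[del /= del0 hdel].
by exists del => // s ts; apply: hausdorff_dist_lt; exact: hdel.
Qed.

Lemma affine_parameter (F : R -> set (R * R)) (a b : R) (r u : R) :
  (exists2 del, 0 < del & forall s, `|a + u * (b - a) - s| < del ->
    forall q, F s q -> exists2 q', F (a + u * (b - a)) q' & `|q - q'| < r) ->
  exists2 del, 0 < del & forall u', 0 <= u' <= 1 -> `|u - u'| < del ->
    forall q, F (a + u' * (b - a)) q -> exists2 q', F (a + u * (b - a)) q' & `|q - q'| < r.
Proof.
move=> [del del0 hdel]; pose k := `|b - a| + 1.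
have k0 : 0 < k by rewrite ltr_wpDl.
exists (del / k); first by rewrite divr_gt0.
move=> u' _ uu'; apply: hdel.
have -> : a + u * (b - a) - (a + u' * (b - a)) = (u - u') * (b - a) by ring.
rewrite normrM; apply: le_lt_trans (_ : `|u - u'| * k < del).
  by rewrite ler_wpM2l // /k lerDl.
by rewrite -ltr_pdivlMr.
Qed.

End Settings.

Theorem theorem4p9 (R : realType) (S : setting R) (hS : valid_setting S)
  (a1 a2 : R * R -> R) (ha1 : flow_speed S a1) (ha2 : flow_speed S a2)
  (I : set R) (Iopen : open I) (Iitv : is_interval I)
  (lam : R -> R * R)
  (lam_cont : {within closure I, continuous lam})
  (lam_pos : forall t, closure I t -> 0 < (lam t).1 /\ 0 < (lam t).2)
  (lam1_incr : forall s t, I s -> I t -> s < t -> (lam s).1 < (lam t).1)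
  (lam2_decr : forall s t, I s -> I t -> s < t -> (lam t).2 < (lam s).2)
  (Gam : R -> set (R * R) * set (R * R))
  (Gam_sol : solution_family S a1 a2 I lam Gam)
  (Gam_cont : continuously_varying I Gam)
  (Gam_ord : positively_ordered S I Gam)
  (tau : R) (Itau : I tau)
  (tGam : set (R * R) * set (R * R))
  (tGam_sol : classical_solution S a1 a2 (lam tau) tGam)
  (sandwich : exists alpha beta : R,
     [/\ I alpha, I beta, alpha < tau, tau < beta
       & pair_le S (Gam alpha) tGam /\ pair_le S tGam (Gam beta)]) :
  tGam = Gam tau.
Proof.
have [alpha [beta [Ia Ib at_ tb [[le1 le2] [le3 le4]]]]] := sandwich.
have [[rho _ C3] sol] := Gam_sol.
have II t : alpha <= t <= beta -> I t by move=> h; exact: (Iitv alpha beta).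
have ne1 t : I t -> compl1 S (Gam t).1 !=set0.
  by move=> It; have [[c1 _ _ _] _] := sol t It; exact: curve_C3_side1_nonempty hS c1 (C3 t It).1.
have ann t (It : I t) := classical_solution_annulus hS (sol t It) (ne1 t It).
have s1 t : I t -> sides (period S) (Gam t).1 (compl1 S (Gam t).1) (compl2 S (Gam t).1).
  by move=> /ann[U [gU [h _ _]]]; exact: inner_sides h.
have s2 t : I t -> sides (period S) (Gam t).2 (compl1 S (Gam t).2) (compl2 S (Gam t).2).
  by move=> /ann[U [gU [h _ _]]]; exact: outer_sides h.
(* In the annular setting the interior of [tGam.1] contains that of the member at [alpha], which is
   non-empty by regularity. *)
have tne : compl1 S tGam.1 !=set0.
  have [e|nS] := pselect (S = Annular).
    by move: le1 (ne1 _ Ia); rewrite e /= => le1 [p hp]; exists p; exact: le1.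
  by have [[c1 _ _ _] _] := tGam_sol; exact: curve_side1_nonempty.
have [V [gV [annV eV1 eV2]]] := classical_solution_annulus hS tGam_sol tne.
have t1 := inner_sides annV; have t2 := outer_sides annV.
have a1b1 := curve_leP (s1 _ Ia) t1 le1; have a1b2 := curve_leP (s2 _ Ia) t2 le2.
have b1b1 := curve_leP t1 (s1 _ Ib) le3; have b1b2 := curve_leP t2 (s2 _ Ib) le4.
have mono1 s t : I s -> I t -> s < t -> compl1 S (Gam s).1 `<=` compl1 S (Gam t).1.
  move=> Is It st; have [l _] := Gam_ord _ _ Is It st.
  by apply: subset_trans (curve_ltP (s1 _ Is) (s1 _ It) l); exact: subset_closure.
have mono2 s t : I s -> I t -> s < t -> compl1 S (Gam s).2 `<=` compl1 S (Gam t).2.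
  move=> Is It st; have [_ l] := Gam_ord _ _ Is It st.
  by apply: subset_trans (curve_ltP (s2 _ Is) (s2 _ It) l); exact: subset_closure.
have [a10 _ _] := ha1; have [a20 _ _] := ha2.
have cont1 t : I t -> forall r, 0 < r -> exists2 del, 0 < del & forall s, `|t - s| < del ->
    forall q, (Gam s).1 q -> exists2 q', (Gam t).1 q' & `|q - q'| < r.
  by move=> It; exact: hausdorff_cvg_near (Gam_cont _ It).1.
have cont2 t : I t -> forall r, 0 < r -> exists2 del, 0 < del & forall s, `|t - s| < del ->
    forall q, (Gam s).2 q -> exists2 q', (Gam t).2 q' & `|q - q'| < r.
  by move=> It; exact: hausdorff_cvg_near (Gam_cont _ It).2.
have lower : compl1 S (Gam tau).1 `<=` compl1 S tGam.1 /\ compl1 S (Gam tau).2 `<=` compl1 S tGam.2.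
  pose t u := alpha + u * (tau - alpha).
  have tI u : 0 <= u <= 1 -> I (t u) by move=> hu; apply: II; rewrite /t; nra.
  have t_tau : t 1 = tau by rewrite /t mul1r subrKC.
  have t_alpha : t 0 = alpha by rewrite /t mul0r addr0.
  have t_lt u u' : u < u' -> t u < t u' by move=> h; rewrite /t ltrD2l ltr_pM2r ?subr_gt0.
  have tb1 u : 0 <= u <= 1 -> t u < beta.
    by move=> /andP[_]; rewrite le_eqVlt => /orP[/eqP ->|/t_lt]; rewrite t_tau // => /lt_trans; apply.
  have := @family_le R (period S) (fun u => (Gam (t u)).1) (fun u => compl1 S (Gam (t u)).1)
    (fun u => compl2 S (Gam (t u)).1) (fun u => (Gam (t u)).2) (fun u => compl1 S (Gam (t u)).2)
    (fun u => compl2 S (Gam (t u)).2) tGam.1 (compl1 S tGam.1) (compl2 S tGam.1)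
    tGam.2 (compl1 S tGam.2) (compl2 S tGam.2).
  rewrite t_tau t_alpha; apply=> //.
  - by move=> u /tI; exact: s1.
  - by move=> u /tI; exact: s2.
  - by move=> u u' /tI Iu /tI Iu' /t_lt; exact: mono1.
  - by move=> u u' /tI Iu /tI Iu' /t_lt; exact: mono2.
  - by move=> u /tI Iu r r0; apply: (affine_parameter (F := fun s => (Gam s).1)); exact: cont1.
  - by move=> u /tI Iu r r0; apply: (affine_parameter (F := fun s => (Gam s).2)); exact: cont2.
  (* A point beyond the member at [beta] is beyond [tGam] and beyond every member met on the way to
     [tau]; it is the anchor that the continuation requires. *)
  - have [q Bq] := side2_nonempty (s1 _ Ib); exists q; split.
      exact: sides_le t1 (s1 _ Ib) b1b1 q Bq.
    move=> u hu; exact: (sides_le (s1 _ (tI u hu)) (s1 _ Ib) (mono1 _ _ (tI u hu) Ib (tb1 u hu))) q Bq.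
  - have [q Bq] := side2_nonempty (s2 _ Ib); exists q; split.
      exact: sides_le t2 (s2 _ Ib) b1b2 q Bq.
    move=> u hu; exact: (sides_le (s2 _ (tI u hu)) (s2 _ Ib) (mono2 _ _ (tI u hu) Ib (tb1 u hu))) q Bq.
  move=> u /andP[u0 u1] AC1 AC2.
  have Iu : I (t u) by apply: tI; rewrite u0 ltW.
  have lt : t u < tau by rewrite -t_tau; exact: t_lt.
  have [U [gU [annU eU1 eU2]]] := ann _ Iu.
  exact: (no_contact annU annV a10 a20 eU1 eU2 eV1 eV2 (lam1_incr _ _ Iu Itau lt)
    (lam2_decr _ _ Iu Itau lt) AC1 AC2).
have upper : compl2 S (Gam tau).1 `<=` compl2 S tGam.1 /\ compl2 S (Gam tau).2 `<=` compl2 S tGam.2.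
  (* The parameter now decreases from [beta] to [tau]. With the two sides of every curve exchanged
     the family increases again, so the same continuation applies, anchored at points inside the
     member at [alpha]. *)
  pose t u := beta + u * (tau - beta).
  have tI u : 0 <= u <= 1 -> I (t u) by move=> hu; apply: II; rewrite /t; nra.
  have t_tau : t 1 = tau by rewrite /t mul1r subrKC.
  have t_beta : t 0 = beta by rewrite /t mul0r addr0.
  have t_lt u u' : u < u' -> t u' < t u by move=> h; rewrite /t ltrD2l ltr_nM2r ?subr_lt0.
  have ta u : 0 <= u <= 1 -> alpha < t u.
    by move=> /andP[_]; rewrite le_eqVlt => /orP[/eqP ->|/t_lt]; rewrite t_tau // => /(lt_trans at_).
  have := @family_le R (period S) (fun u => (Gam (t u)).1) (fun u => compl2 S (Gam (t u)).1)
    (fun u => compl1 S (Gam (t u)).1) (fun u => (Gam (t u)).2) (fun u => compl2 S (Gam (t u)).2)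
    (fun u => compl1 S (Gam (t u)).2) tGam.1 (compl2 S tGam.1) (compl1 S tGam.1)
    tGam.2 (compl2 S tGam.2) (compl1 S tGam.2).
  rewrite t_tau t_beta; apply=> //.
  - by move=> u /tI /s1; exact: sides_dual.
  - by move=> u /tI /s2; exact: sides_dual.
  - exact: sides_dual.
  - exact: sides_dual.
  - by move=> u u' /tI Iu /tI Iu' /t_lt lt; exact: sides_le (s1 _ Iu') (s1 _ Iu) (mono1 _ _ Iu' Iu lt).
  - by move=> u u' /tI Iu /tI Iu' /t_lt lt; exact: sides_le (s2 _ Iu') (s2 _ Iu) (mono2 _ _ Iu' Iu lt).
  - by move=> u /tI Iu r r0; apply: (affine_parameter (F := fun s => (Gam s).1)); exact: cont1.
  - by move=> u /tI Iu r r0; apply: (affine_parameter (F := fun s => (Gam s).2)); exact: cont2.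
  - have [q Aq] := side1_nonempty (s1 _ Ia); exists q; split; first exact: a1b1.
    by move=> u hu; exact: (mono1 _ _ Ia (tI u hu) (ta u hu) q Aq).
  - have [q Aq] := side1_nonempty (s2 _ Ia); exists q; split; first exact: a1b2.
    by move=> u hu; exact: (mono2 _ _ Ia (tI u hu) (ta u hu) q Aq).
  - exact: sides_le t1 (s1 _ Ib) b1b1.
  - exact: sides_le t2 (s2 _ Ib) b1b2.
  move=> u /andP[u0 u1] BD1 BD2.
  have Iu : I (t u) by apply: tI; rewrite u0 ltW.
  have lt : tau < t u by rewrite -t_tau; exact: t_lt.
  have [U [gU [annU eU1 eU2]]] := ann _ Iu.
  have CA1 := sides_le (sides_dual (s1 _ Iu)) (sides_dual t1) BD1.
  have CA2 := sides_le (sides_dual (s2 _ Iu)) (sides_dual t2) BD2.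
  (* Here [tGam] is the smaller pair and [tau < t u], so its potential and speeds take the first
     place. *)
  have [no1 no2] := no_contact annV annU a10 a20 eV1 eV2 eU1 eU2 (lam1_incr _ _ Itau Iu lt)
    (lam2_decr _ _ Itau Iu lt) CA1 CA2.
  by split=> p Gp Hp; [exact: no1 Hp Gp|exact: no2 Hp Gp].
have eq1 : compl1 S (Gam tau).1 = compl1 S tGam.1.
  apply/seteqP; split; first exact: lower.1.
  exact: sides_le (sides_dual (s1 _ Itau)) (sides_dual t1) upper.1.
have eq2 : compl1 S (Gam tau).2 = compl1 S tGam.2.
  apply/seteqP; split; first exact: lower.2.
  exact: sides_le (sides_dual (s2 _ Itau)) (sides_dual t2) upper.2.
have := s1 _ Itau; have := s2 _ Itau; rewrite eq1 eq2 => s2' s1'.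
rewrite [tGam]surjective_pairing [Gam tau]surjective_pairing.
by rewrite (sides_eq t1 s1') (sides_eq t2 s2').
Qed.
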